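(* Let $n\ge 2$. For all $N\in\mathbb N$ there exists a family $\{\Omega_{\varepsilon,N}\}_{\varepsilon\in(0,\varepsilon_0)}$ (for some $\varepsilon_0>0$) of bounded Lipschitz domains of the Euclidean space $\mathbb R^n$ such that $$\lim_{\varepsilon\to0^+}\frac{\mu_j}{m_j^2}=0$$ for all $N+2\le j\le (N+1)(n+1)$, where $\mu_j=\mu_j(\Omega_{\varepsilon,N})$ and $m_j=m_j(\Omega_{\varepsilon,N})$ denote respectively the biharmonic Neumann eigenvalues and the Neumann eigenvalues of the Laplacian on $\Omega_{\varepsilon,N}$.
   Context: $\mathbb N$ is the set of positive integers; a domain is a connected open set. For a bounded Lipschitz domain $\Omega\subset\mathbb R^n$, the biharmonic Neumann eigenvalues $\mu_1\le\mu_2\le\cdots$ (repeated according to multiplicity) are the eigenvalues of the problem $\int_\Omega\langle D^2u,D^2\phi\rangle dv=\mu\int_\Omega u\phi\,dv$ for all $\phi\in H^2(\Omega)$, with $u\in H^2(\Omega)$, $\mu\in\mathbb R$; equivalently $$\mu_j=\min_{\substack{U\subset H^2(\Omega)\\ \dim U=j}}\max_{0\ne u\in U}\frac{\int_\Omega|D^2u|^2dv}{\int_\Omega u^2dv}.$$ The Neumann eigenvalues of the Laplacian are $$m_j=\min_{\substack{U\subset H^1(\Omega)\\ \dim U=j}}\max_{0\ne u\in U}\frac{\int_\Omega|\nabla u|^2dv}{\int_\Omega u^2dv}.$$ Here $H^1(\Omega),H^2(\Omega)$ are the standard Sobolev spaces. *)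

(* Defs.v *)
From HB Require Import structures.
From mathcomp Require Import all_boot all_order all_algebra.
From mathcomp Require Import all_classical all_reals all_analysis.

Set Implicit Arguments.
Unset Strict Implicit.
Unset Printing Implicit Defensive.

Import Order.TTheory GRing.Theory Num.Theory.
Import numFieldNormedType.Exports.

Local Open Scope classical_set_scope.
Local Open Scope ring_scope.

(* The sigma-algebra on R^n = ['rV[R]_n] generated by the coordinates, i.e. the
   Borel sets, as for [n.-tuple R] in the library. *)
Section measurable_rV.
Context {R : realType}.
Variable n : nat.

Definition rV_coord (i : 'I_n) (x : 'rV[R]_n) : measurableTypeR R := x ord0 i.

Let rV_set0 : g_sigma_preimage rV_coord set0.
Proof. exact: sigma_algebra0. Qed.

Let rV_setC A : g_sigma_preimage rV_coord A -> g_sigma_preimage rV_coord (~` A).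
Proof. exact: sigma_algebraC. Qed.

Let rV_bigcup (F : (set 'rV[R]_n)^nat) :
  (forall i, g_sigma_preimage rV_coord (F i)) ->
  g_sigma_preimage rV_coord (\bigcup_i F i).
Proof. exact: sigma_algebra_bigcup. Qed.

HB.instance Definition _ := @isMeasurable.Build
  (measure_tuple_display default_measure_display)
  'rV[R]_n (g_sigma_preimage rV_coord) rV_set0 rV_setC rV_bigcup.

End measurable_rV.

Lemma measurable_rV_coord (R : realType) n (i : 'I_n) :
  measurable_fun [set: 'rV[R]_n] (rV_coord i).
Proof.
move=> _ Y mY; rewrite setTI; apply: sub_sigma_algebra => /=.
rewrite -bigcup_seq/=; exists i => /=; first by rewrite mem_index_enum.
by exists Y => //; rewrite setTI.
Qed.

Lemma measurable_fun_rV d (T : measurableType d) (R : realType) n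
    (f : T -> 'rV[R]_n) :
  (forall i, measurable_fun [set: T] (rV_coord i \o f)) ->
  measurable_fun [set: T] f.
Proof.
move=> mf _ A mA; rewrite setTI.
suff: g_sigma_preimage (fun i => @rV_coord R n i \o f) `<=` measurable.
  apply; rewrite g_sigma_preimage_comp.
  by exists A => //; rewrite setTI.
apply: smallest_sub; first exact: sigma_algebra_measurable.
rewrite -bigcup_seq; apply: bigcup_sub => i _ _ [B mB <-]; exact: mf.
Qed.

Section lebesgue_step.
Context {R : realType}.
Variables (n : nat) (mu : {sigma_finite_measure set 'rV[R]_n -> \bar R}).

Definition rV_cons (p : measurableTypeR R * 'rV[R]_n) : 'rV[R]_n.+1 :=
  row_mx (const_mx (p.1 : R) : 'rV[R]_1) p.2.

Definition rV_uncons (x : 'rV[R]_n.+1) : measurableTypeR R * 'rV[R]_n :=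
  (x ord0 ord0, \row_i x ord0 (lift ord0 i)).

Lemma rV_consK : cancel rV_cons rV_uncons.
Proof.
move=> [a v]; rewrite /rV_uncons /rV_cons /=; congr pair.
  transitivity ((const_mx a : 'rV[R]_1) ord0 ord0); last by rewrite mxE.
  rewrite -[RHS](row_mxEl _ v).
  by congr (fun_of_matrix _ _ _); exact/val_inj.
apply/rowP => i; rewrite mxE -[RHS](row_mxEr (const_mx a : 'rV[R]_1)).
by congr (fun_of_matrix _ _ _); exact/val_inj.
Qed.

Lemma measurable_rV_cons : measurable_fun setT rV_cons.
Proof.
apply: measurable_fun_rV => i.
case: (split_ordP (i : 'I_(1 + n))) => j ->.
  rewrite (_ : _ \o _ = fst); first exact: measurable_fst.
  apply/funext => p /=; transitivity ((const_mx (p.1 : R) : 'rV[R]_1) ord0 j).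
    exact: row_mxEl.
  by rewrite mxE.
rewrite (_ : _ \o _ = rV_coord j \o snd).
  by apply: measurableT_comp; [exact: measurable_rV_coord|exact: measurable_snd].
by apply/funext => p /=; exact: row_mxEr.
Qed.

Lemma measurable_rV_uncons : measurable_fun setT rV_uncons.
Proof.
apply/measurable_fun_pairP; split.
  exact: (@measurable_rV_coord R n.+1 ord0).
apply: measurable_fun_rV => i.
rewrite (_ : _ \o _ = rV_coord (lift ord0 i)); first exact: measurable_rV_coord.
by apply/funext => x /=; rewrite /rV_coord mxE.
Qed.

Definition lebesgue_step : set 'rV[R]_n.+1 -> \bar R :=
  pushforward ((@lebesgue_measure R) \x mu)%E rV_cons.

Let step0 : lebesgue_step set0 = 0%E.
Proof. by rewrite /lebesgue_step /pushforward preimage_set0 measure0. Qed.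

Let step_ge0 A : (0 <= lebesgue_step A)%E.
Proof. exact: (measure_ge0 (@lebesgue_measure R \x mu)%E). Qed.

Let step_sigma_additive : semi_sigma_additive lebesgue_step.
Proof.
move=> F mF tF mUF; rewrite /lebesgue_step /pushforward preimage_bigcup.
have mcons A : measurable A -> measurable (rV_cons @^-1` A).
  by move=> mA; rewrite -[X in measurable X]setTI; exact: measurable_rV_cons.
apply: (measure_semi_sigma_additive (s := (@lebesgue_measure R \x mu)%E)).
- by move=> k; exact: mcons.
- apply/trivIsetP => /= i j _ _ ij; rewrite -preimage_setI.
  by move/trivIsetP : tF => /(_ _ _ _ _ ij) ->//; rewrite preimage_set0.
- by rewrite -preimage_bigcup; exact: mcons.
Qed.

HB.instance Definition _ := isMeasure.Build _ _ _ lebesgue_step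
  step0 step_ge0 step_sigma_additive.

Let step_sigma_finite : sigma_finite setT lebesgue_step.
Proof.
have /sigma_finiteP[F [TF ndF Foo]] := sigma_finiteT (@lebesgue_measure R).
have /sigma_finiteP[G [TG ndG Goo]] := sigma_finiteT mu.
exists (fun k => rV_uncons @^-1` (F k `*` G k)).
  rewrite -preimage_bigcup -[LHS](preimage_setT rV_uncons); congr preimage.
  rewrite -setXTT TF TG predeqE => -[x y]; split; last first.
    by move=> [k _ []/= ? ?]; split; exists k.
  move=> [/= [k _ Fkx] [l _ Gly]]; exists (maxn k l) => //; split.
    by move: x Fkx; exact/subsetPset/ndF/leq_maxl.
  by move: y Gly; exact/subsetPset/ndG/leq_maxr.
move=> k; have [? ?] := Foo k; have [? ?] := Goo k; split.
  rewrite -[X in measurable X]setTI.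
  by apply: measurable_rV_uncons => //; exact: measurableX.
rewrite /lebesgue_step /pushforward -comp_preimage.
rewrite (_ : _ \o _ = id); last by apply/funext => p; exact: rV_consK.
by rewrite preimage_id product_measure1E// lte_mul_pinfty// ge0_fin_numE.
Qed.

HB.instance Definition _ := Measure_isSigmaFinite.Build _ _ _ lebesgue_step
  step_sigma_finite.

End lebesgue_step.

(* n-dimensional Lebesgue measure, by recursion on n through R^n+1 = R x R^n. *)
Fixpoint lebesgue_rV (R : realType) (n : nat) :
    {sigma_finite_measure set 'rV[R]_n -> \bar R} :=
  if n is m.+1 then lebesgue_step (lebesgue_rV R m) else \d_(0 : 'rV[R]_0).

Section lipschitz_domains.
Context {R : realType} {n : nat}.
Implicit Types (x e : 'rV[R]_n) (Omega : set 'rV[R]_n).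

Definition dotv x e : R := \sum_(i < n) x ord0 i * e ord0 i.

(* Near the boundary point [x], Omega is the strict epigraph of a Lipschitz
   function over the hyperplane orthogonal to the unit vector [e]; here
   [y - dotv y e *: e] is the projection of [y] on this hyperplane, so only the
   values of [f] on the hyperplane matter. *)
Definition lipschitz_boundary_at Omega x :=
  exists (e : 'rV[R]_n) (f : 'rV[R]_n -> R),
    [/\ dotv e e = 1, lipschitz f &
        \forall y \near x, Omega y <-> f (y - dotv y e *: e) < dotv y e].

Definition bounded_lipschitz_domain Omega :=
  [/\ open Omega, Omega !=set0, connected Omega, bounded_set Omega &
      forall x, (closure Omega `\` Omega) x -> lipschitz_boundary_at Omega x].

End lipschitz_domains.

Section sobolev.
Context {R : realType} {n : nat}.
Implicit Types (Omega : set 'rV[R]_n) (u g phi : 'rV[R]_n -> R) (k : nat).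
Local Notation leb := (lebesgue_rV R n).

(* A sequence [s] of indices encodes the differential operator
   d_(s_1) ... d_(s_k) of order [size s]. *)
Fixpoint partials (s : seq 'I_n) phi : 'rV[R]_n -> R :=
  if s is i :: s' then fun x => 'D_(delta_mx ord0 i) (partials s' phi) x
  else phi.

Definition smooth phi := forall s : seq 'I_n,
  continuous (partials s phi) /\
  forall i x, derivable (partials s phi) x (delta_mx ord0 i).

Definition test_function Omega phi :=
  [/\ smooth phi, compact (closure [set x | phi x != 0]) &
      closure [set x | phi x != 0] `<=` Omega].

Definition square_integrable Omega u :=
  measurable_fun Omega u /\
  (\int[leb]_(x in Omega) ((u x) ^+ 2)%:E < +oo)%E.

Definition is_weak_partials Omega (s : seq 'I_n) u g :=
  forall phi, test_function Omega phi ->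
    \int[leb]_(x in Omega) (u x * partials s phi x) =
    (-1) ^+ size s * \int[leb]_(x in Omega) (g x * phi x).

(* H^k(Omega) = W^{k,2}(Omega); its elements are functions on R^n of which only
   the values almost everywhere in Omega matter. *)
Definition sobolev k Omega u :=
  square_integrable Omega u /\
  forall s : seq 'I_n, (size s <= k)%N ->
    exists g, square_integrable Omega g /\ is_weak_partials Omega s u g.

(* The weak derivative, which is unique almost everywhere in Omega. *)
Definition weak_partials Omega (s : seq 'I_n) u : 'rV[R]_n -> R :=
  xget (fun=> 0)
    [set g | square_integrable Omega g /\ is_weak_partials Omega s u g].

(* |grad u|^2 *)
Definition sqnorm_grad Omega u x : R :=
  \sum_(i < n) (weak_partials Omega [:: i] u x) ^+ 2.

(* |D^2 u|^2 *)
Definition sqnorm_hess Omega u x : R :=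
  \sum_(i < n) \sum_(j < n) (weak_partials Omega [:: i; j] u x) ^+ 2.

Definition lincomb j (b : 'I_j -> 'rV[R]_n -> R) (c : 'rV[R]_j) x : R :=
  \sum_(i < j) c ord0 i * b i x.

(* Linear independence modulo equality almost everywhere in Omega. *)
Definition ae_free Omega j (b : 'I_j -> 'rV[R]_n -> R) :=
  forall c : 'rV[R]_j,
    {ae leb, forall x, Omega x -> lincomb b c x = 0} -> c = 0.

Definition rayleigh Omega (density : ('rV[R]_n -> R) -> 'rV[R]_n -> R) u : R :=
  (\int[leb]_(x in Omega) density u x) / (\int[leb]_(x in Omega) (u x) ^+ 2).

(* The min-max formula over the j-dimensional subspaces U of H^k(Omega): U is
   given by a basis [b], and its elements by their coordinates [c].  The minimum
   and maximum are taken as infimum and supremum in the extended reals. *)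
Definition minmax k Omega (density : ('rV[R]_n -> R) -> 'rV[R]_n -> R) (j : nat)
    : \bar R :=
  ereal_inf [set ereal_sup [set (rayleigh Omega density (lincomb b c))%:E
                               | c in [set c : 'rV[R]_j | c != 0]]
            | b in [set b : 'I_j -> 'rV[R]_n -> R
                   | (forall i, sobolev k Omega (b i)) /\ ae_free Omega b]].

Definition biharmonic_neumann Omega (j : nat) : \bar R :=
  minmax 2 Omega (sqnorm_hess Omega) j.

Definition laplace_neumann Omega (j : nat) : \bar R :=
  minmax 1 Omega (sqnorm_grad Omega) j.

End sobolev.

(* Main.v *)
From HB Require Import structures.
Require Import Defs.
From mathcomp Require Import all_boot all_order all_algebra.
From mathcomp Require Import all_classical all_reals all_analysis.
From mathcomp Require Import measurable_realfun perm ring lra.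

(** The domain is a dumbbell: N+1 fixed rooms, unit segments times a cube
    ]-1, 1[^(n-1), threaded along one axis by a tube of half-width eps (see
    [dumbbell]).  The theorem compares two counts on it.

    Only N+1 eigenvalues of the Laplacian can degenerate.  A function whose mean
    vanishes in every room satisfies a Poincare inequality with a constant
    independent of eps ([spectral_gap]): in each room this is the Poincare
    inequality of a box, and in the tube the values are transported along the
    axis from the first room, at a cost that involves the length of the tube but
    not its width ([tube_estimate]).  The vanishing of N+1 means leaves a nonzero
    vector in every space of dimension at least N+2, so m_j is bounded below
    uniformly in eps as soon as j >= N+2 ([laplace_dumbbell_ge]).

    The Hessian vanishes on affine functions, so many more biharmonic
    eigenvalues degenerate.  Multiplying each of 1, x_1, .., x_n by a cutoff that
    equals 1 in one room and 0 in the others, with its transitions in the gaps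
    between rooms, gives (N+1)(n+1) test functions that are affine in all the
    rooms.  They are linearly independent already on the rooms, where their
    Gram matrix does not depend on eps; their Hessians are bounded and live in
    the tube only.  Hence mu_j is at most a constant times the volume of the
    tube for j <= (N+1)(n+1) ([dumbbell_upper_bounds]).  This volume tends to 0
    and so does the quotient.

    The Poincare inequality is obtained without density of smooth functions in
    Sobolev spaces.  Along one coordinate, a smooth function is an average of
    its values plus the integral of its derivative against an explicit kernel;
    testing against products of one-dimensional bumps, this formula passes to
    weak derivatives ([ae_representation], a consequence of
    [fundamental_lemma]).  It bounds the distance to a function independent of
    that coordinate ([one_direction_poincare]), and changing the coordinates one
    at a time gives the inequality on a box ([poincare_box]).

    For the Lipschitz boundary, a single direction d with coordinates 1 and -1
    leaves, near a given boundary point, every half-space that bounds a room or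
    the tube and whose boundary contains that point.  In such a direction
    half-spaces are sublevel sets of Lipschitz functions that grow at unit
    speed, a class closed under maxima and minima ([local_epigraph]). *)

Set Implicit Arguments.
Unset Strict Implicit.
Unset Printing Implicit Defensive.

Import Order.TTheory GRing.Theory Num.Theory.
Import numFieldNormedType.Exports.

Local Open Scope classical_set_scope.
Local Open Scope ring_scope.

(** * Boxes and Lebesgue measure *)

Section boxes.
Context {R : realType} {n : nat}.
Implicit Types (a b : 'I_n -> R).

Definition box a b : set 'rV[R]_n :=
  [set x | forall i, a i < x ord0 i < b i].

Lemma box_bigcap a b :
  box a b = \bigcap_(i in [set: 'I_n]) (rV_coord i @^-1` `]a i, b i[).
Proof.
apply/seteqP; split => x /=.
  by move=> abx i _ /=; rewrite in_itv/=; exact: abx.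
by move=> abx i; have := abx i Logic.I; rewrite /= in_itv.
Qed.

Lemma measurable_box a b : measurable (box a b).
Proof.
rewrite box_bigcap; apply: fin_bigcap_measurable => // i _.
by rewrite -[X in measurable X]setTI; exact: measurable_rV_coord.
Qed.

Lemma boxI a b a' b' : box a b `&` box a' b' =
  box (fun i => Num.max (a i) (a' i)) (fun i => Num.min (b i) (b' i)).
Proof.
apply/seteqP; split => x.
  move=> [abx abx'] i; rewrite gt_max lt_min.
  by move: (abx i) (abx' i) => /andP[aix xbi] /andP[aix' xbi']; apply/andP; split; apply/andP.
move=> H; split => i; have := H i; rewrite gt_max lt_min.
  by move=> /andP[/andP[aix _] /andP[xbi _]]; apply/andP.
by move=> /andP[/andP[_ aix] /andP[_ xbi]]; apply/andP.
Qed.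

Lemma bigcup_box : \bigcup_k box (fun=> - k%:R) (fun=> k%:R) = setT.
Proof.
rewrite -subTset => x _.
exists (Num.trunc (\sum_i `|x ord0 i|)).+1 => //= i.
rewrite -ltr_norml; apply: le_lt_trans (truncnS_gt _).
by rewrite (bigD1 i)//= lerDl sumr_ge0.
Qed.

(** Boxes are closed under intersection, so a measure on R^n is determined by
    its values on them once they generate the sigma-algebra; a half-space is a
    countable union of boxes. *)
Lemma measurable_rVE :
  @measurable _ 'rV[R]_n = <<s [set box ab.1 ab.2 | ab in setT] >>.
Proof.
apply/seteqP; split; last first.
  apply: smallest_sub; first exact: sigma_algebra_measurable.
  by move=> _ [ab _ <-]; exact: measurable_box.
set G := [set _ | _ in _].
apply: smallest_sub; first exact: smallest_sigma_algebra.
rewrite -bigcup_seq; apply: bigcup_sub => i _ _ [B mB <-].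
suff : measurable_fun [set: g_sigma_algebraType G]
    (rV_coord i : g_sigma_algebraType G -> measurableTypeR R).
  by apply.
apply: (measurability _ (measurable_realfun.RGenOInfty.measurableE R)).
move=> _ [_ [x ->] <-]; rewrite setTI.
rewrite (_ : _ @^-1` _ = \bigcup_k
  (box (fun l => if l == i then x else - k%:R) (fun=> k%:R))); last first.
  apply/seteqP; split => z /=; last first.
    move=> [k _ /(_ i)]; rewrite eqxx => /andP[xz _].
    by rewrite in_itv/= xz.
  rewrite in_itv/= andbT => xz.
  have : [set: 'rV[R]_n] z by [].
  rewrite -bigcup_box => -[k _ zk]; exists k => // l.
  case: eqP => [->|_]; last exact: zk.
  by rewrite xz; have /andP[] := zk i.
apply: bigcupT_measurable => k; apply: sub_sigma_algebra.
by exists (fun l => if l == i then x else - k%:R, fun=> k%:R).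
Qed.

Lemma measure_rV_unique (m1 m2 : {measure set 'rV[R]_n -> \bar R}) :
  (forall a b, m1 (box a b) = m2 (box a b)) ->
  (forall a b, m1 (box a b) < +oo)%E ->
  forall A, measurable A -> m1 A = m2 A.
Proof.
move=> m12 m1oo; apply: (measure_unique _ (fun k => box (fun=> - k%:R) (fun=> k%:R))).
- exact: measurable_rVE.
- move=> _ _ [[a b] _ <-] [[a' b'] _ <-]; rewrite boxI.
  by eexists (_, _).
- by move=> k; exists (fun=> - k%:R, fun=> k%:R).
- exact: bigcup_box.
- by move=> _ [ab _ <-].
- by move=> k.
Qed.

End boxes.

Section coordinates_of_cons.
Context {R : realType} {n : nat}.

Lemma rV_cons0 (p : measurableTypeR R * 'rV[R]_n) : rV_cons p ord0 ord0 = p.1.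
Proof. by have := rV_consK p; case: p => a v [] -> _. Qed.

Lemma rV_consS (p : measurableTypeR R * 'rV[R]_n) i :
  rV_cons p ord0 (lift ord0 i) = p.2 ord0 i.
Proof.
by have := rV_consK p; case: p => a v [] _ /rowP/(_ i); rewrite mxE.
Qed.

Lemma rV_cons_box (a b : 'I_n.+1 -> R) : @rV_cons R n @^-1` box a b =
  `]a ord0, b ord0[ `*` box (a \o lift ord0) (b \o lift ord0).
Proof.
apply/seteqP; split => -[r v] /=.
  move=> H; split; first by have := H ord0; rewrite in_itv/= rV_cons0.
  by move=> i; have := H (lift ord0 i); rewrite rV_consS.
move=> [rab H] i; case: (unliftP ord0 i) => [j|] ->.
  by rewrite rV_consS; exact: H.
by move: rab; rewrite in_itv/= rV_cons0.
Qed.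

End coordinates_of_cons.

Section lebesgue_box.
Context {R : realType}.

Lemma lebesgue_itvoo (a b : R) :
  (@lebesgue_measure R) `]a, b[%classic = (Num.max 0 (b - a))%:E.
Proof.
rewrite lebesgue_measure_itv/= lte_fin; case: ltP => ab.
  by rewrite -EFinD max_r// subr_ge0 ltW.
by rewrite max_l// subr_le0.
Qed.

Lemma lebesgue_rV_box n (a b : 'I_n -> R) :
  lebesgue_rV R n (box a b) = (\prod_i Num.max 0 (b i - a i))%:E.
Proof.
elim: n a b => [|n IHn] a b.
  rewrite big_ord0 /= diracE mem_set//; by case.
rewrite big_ord_recl EFinM -IHn -lebesgue_itvoo.
rewrite /= /lebesgue_step /pushforward rV_cons_box product_measure1E//.
exact: measurable_box.
Qed.

Lemma lebesgue_rV_box_fin n (a b : 'I_n -> R) :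
  (lebesgue_rV R n (box a b) < +oo)%E.
Proof. by rewrite lebesgue_rV_box ltry. Qed.

Lemma measurable_col_perm n (s : 'S_n) :
  measurable_fun setT (col_perm s : 'rV[R]_n -> 'rV[R]_n).
Proof.
apply: measurable_fun_rV => i.
rewrite (_ : _ \o _ = rV_coord (s i)); first exact: measurable_rV_coord.
by apply/funext => x; rewrite /rV_coord /= mxE.
Qed.

(** The recursive construction of Lebesgue measure singles out the first
    coordinate.  A permutation of the coordinates permutes the sides of a box,
    hence preserves the measure, and any coordinate may be singled out. *)
Lemma lebesgue_rV_col_perm n (s : 'S_n) (A : set 'rV[R]_n) : measurable A ->
  lebesgue_rV R n (col_perm s @^-1` A) = lebesgue_rV R n A.
Proof.
pose m := measure_function_pushforward__canonical__measure_function_Measure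
  (lebesgue_rV R n) (measurable_col_perm s).
move=> mA; symmetry; rewrite -[RHS]/(m A); move: A mA.
apply: measure_rV_unique => a b; last exact: lebesgue_rV_box_fin.
rewrite /m/=.
rewrite /pushforward (_ : _ @^-1` _ =
    box (fun i => a (s^-1 i)%g) (fun i => b (s^-1 i)%g)); last first.
  apply/seteqP; split => x /= H i; last by have := H (s i); rewrite permK mxE.
  by have := H (s^-1 i)%g; rewrite mxE permKV.
rewrite !lebesgue_rV_box (reindex_inj (@perm_inj _ s^-1%g))/=.
by [].
Qed.

End lebesgue_box.

(** * Integration over products and resampling of one coordinate *)

(** The Fubini theorems on a rectangle follow from those on the whole space for
    the extension by 0; the exceptional sets then concern the rectangle only. *)
Section fubini_rectangle.
Context d1 d2 (T1 : measurableType d1) (T2 : measurableType d2) (R : realType).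
Variable m1 : {sigma_finite_measure set T1 -> \bar R}.
Variable m2 : {sigma_finite_measure set T2 -> \bar R}.
Variables (A : set T1) (B : set T2) (mA : measurable A) (mB : measurable B).
Local Open Scope ereal_scope.
Implicit Types f : T1 * T2 -> \bar R.

Let patchX f x y : (f \_ (A `*` B)) (x, y) = ((fun x => (fun y => f (x, y)) \_ B) \_ A) x y.
Proof.
rewrite !patchE; case: (boolP (x \in A)) => xA; last first.
  by rewrite memNset// => -[/= /mem_set]; rewrite (negbTE xA).
rewrite !patchE; case: (boolP (y \in B)) => yB.
  by rewrite mem_set//; split => /=; exact: set_mem.
by rewrite memNset// => -[/= _ /mem_set]; rewrite (negbTE yB).
Qed.

Let patchXl f y :
  \int[m1]_x (f \_ (A `*` B)) (x, y) = ((fun y => \int[m1]_(x in A) f (x, y)) \_ B) y.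
Proof.
rewrite patchE; case: ifPn => yB.
  rewrite [RHS]integral_mkcond; apply: eq_integral => x _.
  by rewrite patchX !patchE; case: ifP => // _; rewrite patchE yB.
apply: integral0_eq => x _; rewrite patchX patchE.
by case: ifP => // _; rewrite patchE (negbTE yB).
Qed.

Let patchXr f x :
  \int[m2]_y (f \_ (A `*` B)) (x, y) = ((fun x => \int[m2]_(y in B) f (x, y)) \_ A) x.
Proof.
rewrite patchE; case: ifPn => xA.
  rewrite [RHS]integral_mkcond; apply: eq_integral => y _.
  by rewrite patchX !patchE xA.
by apply: integral0_eq => y _; rewrite patchX patchE (negbTE xA).
Qed.

Lemma ge0_integral_setX f : measurable_fun (A `*` B) f ->
  (forall p, (A `*` B) p -> 0 <= f p) ->
  \int[m1 \x m2]_(p in A `*` B) f p = \int[m2]_(y in B) \int[m1]_(x in A) f (x, y) /\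
  \int[m1 \x m2]_(p in A `*` B) f p = \int[m1]_(x in A) \int[m2]_(y in B) f (x, y).
Proof.
move=> mf f0.
have mg : measurable_fun setT (f \_ (A `*` B)).
  by apply/(measurable_restrictT _ (measurableX mA mB)).
have g0 p : 0 <= (f \_ (A `*` B)) p.
  by rewrite patchE; case: ifP => // /set_mem; exact: f0.
rewrite integral_mkcond; split.
  rewrite (@fubini_tonelli2 _ _ _ _ R m1 m2 _ mg g0) (integral_mkcond B).
  by apply: eq_integral => y _; exact: patchXl.
rewrite (@fubini_tonelli1 _ _ _ _ R m1 m2 _ mg g0) (integral_mkcond A).
by apply: eq_integral => y _; exact: patchXr.
Qed.

Lemma integral_setX f : (m1 \x m2).-integrable (A `*` B) f ->
  \int[m1 \x m2]_(p in A `*` B) f p = \int[m2]_(y in B) \int[m1]_(x in A) f (x, y) /\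
  \int[m1 \x m2]_(p in A `*` B) f p = \int[m1]_(x in A) \int[m2]_(y in B) f (x, y).
Proof.
move=> /(integrable_mkcond _ (measurableX mA mB)) If.
rewrite integral_mkcond; split.
  rewrite -(@integral21_prod_meas1 _ _ _ _ R m1 m2 _ If) (integral_mkcond B).
  by apply: eq_integral => y _; exact: patchXl.
rewrite -(@integral12_prod_meas1 _ _ _ _ R m1 m2 _ If) (integral_mkcond A).
by apply: eq_integral => y _; exact: patchXr.
Qed.

Lemma integrable_setX_inner f : (m1 \x m2).-integrable (A `*` B) f ->
  m2.-integrable B (fun y => \int[m1]_(x in A) f (x, y)) /\
  {ae m2, forall y, B y -> m1.-integrable A (fun x => f (x, y))}.
Proof.
move=> /(integrable_mkcond _ (measurableX mA mB)) If; split.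
  apply/(integrable_mkcond _ mB).
  apply: (eq_integrable measurableT (fubini_G m1 (f \_ (A `*` B)))).
    by move=> y _; exact: patchXl.
  have mf := measurable_int _ If.
  apply/integrableP; split; first exact: (@measurable_fubini_G _ _ _ _ _ m1 m2).
  have /integrableP[_] := If.
  have mabs : measurable_fun setT (abse \o (f \_ (A `*` B))).
    exact: measurableT_comp.
  have -> := @fubini_tonelli2 _ _ _ _ R m1 m2 _ mabs (fun=> abse_ge0 _).
  apply: le_lt_trans; apply: ge0_le_integral => //.
  - apply: measurableT_comp => //; exact: (@measurable_fubini_G _ _ _ _ _ m1 m2).
  - by apply: measurable_fun_fubini_tonelli_G => // p; exact: abse_ge0.
  - move=> y _; apply: le_abse_integral => //.
    exact: (measurable_fun_pair1 y mf).
have := ae_integrable2 If; apply: filterS => y /= Iy By.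
apply/(integrable_mkcond _ mA); move: Iy; apply: (eq_integrable measurableT) => x _.
rewrite patchX !patchE; case: ifP => // _.
by rewrite patchE mem_set.
Qed.

Lemma measurable_setX_slice f y : measurable_fun (A `*` B) f -> B y ->
  measurable_fun A (fun x => f (x, y)).
Proof.
move=> mf By; apply/(measurable_restrictT _ mA).
have mg : measurable_fun setT (f \_ (A `*` B)).
  by apply/(measurable_restrictT _ (measurableX mA mB)).
apply: eq_measurable_fun (measurable_fun_pair1 y mg) => x _.
by rewrite patchX !patchE; case: ifP => // _; rewrite patchE mem_set.
Qed.

Lemma measurable_setX_integral f : measurable_fun (A `*` B) f ->
  (forall p, (A `*` B) p -> 0 <= f p) ->
  measurable_fun B (fun y => \int[m1]_(x in A) f (x, y)).
Proof.
move=> mf f0; apply/(measurable_restrictT _ mB).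
have mg : measurable_fun setT (f \_ (A `*` B)).
  by apply/(measurable_restrictT _ (measurableX mA mB)).
have g0 p : 0 <= (f \_ (A `*` B)) p.
  by rewrite patchE; case: ifP => // /set_mem; exact: f0.
have := measurable_fun_fubini_tonelli_G (m1 := m1) _ mg g0.
by apply: eq_measurable_fun => y _; exact: patchXl.
Qed.

End fubini_rectangle.

Section update_coordinate.
Context {R : realType} {n : nat}.
Implicit Types (i : 'I_n) (x : 'rV[R]_n) (s t : R).

Definition upd i t x : 'rV[R]_n := \row_l (if l == i then t else x ord0 l).

Lemma upd_eq i t x : upd i t x ord0 i = t.
Proof. by rewrite mxE eqxx. Qed.

Lemma upd_neq i t x l : l != i -> upd i t x ord0 l = x ord0 l.
Proof. by move=> li; rewrite mxE (negbTE li). Qed.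

Lemma upd_upd i s t x : upd i s (upd i t x) = upd i s x.
Proof. by apply/rowP => l; rewrite !mxE; case: eqP. Qed.

Lemma upd_id i x : upd i (x ord0 i) x = x.
Proof. by apply/rowP => l; rewrite mxE; case: eqP => // ->. Qed.

(** Swapping a free real variable with the ith coordinate turns an integral over
    a line in direction i into an integral over the free variable. *)
Definition exchange i (p : measurableTypeR R * 'rV[R]_n) :
  measurableTypeR R * 'rV[R]_n := (p.2 ord0 i, upd i p.1 p.2).

Lemma measurable_upd i : measurable_fun setT
  (fun p : measurableTypeR R * 'rV[R]_n => upd i p.1 p.2).
Proof.
apply: measurable_fun_rV => l; have [->|li] := eqVneq l i.
  rewrite (_ : _ \o _ = fst); first exact: measurable_fst.
  by apply/funext => p; rewrite /rV_coord /= upd_eq.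
rewrite (_ : _ \o _ = rV_coord l \o snd); last first.
  by apply/funext => p; rewrite /rV_coord /= upd_neq.
by apply: measurableT_comp; [exact: measurable_rV_coord|exact: measurable_snd].
Qed.

Lemma measurable_exchange i : measurable_fun setT (exchange i).
Proof.
apply/measurable_fun_pairP; split; last exact: measurable_upd.
rewrite (_ : _ \o _ = rV_coord i \o snd)//.
by apply: measurableT_comp; [exact: measurable_rV_coord|exact: measurable_snd].
Qed.

Lemma rV_cons_exchange i p :
  rV_cons (exchange i p) = col_perm (tperm ord0 (lift ord0 i)) (rV_cons p).
Proof.
apply/rowP => k; rewrite [RHS]mxE; case: (unliftP ord0 k) => [j|] ->.
  rewrite rV_consS; have [->|ji] := eqVneq j i.
    by rewrite tpermR rV_cons0 upd_eq.
  rewrite tpermD ?rV_consS ?upd_neq//.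
  by rewrite (inj_eq lift_inj) eq_sym.
by rewrite tpermL rV_cons0 rV_consS.
Qed.

Local Notation lam := (@lebesgue_measure R).
Local Notation leb := (lebesgue_rV R n).

(** In R x R^n = R^(n+1) the exchange is a transposition of two coordinates. *)
Lemma lebesgue_exchange i (A : set (measurableTypeR R * 'rV[R]_n)) :
  measurable A -> (lam \x leb)%E (exchange i @^-1` A) = (lam \x leb)%E A.
Proof.
move=> mA; pose B : set 'rV[R]_n.+1 := @rV_uncons R n @^-1` A.
have mB : measurable B.
  by rewrite -[X in measurable X]setTI; exact: measurable_rV_uncons.
have AE : A = @rV_cons R n @^-1` B.
  by apply/seteqP; split => p; rewrite /B /= rV_consK.
rewrite AE -[RHS]/(lebesgue_rV R n.+1 B).
rewrite -(lebesgue_rV_col_perm (tperm ord0 (lift ord0 i)) mB) /=.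
rewrite /lebesgue_step /pushforward; congr ((lam \x leb)%E _).
by apply/seteqP; split => p /=; rewrite rV_cons_exchange.
Qed.

Local Open Scope ereal_scope.

Section exchange_on_box.
Variables (i : 'I_n) (a b : 'I_n -> R).
Let I : set (measurableTypeR R) := `]a i, b i[%classic.
Let Q := box a b.

Lemma exchange_box : exchange i @^-1` (I `*` Q) = I `*` Q.
Proof.
apply/seteqP; split => -[s x]; rewrite /I /Q /= !in_itv/= => -[].
  move=> xi H; split; first by have := H i; rewrite upd_eq.
  move=> l; have [->//|li] := eqVneq l i.
  by have := H l; rewrite upd_neq.
move=> si H; split; first exact: H.
move=> l; have [->|li] := eqVneq l i; first by rewrite upd_eq.
by rewrite upd_neq.
Qed.

Let mI : measurable I. Proof. exact: measurable_itv. Qed.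
Let mQ : measurable Q. Proof. exact: measurable_box. Qed.
Let mIQ : measurable (I `*` Q). Proof. exact: measurableX. Qed.

Let integral_pushforward_exchange (F : measurableTypeR R * 'rV[R]_n -> \bar R) :
  \int[pushforward (lam \x leb)%E (exchange i)]_(p in I `*` Q) F p =
  \int[(lam \x leb)%E]_(p in I `*` Q) F p.
Proof.
pose m := measure_function_pushforward__canonical__measure_function_Measure
  (lam \x leb)%E (measurable_exchange i).
rewrite -[LHS]/(\int[m]_(p in _) F p).
by apply: eq_measure_integral => A mA _; rewrite -[RHS](lebesgue_exchange i).
Qed.

Lemma measurable_exchange_box (F : measurableTypeR R * 'rV[R]_n -> \bar R) :
  measurable_fun (I `*` Q) F -> measurable_fun (I `*` Q) (F \o exchange i).
Proof.
move=> mF; apply: (measurable_comp mIQ) => //.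
  by move=> _ [p Hp <-]; move: Hp; rewrite -{1}exchange_box.
by apply: measurable_funTS; exact: measurable_exchange.
Qed.

Lemma ge0_integral_exchange (F : measurableTypeR R * 'rV[R]_n -> \bar R) :
  measurable_fun (I `*` Q) F -> (forall p, (I `*` Q) p -> 0 <= F p) ->
  \int[(lam \x leb)%E]_(p in I `*` Q) F (exchange i p) =
  \int[(lam \x leb)%E]_(p in I `*` Q) F p.
Proof.
move=> mF F0; rewrite -[RHS]integral_pushforward_exchange.
rewrite ge0_integral_pushforward//; first by rewrite exchange_box.
  exact: measurable_exchange.
by move=> p; rewrite inE; exact: F0.
Qed.

Lemma integrable_exchange (F : measurableTypeR R * 'rV[R]_n -> \bar R) :
  (lam \x leb)%E.-integrable (I `*` Q) F ->
  (lam \x leb)%E.-integrable (I `*` Q) (F \o exchange i).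
Proof.
move=> /integrableP[mF IF]; apply/integrableP; split.
  exact: measurable_exchange_box.
have mabs : measurable_fun (I `*` Q) (abse \o F) by exact: measurableT_comp.
have := ge0_integral_exchange mabs (fun p _ => abse_ge0 (F p)).
by rewrite /= => ->.
Qed.

Lemma integral_exchange (F : measurableTypeR R * 'rV[R]_n -> \bar R) :
  (lam \x leb)%E.-integrable (I `*` Q) F ->
  \int[(lam \x leb)%E]_(p in I `*` Q) F (exchange i p) =
  \int[(lam \x leb)%E]_(p in I `*` Q) F p.
Proof.
move=> IF; have mF := measurable_int _ IF.
rewrite integralE [RHS]integralE; congr (_ - _).
  rewrite -(ge0_integral_exchange (measurable_funepos mF) (fun p _ => funepos_ge0 F p)).
  by apply: eq_integral => p _; rewrite !funeposE.
rewrite -(ge0_integral_exchange (measurable_funeneg mF) (fun p _ => funeneg_ge0 F p)).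
  by apply: eq_integral => p _; rewrite !funenegE.
Qed.

Let measurable_snd_box (f : 'rV[R]_n -> \bar R) :
  measurable_fun Q f -> measurable_fun (I `*` Q) (f \o snd).
Proof.
move=> mf; apply: (measurable_comp mQ) => //; first by move=> _ [p [_ ?] <-].
by apply: measurable_funTS; exact: measurable_snd.
Qed.

(** Resampling the ith coordinate over its whole side: after the exchange, the
    integrand no longer depends on the free variable. *)
Lemma ge0_integral_upd (f : 'rV[R]_n -> \bar R) :
  measurable_fun Q f -> (forall x, Q x -> 0 <= f x) ->
  \int[leb]_(x in Q) \int[lam]_(s in I) f (upd i s x) =
  lam I * \int[leb]_(x in Q) f x.
Proof.
move=> mf f0; have mf2 := measurable_snd_box mf.
have f20 p : (I `*` Q) p -> 0 <= f p.2 by move=> [_ ?]; exact: f0.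
have /(_ _ _)[] := @ge0_integral_setX _ _ _ _ R lam leb _ _ mI mQ (f \o snd \o exchange i).
- exact: measurable_exchange_box.
- by move=> p Hp; apply: f20; move: Hp; rewrite -{1}exchange_box.
move=> /= <- _; rewrite (ge0_integral_exchange (F := f \o snd))//.
have [-> _] := @ge0_integral_setX _ _ _ _ R lam leb _ _ mI mQ (f \o snd) mf2 f20.
transitivity (\int[leb]_(x in Q) (lam I * f x)).
  by apply: eq_integral => x _; rewrite /= (integral_cst lam mI (f x)) muleC.
by rewrite ge0_integralZl// measure_ge0.
Qed.

Lemma integral_upd (f : 'rV[R]_n -> R) :
  leb.-integrable Q (EFin \o f) ->
  \int[leb]_(x in Q) \int[lam]_(s in I) (f (upd i s x))%:E =
  lam I * \int[leb]_(x in Q) (f x)%:E /\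
  (lam \x leb).-integrable (I `*` Q) (EFin \o f \o snd).
Proof.
move=> If; have mf := measurable_int _ If.
have mf2 := measurable_snd_box mf.
have If2 : (lam \x leb).-integrable (I `*` Q) (EFin \o f \o snd).
  apply/integrableP; split => //.
  have mabs : measurable_fun (I `*` Q) (abse \o ((EFin \o f) \o snd)).
    exact: measurableT_comp.
  have [-> _]:= @ge0_integral_setX _ _ _ _ R lam leb _ _ mI mQ _ mabs
    (fun p _ => abse_ge0 _).
  rewrite (eq_integral (fun x => lam I * `|(f x)%:E|)); last first.
    by move=> x _; rewrite /= (integral_cst lam mI `|(f x)%:E|) muleC.
  rewrite ge0_integralZl//; last first.
    exact: measurableT_comp.
  have /integrableP[_ ?] := If; rewrite lte_mul_pinfty//.
  by rewrite /I lebesgue_itvoo.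
split => //.
have [+ _] := @integral_setX _ _ _ _ R lam leb _ _ mI mQ _ (integrable_exchange If2).
move=> /= <-; rewrite (integral_exchange If2).
have [-> _] := @integral_setX _ _ _ _ R lam leb _ _ mI mQ _ If2.
have lamI : lam I = (Num.max 0 (b i - a i)%R)%:E by exact: lebesgue_itvoo.
rewrite lamI -integralZl//; apply: eq_integral => x _.
by rewrite /= (integral_cst lam mI (f x)%:E) muleC; congr (_ * _); rewrite -lamI.
Qed.

End exchange_on_box.

End update_coordinate.

(** * Borel sets and open sets *)

Section open_measurable_rV.
Context {R : realType} {n : nat}.
Implicit Types (a b : 'I_n -> R).

Lemma near_boxP a b (x : 'rV[R]_n) : box a b x -> \forall y \near x, box a b y.
Proof.
move=> abx.
apply: (@filter_forall _ _ (fun i (y : 'rV[R]_n) => a i < y ord0 i < b i) (nbhs x)) => i.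
have /andP[ax xb] := abx i.
have ci : (fun y : 'rV[R]_n => y ord0 i) @ x --> x ord0 i.
  exact: coord_continuous.
by near=> y; apply/andP; split; near: y;
  [exact: (cvgr_gt _ ci _ ax)|exact: (cvgr_lt _ ci _ xb)].
Unshelve. all: by end_near. Qed.

Lemma open_box a b : open (box a b).
Proof. by rewrite openE => x abx; exact: near_boxP. Qed.

Lemma ball_boxE (x : 'rV[R]_n) e : 0 < e ->
  ball x e = box (fun i => x ord0 i - e) (fun i => x ord0 i + e).
Proof.
move=> e0; apply/seteqP; split => y /=.
  move=> [_ H] i; have := H ord0 i; rewrite /ball/= ltr_distlC.
  by [].
move=> H; split => // i j; rewrite (ord1 i) /ball/= ltr_distlC; exact: H.
Qed.

Lemma open_box_sub (A : set 'rV[R]_n) x : open A -> A x ->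
  exists2 e, 0 < e & box (fun i => x ord0 i - e) (fun i => x ord0 i + e) `<=` A.
Proof.
rewrite openE => /[apply] /nbhs_ballP[e /= e0 H]; exists e => //.
by rewrite -ball_boxE.
Qed.

(** An open set is a countable union of boxes with rational centres, while the
    sigma-algebra is generated by the coordinates. *)
Lemma open_measurable_rV (A : set 'rV[R]_n) : open A -> measurable A.
Proof.
move=> oA.
pose B (p : 'rV[rat]_n * nat) := box
  (fun i => (ratr (p.1 ord0 i) : R) - p.2.+1%:R^-1)
  (fun i => (ratr (p.1 ord0 i) : R) + p.2.+1%:R^-1).
rewrite (_ : A = \bigcup_p (if `[< B p `<=` A >] then B p else set0)).
  apply: countable_bigcupT_measurable => [|p]; first exact: countableP.
  by case: ifP => // _; exact: measurable_box.
apply/seteqP; split => x; last first.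
  by move=> [p _]; case: asboolP => // + Bpx; exact.
move=> Ax; have [e e0 eA] := open_box_sub oA Ax.
have [k ke] : exists k, k.+1%:R^-1 < e / 2.
  exists (Num.trunc (e / 2)^-1).
  rewrite invf_plt ?posrE ?divr_gt0//; exact: truncnS_gt.
have /choice[q Hq] : forall i, exists q,
    (ratr q : R) \in `](x ord0 i - k.+1%:R^-1), (x ord0 i + k.+1%:R^-1)[.
  by move=> i; apply: rat_in_itvoo; rewrite ltrD2l gt0_cp// invr_gt0.
exists (\row_i q i, k) => //.
have xB : B (\row_i q i, k) x.
  move=> i; have := Hq i; rewrite in_itv/= mxE => /andP[H1 H2].
  by rewrite ltrBlDr H2 -ltrBlDr.
case: asboolP => // BA; case: BA => y By; apply: eA => i.
have := Hq i; rewrite in_itv/= => /andP[H1 H2].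
have := By i; rewrite /= mxE => /andP[H3 H4].
move: (ratr (q i) : R) (k.+1%:R^-1 : R) ke H1 H2 H3 H4 => r d ke H1 H2 H3 H4.
by apply/andP; split; lra.
Qed.

Lemma continuous_measurable_rV (f : 'rV[R]_n -> R) :
  continuous f -> measurable_fun setT f.
Proof.
move=> /continuousP cf; apply: (measurability _ (RGenOpens.measurableE R)).
move=> _ [_ [a [b ->]] <-]; rewrite setTI.
apply: open_measurable_rV; apply: cf; exact: interval_open.
Qed.

End open_measurable_rV.

(** * Smooth functions of one variable *)

Section smooth_line.
Context {R : realType}.
Implicit Types (f g : R -> R) (k : nat) (p : {poly R}).

(** The derivatives are witnesses instead of values of the derivation operator,
    so that sums, products and compositions are handled by induction on k. *)
Fixpoint Ck k f : Prop := if k is k'.+1 then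
  exists2 f' : R -> R, (forall x : R, is_derive x 1 f (f' x)) & Ck k' f' else True.

Definition smooth1 f := forall k, Ck k f.

Lemma CkS k f : Ck k.+1 f -> Ck k f.
Proof.
elim: k f => // k IHk f [f' ff' /IHk f'k]; by exists f'.
Qed.

Lemma CkD k f g : Ck k f -> Ck k g -> Ck k (f \+ g).
Proof.
elim: k f g => // k IHk f g [f' ff' f'k] [g' gg' g'k].
exists (f' \+ g'); last exact: IHk.
by move=> x; exact: is_deriveD.
Qed.

Lemma CkM k f g : Ck k f -> Ck k g -> Ck k (f \* g).
Proof.
elim: k f g => // k IHk f g Cf Cg.
have [f' ff' f'k] := Cf; have [g' gg' g'k] := Cg.
exists ((f \* g') \+ (g \* f')); last by apply: CkD; apply: IHk => //; exact: CkS.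
by move=> x; exact: is_deriveM.
Qed.

Lemma Ck_cst k (c : R) : Ck k (fun=> c).
Proof.
elim: k c => // k IHk c; exists (fun=> 0) => // x; exact: is_derive_cst.
Qed.

Lemma Ck_affine k f (c d : R) : Ck k f -> Ck k (fun x => f (c * x + d)).
Proof.
elim: k f => // k IHk f [f' ff' f'k].
exists ((fun x => f' (c * x + d)) \* (fun=> c)); last first.
  by apply: CkM; [exact: IHk|exact: Ck_cst].
move=> x; apply: (@is_derive1_comp _ f (fun x => c * x + d)).
by apply: is_derive_eq; rewrite /GRing.scale/=; ring.
Qed.

Lemma smooth1D f g : smooth1 f -> smooth1 g -> smooth1 (f \+ g).
Proof. by move=> sf sg k; exact: CkD. Qed.

Lemma smooth1M f g : smooth1 f -> smooth1 g -> smooth1 (f \* g).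
Proof. by move=> sf sg k; exact: CkM. Qed.

Lemma smooth1_cst (c : R) : smooth1 (fun=> c).
Proof. by move=> k; exact: Ck_cst. Qed.

Lemma smooth1_id : smooth1 id.
Proof.
case=> // k; exists (fun=> 1); last exact: Ck_cst.
by move=> x; exact: is_derive_id.
Qed.

Lemma smooth1_affine f (c d : R) :
  smooth1 f -> smooth1 (fun x => f (c * x + d)).
Proof. by move=> sf k; exact: Ck_affine. Qed.

Lemma smooth1_deriv f : smooth1 f ->
  exists2 f' : R -> R, (forall x : R, is_derive x 1 f (f' x)) & smooth1 f'.
Proof.
move=> sf; have [f' ff' _] := sf 1%N; exists f' => // k.
have [f'' ff'' f''k] := sf k.+1.
suff -> : f' = f'' by [].
by apply/funext => x; rewrite -(@derive_val _ _ _ _ _ _ _ (ff' x)) -(@derive_val _ _ _ _ _ _ _ (ff'' x)).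
Qed.

Lemma is_derive_smooth1 f f' :
  (forall x : R, is_derive x 1 f (f' x)) -> smooth1 f' -> smooth1 f.
Proof. by move=> ff' sf' [//|k]; exists f'. Qed.

Lemma smooth1_continuous f : smooth1 f -> continuous f.
Proof.
move=> /smooth1_deriv[f' ff' _] x; apply/differentiable_continuous.
by apply/derivable1_diffP; exact: ex_derive.
Qed.

(** For p = 1 this is exp(-1/x), extended by 0.  With a polynomial factor in
    1/x, the class is closed under differentiation. *)
Definition flat p (x : R) := if 0 < x then p.[x^-1] * expR (- x^-1) else 0.

(** Every power is at most a factorial times the exponential.  At x = 0 this
    bound for y = 1/x gives the derivative of [flat]. *)
Lemma poly_expR_bounded p :
  exists2 C : R, 0 <= C & forall y, 0 <= y -> `|p.[y] * expR (- y)| <= C.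
Proof.
suff Xn n : forall y : R, 0 <= y -> y ^+ n * expR (- y) <= n`!%:R.
  exists (\sum_(i < size p) `|p`_i| * i`!%:R).
    by apply: sumr_ge0 => i _; rewrite mulr_ge0.
  move=> y y0; rewrite horner_coef big_distrl/=.
  apply: le_trans (ler_norm_sum _ _ _) _; apply: ler_sum => i _.
  rewrite -mulrA normrM ler_wpM2l//.
  by rewrite ger0_norm ?Xn// mulr_ge0 ?expR_ge0 ?exprn_ge0.
move=> y y0; rewrite expRN ler_pdivrMr ?expR_gt0//.
case: n => [|n].
  rewrite expr0 fact0 mul1r; apply: le_trans (expR_ge1Dx _).
  by rewrite lerDl.
have := expR_ge1Dxn n y0; rewrite -lerBrDl => H.
rewrite mulrC -ler_pdivrMr ?ltr0n ?fact_gt0//.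
by apply: le_trans H _; rewrite gerBl.
Qed.

Lemma is_derive_flat p (x : R) :
  is_derive x 1 (flat p) (flat ('X^2 * (p - p^`())) x).
Proof.
have [x0|x0|->] := ltgtP x 0.
- rewrite {2}/flat ltNge (ltW x0)/=.
  apply: (@near_eq_is_derive _ _ _ (cst 0)) => //.
  near=> y; rewrite /flat ltNge; case: leP => //= y0.
  by have : y < 0 by [near: y; exact: lt_nbhsl]; rewrite ltNge ltW.
- rewrite {2}/flat x0.
  apply: (@near_eq_is_derive R R R (fun x : R => p.[x^-1] * expR (- x^-1))).
  + near=> y; rewrite /flat; case: ltP => //= y0.
    by have : 0 < y by [near: y; exact: lt_nbhsr]; rewrite ltNge y0.
  + have dV : is_derive x 1 (fun x : R => x^-1) (- x ^- 2).
      rewrite (_ : - x ^- 2 = - (id x) ^- 2 *: 1); last first.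
        by rewrite /GRing.scale/= mulr1.
      exact: (@is_deriveV _ id x 1 1 (lt0r_neq0 x0) (is_derive_id _ _)).
    have dP : is_derive x 1 (fun x : R => p.[x^-1]) (p^`().[x^-1] * (- x ^- 2)).
      exact: (@is_derive1_comp _ (horner p) (fun x => x^-1)).
    have dE : is_derive x 1 (fun x : R => expR (- x^-1)) (expR (- x^-1) * (x ^- 2)).
      apply: (@is_derive1_comp _ expR (fun x => - x^-1)).
      by apply: is_derive_eq; rewrite opprK.
    apply: is_derive_eq (is_deriveM dP dE) _.
    rewrite /GRing.scale/= !hornerE -?exprVn; move: (x^-1) => y /=.
    rewrite -[LHS]/(p.[y] * expR (- y) * y ^+ 2
      + expR (- y) * p^`().[y] * - y ^+ 2); ring.
- rewrite {2}/flat ltxx.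
  have [C C0 HC] := poly_expR_bounded ('X^2 * p).
  have bd y : `|flat p y| <= C * y ^+ 2.
    rewrite /flat; case: ifPn => [y0|_]; last by rewrite normr0 mulr_ge0 ?sqr_ge0.
    have := HC y^-1; rewrite invr_ge0 ltW// => /(_ isT).
    rewrite hornerM hornerXn exprVn -mulrA normrM gtr0_norm ?invr_gt0 ?exprn_gt0//.
    by rewrite mulrC ler_pdivrMr ?exprn_gt0.
  suff H : h^-1 *: ((flat p \o shift 0) (h *: 1) - flat p 0) @[h --> 0^'] --> (0:R).
    by apply: DeriveDef; [apply/cvg_ex; exists 0|exact/cvg_lim].
  apply/cvgr0Pnorm_le => e e0; near=> h.
  rewrite /= /GRing.scale/= mulr1 addr0 {2}/flat ltxx subr0 normrM normfV.
  have h0 : h != 0 by near: h; exact: nbhs_dnbhs_neq.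
  rewrite mulrC ler_pdivrMr ?normr_gt0//.
  apply: le_trans (bd h) _; rewrite -real_normK ?num_real// expr2 mulrA.
  rewrite ler_wpM2r//; have : `|h| <= e / (C + 1).
    near: h; apply: dnbhs0_le; rewrite divr_gt0//; lra.
  rewrite ler_pdivlMr; last by lra.
  apply: le_trans; rewrite mulrC ler_wpM2l//; lra.
Unshelve. all: by end_near. Qed.

Lemma smooth1_flat p : smooth1 (flat p).
Proof.
move=> k; elim: k p => // k IHk p.
exists (flat ('X^2 * (p - p^`()))) => // x; exact: is_derive_flat.
Qed.

End smooth_line.

(** * Bumps on an interval and their primitives *)

Section bumps.
Context {R : realType}.
Implicit Types (f g psi : R -> R) (a b : R).
Local Notation lam := (@lebesgue_measure R).

(** The support lies in a segment inside the open interval, which makes products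
    of bumps test functions of an open box. *)
Definition bump_on a b psi := smooth1 psi /\
  exists c d, [/\ a < c, d < b & forall x, psi x != 0 -> c <= x <= d].

Lemma bump_out a b psi x : bump_on a b psi -> ~~ (a < x < b) -> psi x = 0.
Proof.
move=> [_ [c [d [ac db H]]]]; apply: contraNeq => /H /andP[cx xd].
by rewrite (lt_le_trans ac cx) (le_lt_trans xd db).
Qed.

Lemma flat1E (x : R) : flat 1 x = if 0 < x then expR (- x^-1) else 0.
Proof. by rewrite /flat hornerC mul1r. Qed.

Lemma flat1_ge0 (x : R) : 0 <= flat 1 x.
Proof. by rewrite flat1E; case: ifP => // _; exact: expR_ge0. Qed.

Lemma flat1_le1 (x : R) : flat 1 x <= 1.
Proof.
rewrite flat1E; case: ifPn => // x0.
by rewrite -expR0 ler_expR oppr_le0 invr_ge0 ltW.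
Qed.

(** Smooth functions supported inside ]a, b[ and bounded by 1 that converge to the
    indicator function of ]a, b[: dominated convergence passes from their tensor
    products to boxes. *)
Definition mesa a b (m : nat) (x : R) :=
  flat 1 (m.+1%:R * x + (- (m.+1%:R * a) - 1)) *
  flat 1 (- m.+1%:R * x + (m.+1%:R * b - 1)).

Lemma mesa_ge0 a b m x : 0 <= mesa a b m x.
Proof. by rewrite mulr_ge0 ?flat1_ge0. Qed.

Lemma mesa_le1 a b m x : mesa a b m x <= 1.
Proof. by rewrite mulr_ile1 ?flat1_ge0 ?flat1_le1. Qed.

Lemma bump_mesa a b m : bump_on a b (mesa a b m).
Proof.
split.
  by apply: smooth1M; apply: smooth1_affine; exact: smooth1_flat.
exists (a + m.+1%:R^-1), (b - m.+1%:R^-1).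
have m0 : 0 < m.+1%:R^-1 :> R by rewrite invr_gt0.
split; [by rewrite ltrDl|by rewrite gtrBl|] => x.
rewrite /mesa !flat1E; case: ifPn => [H1|]; last by rewrite mul0r eqxx.
case: ifPn => [H2 _|]; last by rewrite mulr0 eqxx.
move: H1 H2; have -> : m.+1%:R * x + (- (m.+1%:R * a) - 1) =
  m.+1%:R * (x - (a + m.+1%:R^-1)).
  by rewrite mulrBr mulrDr mulfV//; ring.
have -> : - m.+1%:R * x + (m.+1%:R * b - 1) =
  m.+1%:R * (b - m.+1%:R^-1 - x).
  by rewrite !mulrBr mulfV//; ring.
rewrite !pmulr_rgt0// !subr_gt0 => H1 H2.
by rewrite !ltW.
Qed.

Lemma cvg_mesa a b x :
  mesa a b m x @[m --> \oo] --> (\1_(`]a, b[%classic) x : R).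
Proof.
have flat_cvg t : 0 < t -> flat 1 (m.+1%:R * t - 1) @[m --> \oo] --> (1:R).
  move=> t0; rewrite -[X in _ --> X]expR0 -oppr0.
  have H : (m.+1%:R * t - 1)^-1 @[m --> \oo] --> (0 : R).
    apply/gtr0_cvgV0.
      near=> m; rewrite subr_gt0 -ltr_pdivrMr//.
      near: m; exists (Num.trunc (1/t)) => // m /= hm.
      by apply: lt_le_trans (truncnS_gt _) _; rewrite ler_nat.
    apply/cvgryPgt => A; near=> m; rewrite ltrBrDr -ltr_pdivrMr//.
    near: m; exists (Num.trunc ((A+1)/t)) => // m /= hm.
    by apply: lt_le_trans (truncnS_gt _) _; rewrite ler_nat.
  have HN : (fun m : nat => - (m.+1%:R * t - 1)^-1) @ \oo --> - (0 : R) by exact: cvgN.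
  have H1 := cvg_comp _ _ HN (@continuous_expR R (- 0)).
  apply: cvg_trans H1; apply: near_eq_cvg; near=> m.
  rewrite flat1E ifT//= subr_gt0 -ltr_pdivrMr//.
  near: m; exists (Num.trunc (1/t)) => // m /= hm.
  by apply: lt_le_trans (truncnS_gt _) _; rewrite ler_nat.
rewrite indicE; case: (boolP (x \in _)) => xab /=.
  move: xab; rewrite inE/= in_itv/= => /andP[ax xb].
  rewrite -[X in _ --> X]mulr1; apply: cvgM.
    have H1 := flat_cvg (x - a); rewrite subr_gt0 in H1.
    apply: cvg_trans (H1 ax); apply: near_eq_cvg; near=> m; congr flat; ring.
  have H1 := flat_cvg (b - x); rewrite subr_gt0 in H1.
  apply: cvg_trans (H1 xb); apply: near_eq_cvg; near=> m; congr flat; ring.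
rewrite (_ : (fun m => _) = fun=> 0); first exact: cvg_cst.
apply/funext => m; apply: (bump_out (bump_mesa a b m)).
by move: xab; apply: contra => H; rewrite inE/= in_itv.
Unshelve. all: by end_near. Qed.

Definition prim a f x := \int[lam]_(t in `[a, x]) f t.

Lemma integrable_segment f a b : continuous f ->
  lam.-integrable `[a, b] (EFin \o f).
Proof.
move=> cf; apply: continuous_compact_integrable; first exact: segment_compact.
exact: continuous_subspaceT.
Qed.

(** Only the part of the support of psi below x counts. *)
Lemma prim_eq a psi x y : (forall t, psi t != 0 -> (t <= x) = (t <= y)) ->
  prim a psi x = prim a psi y.
Proof.
move=> H; rewrite /prim Rintegral_mkcond [RHS]Rintegral_mkcond.
congr (Rintegral _ _ _); apply/funext => t; rewrite !patchE.
have [->|/H E] := eqVneq (psi t) 0; first by rewrite !if_same.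
by congr (if _ then _ else _); apply/idP/idP; rewrite !inE/= !in_itv/= E.
Qed.

Lemma prim_left a psi x : x <= a -> prim a psi x = 0.
Proof.
move=> xa; rewrite /prim; have [->|xa'] := eqVneq x a.
  by rewrite set_itv1 Rintegral_set1.
by rewrite set_itv_ge ?Rintegral_set0//= bnd_simp -ltNge lt_neqAle xa' xa.
Qed.

Lemma prim_right a b psi x : bump_on a b psi -> b <= x -> prim a psi x = prim a psi b.
Proof.
move=> bpsi bx; apply: prim_eq => t.
have [/andP[_ tb] _|/(bump_out bpsi) ->] := boolP (a < t < b); last by rewrite eqxx.
by rewrite (ltW tb) (le_trans (ltW tb)).
Qed.

Lemma is_derive_prim a b psi x : bump_on a b psi ->
  is_derive x (1 : R) (prim a psi) (psi x).
Proof.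
move=> bpsi; have [ax|xa] := ltP a x.
  have cf := smooth1_continuous bpsi.1.
  have xx1 : x < x + 1 by rewrite ltrDl.
  have [d1 d2] := continuous_FTC1_closed xx1
    (integrable_segment a (x + 1) cf) ax (cf x).
  by apply: DeriveDef; [exact: d1|rewrite -derive1E].
rewrite (bump_out bpsi); last by rewrite ltNge xa.
have [_ [c [d [ac db H]]]] := bpsi.
apply: (@near_eq_is_derive _ R R (cst 0)) => //.
near=> y; rewrite (@prim_eq a psi y a)//; last first.
  move=> t /H /andP[ct _].
  have yc : y < c.
    by near: y; apply: lt_nbhsl; exact: le_lt_trans xa ac.
  by rewrite !leNgt (lt_le_trans ac ct) (lt_le_trans yc ct).
by rewrite prim_left.
Unshelve. all: by end_near. Qed.

Lemma smooth1_prim a b psi : bump_on a b psi -> smooth1 (prim a psi).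
Proof.
move=> bpsi; apply: is_derive_smooth1 bpsi.1.
by move=> x; exact: (@is_derive_prim a b).
Qed.

(** A primitive of a bump is a bump when the total integral vanishes, which is
    achieved by subtracting a multiple of eta.  Such primitives are the test
    functions against which weak derivatives are used. *)
Lemma prim_bump a b psi eta : bump_on a b psi -> bump_on a b eta ->
  prim a eta b = 1 ->
  bump_on a b (fun x => prim a psi x - prim a psi b * prim a eta x).
Proof.
move=> bpsi beta eta1.
have [spsi [c [d [ac db H]]]] := bpsi.
have [seta [c' [d' [ac' db' H']]]] := beta.
split.
  have -> : (fun x => prim a psi x - prim a psi b * prim a eta x) =
    (prim a psi) \+ ((fun=> - prim a psi b) \* (prim a eta)).
    by apply/funext => x /=; rewrite mulNr.
  apply: smooth1D; first exact: (@smooth1_prim a b).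
  by apply: smooth1M; [exact: smooth1_cst|exact: (@smooth1_prim a b)].
exists (Num.min c c'), (Num.max d d'); split.
- by rewrite lt_min ac ac'.
- by rewrite gt_max db db'.
- move=> x; apply: contraR; rewrite negb_and -!ltNge lt_min gt_max.
  move=> /orP[/andP[xc xc']|/andP[dx dx']].
    have -> : prim a psi x = prim a psi a.
      apply: prim_eq => t /H /andP[ct _].
      by rewrite !leNgt (lt_le_trans xc ct) (lt_le_trans ac ct).
    have -> : prim a eta x = prim a eta a.
      apply: prim_eq => t /H' /andP[ct _].
      by rewrite !leNgt (lt_le_trans xc' ct) (lt_le_trans ac' ct).
    by rewrite (prim_left psi (lexx a)) (prim_left eta (lexx a)) mulr0 subrr.
  have -> : prim a psi x = prim a psi b.
    apply: prim_eq => t /H /andP[_ td].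
    by rewrite (le_trans td (ltW dx)) (le_trans td (ltW db)).
  have -> : prim a eta x = prim a eta b.
    apply: prim_eq => t /H' /andP[_ td].
    by rewrite (le_trans td (ltW dx')) (le_trans td (ltW db')).
  by rewrite eta1 mulr1 subrr.
Qed.

Lemma prim_le a f x y : continuous f -> (forall t, 0 <= f t) -> x <= y ->
  0 <= prim a f x <= prim a f y.
Proof.
move=> cf f0 xy; apply/andP; split; first by apply: Rintegral_ge0 => t _; exact: f0.
rewrite /prim /Rintegral; apply: fine_le.
- by apply: integrable_fin_num => //; exact: integrable_segment.
- by apply: integrable_fin_num => //; exact: integrable_segment.
- apply: ge0_subset_integral => //.
  + by have /measurable_int := integrable_segment a y cf.
  + by move=> t _; rewrite lee_fin.
  + by apply: subset_itvl; rewrite bnd_simp.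
Qed.

Lemma unit_bump a b : a < b -> exists eta,
  [/\ bump_on a b eta, forall x, 0 <= eta x & prim a eta b = 1].
Proof.
(* For this m the support of the mesa contains the midpoint. *)
move=> ab; pose m := Num.trunc (2 / (b - a)); pose f := mesa a b m.
have ba0 : 0 < b - a by rewrite subr_gt0.
have bf : bump_on a b f by exact: bump_mesa.
have cf := smooth1_continuous bf.1.
have f0 x : 0 <= f x by exact: mesa_ge0.
have hm : 1 < m.+1%:R * ((b - a) / 2).
  rewrite -ltr_pdivrMr ?divr_gt0// div1r invf_div; exact: truncnS_gt.
have fmid : 0 < f ((a + b) / 2).
  have H1 : 0 < m.+1%:R * ((a + b) / 2) + (- (m.+1%:R * a) - 1).
    by move: (m.+1%:R : R) hm => k; lra.
  have H2 : 0 < - m.+1%:R * ((a + b) / 2) + (m.+1%:R * b - 1).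
    by move: (m.+1%:R : R) hm => k; lra.
  by rewrite /f /mesa !flat1E H1 H2 mulr_gt0 ?expR_gt0.
(* If the integral vanished, the primitive would be 0 up to b, and so would be
   its derivative f at the midpoint. *)
have P0 : 0 < prim a f b.
  rewrite lt_def; apply/andP; split; last first.
    by have /andP[] := prim_le a cf f0 (lexx b).
  apply/eqP => Pb0.
  have P0 x : x <= b -> prim a f x = 0.
    move=> xb; have /andP[H1 H2] := prim_le a cf f0 xb.
    by apply/eqP; rewrite eq_le H1 andbT -Pb0.
  have : is_derive ((a + b) / 2) (1 : R) (prim a f) 0.
    apply: (@near_eq_is_derive _ R R (cst 0)) => //.
    near=> y; rewrite P0//; apply: ltW; near: y; apply: lt_nbhsl.
    rewrite ltr_pdivrMr//; lra.
  have := @is_derive_prim a b f ((a + b) / 2) bf.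
  move=> [_ E1] [_ E2]; move: fmid; rewrite -E1 E2 ltxx//.
exists (fun x => (prim a f b)^-1 * f x); split.
- split; first by apply: (smooth1M (smooth1_cst _)); exact: bf.1.
  have [_ [c [d [ac db H]]]] := bf; exists c, d; split => // x.
  by rewrite mulf_eq0 negb_or => /andP[_]; exact: H.
- by move=> x; rewrite mulr_ge0// invr_ge0 ltW.
- rewrite /prim RintegralZl//; last exact: integrable_segment.
  by rewrite mulVf// gt_eqF.
Unshelve. all: by end_near. Qed.

End bumps.

(** * Smooth functions of several variables and test functions *)

Section smooth_space.
Context {R : realType} {n : nat}.
Implicit Types (u v phi : 'rV[R]_n -> R) (i j : 'I_n) (x : 'rV[R]_n).

(** The base point corresponds to an arbitrary parameter t of the line, so that
    the parameter can be the coordinate itself. *)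
Lemma derive_line phi x (w : 'rV[R]_n) (g : R -> R) (t : R) :
  (forall h, phi (h *: w + x) = g (h + t)) ->
  'D_w phi x = 'D_1 g t /\ (derivable phi x w <-> derivable g t 1).
Proof.
move=> H; have E : (fun h : R => h^-1 *: ((phi \o shift x) (h *: w) - phi x)) =
    (fun h : R => h^-1 *: ((g \o shift t) (h *: 1) - g t)).
  apply/funext => h; have := H 0; rewrite scale0r !add0r /= H => <-.
  by rewrite [h *: 1]mulr1.
by split; rewrite /derive /derivable E.
Qed.

(** The partial derivative taken first is the outermost layer here, whereas it is
    the last letter of the word in [partials]; products require the former. *)
Fixpoint Cn k phi : Prop := continuous phi /\
  (if k is k'.+1 then forall i, (forall x, derivable phi x (delta_mx ord0 i)) /\
    Cn k' (fun x => 'D_(delta_mx ord0 i) phi x) else True).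

Lemma partials_rcons s i phi : partials (rcons s i) phi =
  partials s (fun x => 'D_(delta_mx ord0 i) phi x).
Proof. by elim: s => //= j s ->. Qed.

Lemma smooth_partial i phi :
  smooth phi -> smooth (fun x => 'D_(delta_mx ord0 i) phi x).
Proof. by move=> sphi s; have := sphi (rcons s i); rewrite partials_rcons. Qed.

Lemma smooth_partials s phi : smooth phi -> smooth (partials s phi).
Proof.
elim/last_ind: s phi => [|s i IH] phi sphi; first exact: sphi.
by rewrite partials_rcons; apply: IH; exact: smooth_partial.
Qed.

Lemma smooth_continuous phi : smooth phi -> continuous phi.
Proof. by move=> /(_ [::])[]. Qed.

Lemma smooth_derivable i phi x : smooth phi -> derivable phi x (delta_mx ord0 i).
Proof. by move=> /(_ [::])[_]; exact. Qed.

Lemma smoothP phi : smooth phi <-> forall k, Cn k phi.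
Proof.
split.
  move=> + k; elim: k phi => [|k IHk] phi sphi.
    by split => //; exact: smooth_continuous.
  split; first exact: smooth_continuous.
  by move=> i; split => [x|]; [exact: smooth_derivable|exact/IHk/smooth_partial].
move=> + s; elim/last_ind: s phi => [|s i IH] phi Cphi.
  split; first by have [] := Cphi 0%N.
  by move=> i x; have [_ /(_ i)[]] := Cphi 1%N.
rewrite partials_rcons; apply: IH => k.
by have [_ /(_ i)[]] := Cphi k.+1.
Qed.

Lemma CnS k phi : Cn k.+1 phi -> Cn k phi.
Proof.
elim: k phi => [|k IHk] phi; first by move=> [].
move=> [cphi H]; split => // i; have [dphi Hi] := H i; split => //; exact: IHk.
Qed.

Lemma CnD k u v : Cn k u -> Cn k v -> Cn k (u \+ v).
Proof.
elim: k u v => [|k IHk] u v [cu Hu] [cv Hv].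
  by split=> //= x; apply: continuousD; [exact: cu|exact: cv].
split; first by move=> x; apply: continuousD; [exact: cu|exact: cv].
move=> i; have [du Hui] := Hu i; have [dv Hvi] := Hv i.
split; first by move=> x; exact: derivableD.
rewrite (_ : (fun x => _) = (fun x => 'D_(delta_mx ord0 i) u x) \+
  (fun x => 'D_(delta_mx ord0 i) v x)); first exact: IHk.
by apply/funext => x; rewrite deriveD.
Qed.

Lemma CnM k u v : Cn k u -> Cn k v -> Cn k (u \* v).
Proof.
elim: k u v => [|k IHk] u v Cu Cv; have [cu Hu] := Cu; have [cv Hv] := Cv.
  by split=> //= x; apply: continuousM; [exact: cu|exact: cv].
split; first by move=> x; apply: continuousM; [exact: cu|exact: cv].
move=> i; have [du Hui] := Hu i; have [dv Hvi] := Hv i.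
split; first by move=> x; exact: derivableM.
rewrite (_ : (fun x => _) = (u \* (fun x => 'D_(delta_mx ord0 i) v x)) \+
  (v \* (fun x => 'D_(delta_mx ord0 i) u x))).
  by apply: CnD; apply: IHk => //; exact: CnS.
by apply/funext => x; rewrite deriveM.
Qed.

Lemma Cn_cst k (c : R) : Cn k (fun=> c).
Proof.
elim: k c => [|k IHk] c; first by split => //; exact: cst_continuous.
split; first exact: cst_continuous.
move=> i; split; first by move=> x; exact: (derivable_cst c).
have -> : (fun x : 'rV[R]_n => 'D_(delta_mx ord0 i) (fun=> c) x) = (fun=> 0 : R).
  by apply/funext => x; exact: derive_cst.
exact: IHk.
Qed.

Lemma smooth_cst (c : R) : smooth (fun _ : 'rV[R]_n => c).
Proof. by apply/smoothP => k; exact: Cn_cst. Qed.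

Lemma smoothD u v : smooth u -> smooth v -> smooth (u \+ v).
Proof. by move=> /smoothP su /smoothP sv; apply/smoothP => k; exact: CnD. Qed.

Lemma smoothM u v : smooth u -> smooth v -> smooth (u \* v).
Proof. by move=> /smoothP su /smoothP sv; apply/smoothP => k; exact: CnM. Qed.

Lemma smooth_sum (I : Type) (r : seq I) (P : pred I) (F : I -> 'rV[R]_n -> R) :
  (forall k, P k -> smooth (F k)) -> smooth (fun x => \sum_(k <- r | P k) F k x).
Proof.
move=> sF; elim: r => [|k r IHr].
  by rewrite (_ : (fun x => _) = fun=> 0); [exact: smooth_cst|
    apply/funext => x; rewrite big_nil].
have [Pk|Pk] := boolP (P k).
  rewrite (_ : (fun x => _) = F k \+ (fun x => \sum_(k <- r | P k) F k x)).
    by apply: smoothD; [exact: sF|exact: IHr].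
  by apply/funext => x; rewrite big_cons Pk.
rewrite (_ : (fun x => _) = (fun x => \sum_(k <- r | P k) F k x))//.
by apply/funext => x; rewrite big_cons (negbTE Pk).
Qed.

Lemma smooth_prod (I : Type) (r : seq I) (P : pred I) (F : I -> 'rV[R]_n -> R) :
  (forall k, P k -> smooth (F k)) -> smooth (fun x => \prod_(k <- r | P k) F k x).
Proof.
move=> sF; elim: r => [|k r IHr].
  by rewrite (_ : (fun x => _) = fun=> 1); [exact: smooth_cst|
    apply/funext => x; rewrite big_nil].
have [Pk|Pk] := boolP (P k).
  rewrite (_ : (fun x => _) = F k \* (fun x => \prod_(k <- r | P k) F k x)).
    by apply: smoothM; [exact: sF|exact: IHr].
  by apply/funext => x; rewrite big_cons Pk.
rewrite (_ : (fun x => _) = (fun x => \prod_(k <- r | P k) F k x))//.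
by apply/funext => x; rewrite big_cons (negbTE Pk).
Qed.

Lemma derive_coord (f f' : R -> R) i j x :
  (forall t : R, is_derive t (1 : R) f (f' t)) ->
  'D_(delta_mx ord0 j) (fun x => f (x ord0 i)) x =
    (if i == j then f' (x ord0 i) else 0) /\
  derivable (fun x => f (x ord0 i)) x (delta_mx ord0 j).
Proof.
move=> ff'; have [<-|ij] := eqVneq i j.
  have E h : f ((h *: delta_mx ord0 i + x) ord0 i) = f (h + x ord0 i).
    by rewrite !mxE !eqxx mulr1.
  have [-> H] := @derive_line (fun x => f (x ord0 i)) x _ f (x ord0 i) E.
  have [d <-] := ff' (x ord0 i); split; [reflexivity|exact/H].
have E h : f ((h *: delta_mx ord0 j + x) ord0 i) = cst (f (x ord0 i)) (h + 0).
  by rewrite !mxE (negbTE ij) andbF mulr0 add0r.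
have [-> H] := @derive_line (fun x => f (x ord0 i)) x _ (cst (f (x ord0 i))) 0 E.
by split; [exact: derive_cst|exact/H/derivable_cst].
Qed.

Lemma smooth_coord f i : smooth1 f -> smooth (fun x : 'rV[R]_n => f (x ord0 i)).
Proof.
move=> sf; apply/smoothP => k; elim: k f sf => [|k IHk] f sf.
  split => // x; apply: (@continuous_comp _ _ _ (fun x : 'rV[R]_n => x ord0 i)).
    exact: coord_continuous.
  exact: smooth1_continuous.
have [f' ff' sf'] := smooth1_deriv sf.
split.
  move=> x; apply: (@continuous_comp _ _ _ (fun x : 'rV[R]_n => x ord0 i)).
    exact: coord_continuous.
  exact: smooth1_continuous.
move=> j; split; first by move=> x; have [] := derive_coord i j x ff'.
rewrite (_ : (fun x => _) = if i == j then fun x => f' (x ord0 i) else fun=> 0).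
  by case: ifP => _; [exact: IHk|exact: Cn_cst].
by apply/funext => x; have [-> _] := derive_coord i j x ff'; case: ifP.
Qed.

Lemma support_out Omega phi x : test_function Omega phi -> ~ Omega x -> phi x = 0.
Proof.
move=> [_ _ sO] nOx; apply/eqP/negPn/negP => phix; apply: nOx; apply: sO.
exact: subset_closure.
Qed.

Lemma test_function_sub (A B : set 'rV[R]_n) phi :
  A `<=` B -> test_function A phi -> test_function B phi.
Proof. by move=> AB [s c sA]; split => //; exact: subset_trans AB. Qed.

Lemma derive_out phi i x : ~ closure [set x | phi x != 0] x ->
  'D_(delta_mx ord0 i) phi x = 0.
Proof.
move=> ncx; rewrite (@near_eq_derive _ _ _ _ (cst 0)) ?derive_cst//.
have : open (~` closure [set x | phi x != 0]).
  by apply: closed_openC; exact: closed_closure.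
rewrite openE => /(_ x ncx); apply: filterS => y ncy.
by apply/eqP/negPn/negP => py; apply: ncy; exact: subset_closure.
Qed.

Lemma test_function_partial Omega phi i : test_function Omega phi ->
  test_function Omega (fun x => 'D_(delta_mx ord0 i) phi x).
Proof.
move=> [s c sO].
have H : closure [set x | 'D_(delta_mx ord0 i) phi x != 0] `<=`
    closure [set x | phi x != 0].
  rewrite [X in _ `<=` X](_ : _ = closure (closure [set x | phi x != 0])).
    apply: closureS => x /= Dx; apply: contrapT => /(derive_out i) D0.
    by rewrite D0 eqxx in Dx.
  rewrite -((closure_id (closure [set x | phi x != 0])).1 _)//.
  exact: closed_closure.
split; [exact: smooth_partial| |exact: subset_trans sO].
by apply: subclosed_compact c H; exact: closed_closure.
Qed.

Lemma test_function_partials Omega phi s : test_function Omega phi ->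
  test_function Omega (partials s phi).
Proof.
by move=> tphi; elim: s => //= i s IH; exact: test_function_partial.
Qed.

Definition bumps (a b : 'I_n -> R) (psi : 'I_n -> R -> R) :=
  forall i, bump_on (a i) (b i) (psi i).

Definition tensor (psi : 'I_n -> R -> R) (x : 'rV[R]_n) :=
  \prod_i psi i (x ord0 i).

Lemma smooth_tensor psi : (forall i, smooth1 (psi i)) -> smooth (tensor psi).
Proof.
move=> spsi; rewrite (_ : tensor psi = (fun x => \prod_i (fun y : 'rV_n => psi i (y ord0 i)) x))//.
by apply: smooth_prod => i _; exact: smooth_coord.
Qed.

Lemma tensor_out a b psi x : bumps a b psi -> ~ box a b x -> tensor psi x = 0.
Proof.
move=> bpsi nx; have /existsNP[i Hi] := nx.
rewrite /tensor (bigD1 i)//= (bump_out (bpsi i)) ?mul0r//.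
exact/negP.
Qed.

Lemma test_function_tensor a b psi :
  bumps a b psi -> test_function (box a b) (tensor psi).
Proof.
move=> bpsi; have /choice[c Hc] : forall i, exists c : R * R,
    [/\ (a i < c.1)%R, (c.2 < b i)%R & forall t, psi i t != 0 -> (c.1 <= t <= c.2)%R].
  by move=> i; have [_ [c [d H]]] := bpsi i; exists (c, d).
pose K : set 'rV[R]_n := [set x | forall i, `[(c i).1, (c i).2]%classic (x ord0 i)].
have cK : compact K.
  apply: (@rV_compact R n (fun i => `[(c i).1, (c i).2]%classic)) => i.
  exact: segment_compact.
have clK : closed K.
  exact: (@compact_closed 'rV[R]_n K (@norm_hausdorff R 'rV[R]_n) cK).
have sK : closure [set x | tensor psi x != 0] `<=` K.
  rewrite [X in _ `<=` X](closure_id _).1//; apply: closureS => x /= px i.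
  have [_ _] := Hc i; rewrite /= in_itv/=; apply.
  by move: px; apply: contra => /eqP pi0; rewrite /tensor (bigD1 i)//= pi0 mul0r.
split; first by apply: smooth_tensor => i; exact: (bpsi i).1.
- by apply: subclosed_compact cK sK; exact: closed_closure.
- apply: (subset_trans sK) => x Kx i; have [h1 h2 _] := Hc i.
  have := Kx i; rewrite /= in_itv/= => /andP[h3 h4].
  by rewrite (lt_le_trans h1 h3) (le_lt_trans h4 h2).
Qed.

(** A partial derivative of a tensor product replaces one factor by its
    derivative, so the factor is made explicit. *)
Definition set_factor (psi : 'I_n -> R -> R) i (f : R -> R) :=
  fun l => if l == i then f else psi l.

Lemma tensor_set_factor psi i f x :
  tensor (set_factor psi i f) x = f (x ord0 i) * \prod_(l | l != i) psi l (x ord0 l).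
Proof.
rewrite /tensor (bigD1 i)//= /set_factor eqxx; congr (_ * _).
by apply: eq_bigr => l /negbTE ->.
Qed.

Lemma derive_tensor psi i (f f' : R -> R) x :
  (forall t : R, is_derive t (1 : R) f (f' t)) ->
  'D_(delta_mx ord0 i) (tensor (set_factor psi i f)) x =
  tensor (set_factor psi i f') x.
Proof.
move=> ff'; set c := \prod_(l | l != i) psi l (x ord0 l).
have E h : tensor (set_factor psi i f) (h *: delta_mx ord0 i + x) =
    (fun t => f t * c) (h + x ord0 i).
  rewrite tensor_set_factor !mxE !eqxx mulr1; congr (_ * _).
  by apply: eq_bigr => l li; rewrite !mxE eqxx (negbTE li) mulr0 add0r.
have [-> _] := @derive_line _ x _ (fun t => f t * c) (x ord0 i) E.
rewrite tensor_set_factor -/c.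
have H : is_derive (x ord0 i) (1 : R) (f \* (cst c)) (f (x ord0 i) *: 0 + c *: f' (x ord0 i)).
  exact: is_deriveM.
have [_ ->] := H; rewrite scaler0 add0r; exact: mulrC.
Qed.

End smooth_space.

(** * The fundamental lemma of the calculus of variations *)

Section density_measure.
Local Open Scope ereal_scope.
Context d (T : measurableType d) (R : realType).
Variables (mu : {measure set T -> \bar R}) (f : T -> \bar R).
Hypotheses (mf : measurable_fun setT f) (f0 : forall x, 0 <= f x).

(** The proofs are arguments of the definition, so that the measure structure can
    be found from the function alone. *)
Definition density_measure of measurable_fun setT f & (forall x, 0 <= f x) :=
  fun A : set T => \int[mu]_(x in A) f x.

Local Notation nu := (density_measure mf f0).

Let nu0 : nu set0 = 0. Proof. exact: integral_set0. Qed.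

Let nu_ge0 A : 0 <= nu A. Proof. by apply: integral_ge0 => x _; exact: f0. Qed.

Let nu_sigma_additive : semi_sigma_additive nu.
Proof.
move=> F mF tF mUF; rewrite /density_measure ge0_integral_bigcup//; last first.
  exact: measurable_funTS.
apply: is_cvg_ereal_nneg_natsum_cond => n _ _.
by apply: integral_ge0 => x _; exact: f0.
Qed.

HB.instance Definition _ := isMeasure.Build _ _ _ nu nu0 nu_ge0 nu_sigma_additive.

End density_measure.

Section fundamental_lemma.
Context {R : realType} {n : nat}.
Local Notation leb := (lebesgue_rV R n).
Implicit Types (a b : 'I_n -> R) (h : 'rV[R]_n -> R).

(** The positive and the negative part of h are the densities of two measures
    that agree on boxes, hence on all measurable sets. *)
Lemma integral_boxes_eq0 h : leb.-integrable setT (EFin \o h) ->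
  (forall a b, \int[leb]_(x in box a b) (h x)%:E = 0)%E ->
  {ae leb, forall x, h x = 0}.
Proof.
move=> Ih H.
have mh := measurable_int _ Ih.
have mp := measurable_funepos mh; have mn := measurable_funeneg mh.
pose nup : {measure set 'rV[R]_n -> \bar R} := density_measure leb mp (funepos_ge0 _).
pose nun : {measure set 'rV[R]_n -> \bar R} := density_measure leb mn (funeneg_ge0 _).
have IB B : measurable B -> leb.-integrable B (EFin \o h).
  by move=> mB; exact: integrableS Ih.
have fp B : measurable B -> nup B \is a fin_num.
  move=> mB; apply: integrable_fin_num => //; apply: integrable_funepos => //; exact: IB.
have fn B : measurable B -> nun B \is a fin_num.
  move=> mB; apply: integrable_fin_num => //; apply: integrable_funeneg => //; exact: IB.
have hE A : (\int[leb]_(x in A) (h x)%:E = nup A - nun A)%E by rewrite integralE.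
have E A : measurable A -> nup A = nun A.
  apply: measure_rV_unique => a b; last first.
    by rewrite ltey_eq fp//; exact: measurable_box.
  have := fn _ (measurable_box a b); have := fp _ (measurable_box a b).
  have := H a b; rewrite hE.
  case: (nup _) => // p; case: (nun _) => // q + _ _.
  by rewrite -EFinB => -[] /eqP; rewrite subr_eq0 => /eqP ->.
have : ae_eq leb setT (EFin \o h) (cst 0%E).
  apply: (@integral_ae_eq _ _ _ leb setT measurableT (cst 0%E) (EFin \o h) Ih) => [|A _ mA].
    exact: measurable_cst.
  rewrite [LHS]hE integral0 E// subee//; exact: fn.
by apply: filterS => x /(_ Logic.I) [].
Qed.

Lemma tensor_indic a b (x : 'rV[R]_n) :
  \prod_i (\1_(`]a i, b i[%classic) (x ord0 i) : R) = \1_(box a b) x.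
Proof.
rewrite [RHS]indicE; case: (boolP (x \in box a b)) => [/set_mem xab|nx].
  rewrite big1// => i _; rewrite indicE mem_set//= in_itv/=; exact: xab.
have /existsNP[i Hi] : ~ box a b x by move=> H; move: nx; rewrite mem_set.
rewrite (bigD1 i)//= indicE memNset ?mul0r//= in_itv/=; exact/negP/negP.
Qed.

Lemma cvg_tensor_mesa a b (x : 'rV[R]_n) :
  tensor (fun i => mesa (a i) (b i) m) x @[m --> \oo] --> (\1_(box a b) x : R).
Proof.
rewrite -tensor_indic /tensor; apply: cvg_big => [|i _]; last exact: cvg_mesa.
exact: mul_continuous.
Qed.

Lemma measurable_smooth (phi : 'rV[R]_n -> R) : smooth phi -> measurable_fun setT phi.
Proof. by move=> sphi; apply: continuous_measurable_rV; exact: smooth_continuous. Qed.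

(** The tensor products of mesas converge to the indicator function of a smaller
    box, so the integral of h over every box vanishes. *)
Lemma fundamental_lemma a b h : leb.-integrable (box a b) (EFin \o h) ->
  (forall psi, bumps a b psi -> \int[leb]_(x in box a b) (h x * tensor psi x) = 0) ->
  {ae leb, forall x, box a b x -> h x = 0}.
Proof.
move=> Ih H; have mQ := measurable_box a b; have mh := measurable_int _ Ih.
suff : {ae leb, forall x, (h \_ (box a b)) x = 0}.
  by apply: filterS => x + xab; rewrite patchE mem_set.
apply: integral_boxes_eq0.
  by rewrite -restrict_EFin; apply/(integrable_mkcond _ mQ).
move=> a' b'.
pose a2 i := Num.max (a i) (a' i); pose b2 i := Num.min (b i) (b' i).
have -> : (\int[leb]_(x in box a' b') ((h \_ (box a b)) x)%:E =
    \int[leb]_(x in box a b) (h x * \1_(box a2 b2) x)%:E)%E.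
  rewrite integral_mkcond [RHS]integral_mkcond; apply: eq_integral => x _.
  rewrite !patchE -boxI indicI /=.
  case: (boolP (x \in box a' b')) => xab'; case: (boolP (x \in box a b)) => xab //=.
    by rewrite !indicE xab xab' !mulr1.
  by rewrite !indicE (negbTE xab') !mulr0.
pose psi m i := mesa (a2 i) (b2 i) m.
have bpsi m : bumps a b (psi m).
  move=> i; have [s [c [d [ac db Hcd]]]] := bump_mesa (a2 i) (b2 i) m.
  split => //; exists c, d; split => //.
    by apply: le_lt_trans ac; rewrite le_max lexx.
  by apply: lt_le_trans db _; rewrite ge_min lexx.
have tens1 m x : `|tensor (psi m) x| <= 1.
  rewrite normr_prod; apply: prodr_ile1 => i _.
  by rewrite normr_ge0 ger0_norm ?mesa_ge0 ?mesa_le1.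
have mt m : measurable_fun (box a b) (EFin \o (fun x => h x * tensor (psi m) x)).
  apply/measurable_EFinP; apply: measurable_funM; first exact/measurable_EFinP.
  apply: measurable_funTS; apply: measurable_smooth.
  by apply: smooth_tensor => i; exact: (bpsi m i).1.
have It m : leb.-integrable (box a b) (EFin \o (fun x => h x * tensor (psi m) x)).
  apply: (le_integrable mQ (mt m) _ Ih) => x _ /=.
  by rewrite lee_fin normrM ler_piMr.
have int0 m : (\int[leb]_(x in box a b) (h x * tensor (psi m) x)%:E = 0)%E.
  have := H _ (bpsi m); rewrite /Rintegral.
  have := integrable_fin_num mQ (It m).
  by case: (integral _ _ _) => // r _ /= ->.
have [|||||_ _ cvgt] := @dominated_convergence _ _ _ leb _ mQ
  (fun m x => (h x * tensor (psi m) x)%:E)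
  (fun x => (h x * \1_(box a2 b2) x)%:E) (fun x => `|h x|%:E).
- by move=> m; exact: mt.
- apply/measurable_EFinP; apply: measurable_funM; first exact/measurable_EFinP.
  by apply: measurable_funTS; apply: measurable_indic; exact: measurable_box.
- apply: aeW => x _; apply: cvg_EFin; first by near=> m.
  by apply: cvgM; [exact: cvg_cst|exact: cvg_tensor_mesa].
- exact: integrable_norm.
- by apply: aeW => x m _; rewrite lee_fin normrM ler_piMr.
apply: (cvg_unique _ cvgt) => //.
rewrite (_ : (fun m => _) = cst 0%E); first exact: cvg_cst.
by apply/funext => m; exact: int0.
Unshelve. all: by end_near. Qed.

End fundamental_lemma.

(** * Integrability of bounded products and of squares *)

Section integrability.
Context d (T : measurableType d) (R : realType) (mu : {measure set T -> \bar R}).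
Implicit Types (f g : T -> R) (D : set T).

Lemma integrableM_bounded D f g (M : R) : measurable D ->
  mu.-integrable D (EFin \o f) -> measurable_fun D g ->
  (forall x, D x -> `|g x| <= M) -> mu.-integrable D (EFin \o (f \* g)).
Proof.
move=> mD If mg gM; have /measurable_EFinP mf := measurable_int _ If.
apply: (le_integrable mD _ _ (integrableZl mD M If)).
  by apply/measurable_EFinP; exact: measurable_funM.
move=> x Dx; rewrite lee_fin !normrM mulrC ler_wpM2r//.
by apply: le_trans (ler_norm _); exact: gM.
Qed.

Lemma integrable_cst_fin D (k : R) : measurable D -> (mu D < +oo)%E ->
  mu.-integrable D (EFin \o cst k).
Proof.
move=> mD muD; apply/integrableP; split; first by apply/measurable_EFinP; exact: measurable_cst.
rewrite (_ : (fun x => _) = cst `|k|%:E)// integral_cst//.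
by rewrite lte_mul_pinfty.
Qed.

Lemma sqr_integrable D f : measurable D -> (mu D < +oo)%E ->
  measurable_fun D f -> (\int[mu]_(x in D) ((f x) ^+ 2)%:E < +oo)%E ->
  mu.-integrable D (EFin \o f) /\ mu.-integrable D (EFin \o (fun x => f x ^+ 2)).
Proof.
move=> mD muD mf f2.
have If2 : mu.-integrable D (EFin \o (fun x => f x ^+ 2)).
  apply/integrableP; split.
    by apply/measurable_EFinP; exact: measurable_funX.
  apply: le_lt_trans f2; apply: ge0_le_integral => //.
  - by apply/measurable_EFinP; apply: measurableT_comp => //; exact: measurable_funX.
  - by apply/measurable_EFinP; exact: measurable_funX.
  - by move=> x _; rewrite lee_fin ger0_norm// sqr_ge0.
split => //.
have I1 : mu.-integrable D (EFin \o (fun x => 1 + f x ^+ 2)).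
  rewrite (_ : _ \o _ = (fun x => (1%:E + (f x ^+ 2)%:E)%E))//.
  by apply: integrableD => //; exact: integrable_cst_fin.
apply: (le_integrable mD _ _ I1); first exact/measurable_EFinP.
move=> x _; rewrite lee_fin [leRHS]ger0_norm ?addr_ge0 ?sqr_ge0//=.
have le1sqr (t : R) : t <= 1 + t ^+ 2.
  by have h1 := sqr_ge0 (t - 1); have h2 := sqr_ge0 t; nra.
by have := le1sqr `|f x|; rewrite real_normK ?num_real.
Qed.

End integrability.

Section bounded_bumps.
Context {R : realType}.

Lemma bump_bounded (a b : R) psi : bump_on a b psi ->
  exists2 M, 0 <= M & forall x, `|psi x| <= M.
Proof.
move=> bpsi; have cpsi := smooth1_continuous bpsi.1.
have [ab|ba] := leP a b; last first.
  exists 0 => // x; rewrite (bump_out bpsi) ?normr0//.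
  by apply/negP => /andP[ax xb]; have := lt_trans ba (lt_trans ax xb); rewrite ltxx.
have cn : {within `[a, b], continuous (fun x => `|psi x|)}.
  apply: continuous_subspaceT => x; apply: continuous_comp; first exact: cpsi.
  exact: norm_continuous.
have [c cab Hc] := EVT_max ab cn.
exists `|psi c| => // x.
have [axb|nx] := boolP (a < x < b); last by rewrite (bump_out bpsi nx) normr0.
by apply: Hc; rewrite in_itv/=; move: axb => /andP[/ltW-> /ltW->].
Qed.

Lemma tensor_bounded n (a b : 'I_n -> R) psi : bumps a b psi ->
  exists2 M, 0 <= M & forall x, `|tensor psi x| <= M.
Proof.
move=> bpsi; have /choice[M HM] : forall i, exists M, 0 <= M /\ forall x, `|psi i x| <= M.
  by move=> i; have [M M0 HM] := bump_bounded (bpsi i); exists M.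
exists (\prod_i M i); first by apply: prodr_ge0 => i _; have [] := HM i.
move=> x; rewrite normr_prod; apply: ler_prod => i _.
by rewrite normr_ge0; have [_ ->] := HM i.
Qed.

End bounded_bumps.

Section sqr_integral.
Context d (T : measurableType d) (R : realType) (mu : {measure set T -> \bar R}).
Variables (D : set T) (f : T -> R) (m : R).
Hypotheses (mD : measurable D) (muD : mu D = m%:E) (m0 : 0 < m).
Hypothesis mf : measurable_fun D f.

(** The Cauchy-Schwarz inequality, by expanding the square of the difference of
    f and its mean. *)
Lemma sqr_integral_le : mu.-integrable D (EFin \o f) ->
  (((\int[mu]_(x in D) f x) ^+ 2)%:E <= m%:E * \int[mu]_(x in D) ((f x) ^+ 2)%:E)%E.
Proof.
move=> If.
have [f2|] := ltP (\int[mu]_(x in D) ((f x) ^+ 2)%:E)%E +oo%E; last first.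
  by rewrite leye_eq => /eqP ->; rewrite gt0_muley ?lte_fin// leey.
have muoo : (mu D < +oo)%E by rewrite muD ltry.
have [_ If2] := sqr_integrable mD muoo mf f2.
set A := Rintegral _ _ f.
have cstI k := integrable_cst_fin k mD muoo.
have H : 0 <= \int[mu]_(x in D) ((f x ^+ 2 - (A / m *+ 2) * f x) + (A / m) ^+ 2).
  apply: Rintegral_ge0 => x _; move: (A / m) => q.
  by rewrite (_ : _ + _ = (f x - q) ^+ 2) ?sqr_ge0//; ring.
move: H; rewrite RintegralD//; last 2 first.
- rewrite (_ : _ \o _ = (fun x => (f x ^+ 2)%:E - (A / m *+ 2 * f x)%:E)%E)//.
  by apply: integrableB => //; exact: (integrableZl mD (A / m *+ 2) If).
- exact: cstI.
rewrite RintegralB//; last exact: (integrableZl mD (A / m *+ 2) If).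
rewrite RintegralZl// -/A.
have -> : (\int[mu]_(x in D) (A / m) ^+ 2 = (A / m) ^+ 2 * m)%R.
  by rewrite Rintegral_cst// muD.
move=> H; have fin2 := integrable_fin_num mD If2.
rewrite -(fineK fin2) -EFinM lee_fin -/(Rintegral _ _ _).
move: H; set S := Rintegral _ _ _ => H.
have qA : A / m * m = A by rewrite divfK// gt_eqF.
move: (A / m) qA H => q <- H.
have -> : (q * m) ^+ 2 = m * S - m * (S - (q *+ 2) * (q * m) + q ^+ 2 * m) by ring.
by rewrite gerBl mulr_ge0// ltW.
Qed.
End sqr_integral.

(** * The Poincare inequality along one coordinate *)

Lemma abse_fine_le (R : realType) (y : \bar R) : (`|(fine y)%:E| <= `|y|)%E.
Proof. by case: y => [r| |]; rewrite ?lexx ?leey. Qed.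

Lemma indic_pred (R : realType) (T : Type) (p : T -> bool) :
  \1_[set x | p x] = (fun x => (p x)%:R : R).
Proof.
apply/funext => x; rewrite indicE; case: (boolP (p x)) => px.
  by rewrite mem_set.
by rewrite memNset//; exact/negP.
Qed.

Lemma norm_sub_bool (R : realType) (t : R) (c : bool) :
  0 <= t <= 1 -> `|t - c%:R| <= 1.
Proof.
move=> /andP[t0 t1]; rewrite ler_norml; case: c => /=; apply/andP; split; lra.
Qed.

Section one_direction.
Context {R : realType} {n : nat}.
Local Notation leb := (lebesgue_rV R n).
Local Notation lam := (@lebesgue_measure R).
Variables (i : 'I_n) (a b : 'I_n -> R) (u g : 'rV[R]_n -> R).
Let Q := box a b.
Let I : set (measurableTypeR R) := `]a i, b i[%classic.
Hypothesis abi : a i < b i.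
Hypotheses (Iu : leb.-integrable Q (EFin \o u)) (Ig : leb.-integrable Q (EFin \o g)).
Hypothesis weak : forall psi, bumps a b psi ->
  \int[leb]_(x in Q) (u x * 'D_(delta_mx ord0 i) (tensor psi) x) =
  - \int[leb]_(x in Q) (g x * tensor psi x).
Variable eta : R -> R.
Hypotheses (beta : bump_on (a i) (b i) eta) (eta0 : forall t, 0 <= eta t)
  (eta1 : prim (a i) eta (b i) = 1).

Let mQ : measurable Q. Proof. exact: measurable_box. Qed.
Let mI : measurable I. Proof. exact: measurable_itv. Qed.
Let mu_ : measurable_fun Q u.
Proof. by apply/measurable_EFinP; exact: measurable_int Iu. Qed.
Let mg_ : measurable_fun Q g.
Proof. by apply/measurable_EFinP; exact: measurable_int Ig. Qed.

(** For smooth v on the interval, integration by parts gives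
    v(r) = int v eta + int mean_kernel(r, s) v'(s) ds, and the kernel is bounded
    by 1 because eta is a probability density. *)
Definition mean_kernel (s r : R) : R := prim (a i) eta r - (s <= r)%R%:R.

Let Theta_itv x : 0 <= prim (a i) eta x <= 1.
Proof.
have ceta := smooth1_continuous beta.1.
have [xb|bx] := leP x (b i).
  by have := prim_le (a i) ceta eta0 xb; rewrite eta1.
by rewrite (prim_right beta (ltW bx)) eta1 ler01 lexx.
Qed.

Let mean_kernel_le1 s r : `|mean_kernel s r| <= 1.
Proof.
exact: norm_sub_bool (Theta_itv r).
Qed.

Let F1 (p : measurableTypeR R * 'rV[R]_n) : R := u p.2 * eta (p.2 ord0 i).
Let F2 (p : measurableTypeR R * 'rV[R]_n) : R := mean_kernel p.1 (p.2 ord0 i) * g p.2.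

Let measurable_eta : measurable_fun setT eta.
Proof. by apply: continuous_measurable_fun; exact: smooth1_continuous beta.1. Qed.

Let Iueta : leb.-integrable Q (EFin \o (fun x => u x * eta (x ord0 i))).
Proof.
have [M M0 HM] := bump_bounded beta.
apply: (@integrableM_bounded _ _ _ _ _ _ (fun x : 'rV_n => eta (x ord0 i)) M) => //.
by apply: measurable_funTS; apply: (measurableT_comp measurable_eta); exact: measurable_rV_coord.
Qed.

Let IF1 : (lam \x leb)%E.-integrable (I `*` Q) (EFin \o F1).
Proof. by have [_] := integral_upd i Iueta. Qed.

Let measurable_mean_kernel :
  measurable_fun setT (fun p : measurableTypeR R * 'rV[R]_n => mean_kernel p.1 (p.2 ord0 i)).
Proof.
have mi : measurable_fun setT (fun p : measurableTypeR R * 'rV[R]_n => p.2 ord0 i : R).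
  by apply: (measurableT_comp (measurable_rV_coord i)); exact: measurable_snd.
apply: measurable_funB.
  apply: (measurableT_comp _ mi); apply: continuous_measurable_fun.
  by apply: smooth1_continuous; exact: smooth1_prim beta.
suff : measurable_fun setT
    (\1_[set p : measurableTypeR R * 'rV[R]_n | p.1 <= p.2 ord0 i] : _ -> R).
  by rewrite indic_pred.
apply: measurable_indic; rewrite -[X in measurable X]setTI.
by apply: measurable_fun_le => //; exact: measurable_fst.
Qed.

Let IF2 : (lam \x leb)%E.-integrable (I `*` Q) (EFin \o F2).
Proof.
have [_ Ig2] := integral_upd i Ig.
rewrite (_ : F2 = (g \o snd) \* (fun p => mean_kernel p.1 (p.2 ord0 i))); last first.
  by apply/funext => p /=; rewrite mulrC.
apply: (integrableM_bounded (measurableX mI mQ) Ig2 (M := 1)) => //.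
by apply: measurable_funTS; exact: measurable_mean_kernel.
Qed.

(** The integrand K of the representation formula is F composed with the exchange
    of s and x_i, which gives its measurability and integrability. *)
Let F p := F1 p + F2 p.
Let K (s : measurableTypeR R) (x : 'rV[R]_n) : R := F (x ord0 i, upd i s x).

Let IF : (lam \x leb)%E.-integrable (I `*` Q) (EFin \o F).
Proof.
rewrite (_ : _ \o _ = (fun p => (F1 p)%:E + (F2 p)%:E)%E)//.
by apply: integrableD => //; exact: measurableX.
Qed.

Let IK : (lam \x leb)%E.-integrable (I `*` Q) (fun p => (K p.1 p.2)%:E).
Proof. exact: (integrable_exchange IF). Qed.

Section test.
Variable psi : 'I_n -> R -> R.
Hypothesis bpsi : bumps a b psi.
Let P (x : 'rV[R]_n) := \prod_(l | l != i) psi l (x ord0 l).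
Let m := prim (a i) (psi i) (b i).
Let Phi r := prim (a i) (psi i) r - m * prim (a i) eta r.

Let tensor_upd s x : tensor psi (upd i s x) = psi i s * P x.
Proof.
rewrite /tensor (bigD1 i)//= upd_eq; congr (_ * _).
by apply: eq_bigr => l li; rewrite upd_neq.
Qed.

Let tensorE x : tensor psi x = psi i (x ord0 i) * P x.
Proof. by rewrite -{1}(upd_id i x) tensor_upd. Qed.

Let T (p : measurableTypeR R * 'rV[R]_n) := tensor psi (upd i p.1 p.2).

Let measurable_T : measurable_fun setT T.
Proof.
apply: (measurableT_comp _ (measurable_upd i)).
by apply: measurable_smooth; apply: smooth_tensor => l; exact: (bpsi l).1.
Qed.

Let IFT : (lam \x leb)%E.-integrable (I `*` Q) (EFin \o (F \* T)).
Proof.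
have [M _ HM] := tensor_bounded bpsi.
apply: (integrableM_bounded (measurableX mI mQ) IF (M := M)).
  by apply: measurable_funTS; exact: measurable_T.
by move=> p _; exact: HM.
Qed.

Let KT s x : K s x * tensor psi x = (F \* T) (exchange i (s, x)).
Proof. by rewrite /K /exchange /T /= upd_upd upd_id. Qed.

Let cpsi := smooth1_continuous (bpsi i).1.

Let Ipsi : lam.-integrable I (EFin \o psi i).
Proof.
apply: integrableS (integrable_segment (a i) (b i) cpsi) => //.
by apply: subset_itvW; rewrite ?lexx.
Qed.

Let integral_psi : (\int[lam]_(s in I) (psi i s)%:E = m%:E)%E.
Proof.
rewrite /m /prim /Rintegral fineK; last first.
  by apply: integrable_fin_num => //; exact: integrable_segment.
rewrite [LHS]integral_mkcond [RHS]integral_mkcond; apply: eq_integral => s _.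
rewrite !patchE; have [sab|nsab] := boolP (a i < s < b i).
  rewrite !mem_set//= in_itv//=; have /andP[? ?] := sab.
  by rewrite !ltW.
by rewrite (bump_out (bpsi i) nsab) !if_same.
Qed.

Let integral_mean_kernel r : I r ->
  lam.-integrable I (fun s => (mean_kernel s r * psi i s)%:E) /\
  (\int[lam]_(s in I) (mean_kernel s r * psi i s)%:E = (- Phi r)%:E)%E.
Proof.
rewrite /I /= in_itv/= => /andP[ar rb].
have Ipsir : lam.-integrable I (EFin \o (fun s => (s <= r)%R%:R * psi i s)).
  apply: (le_integrable mI _ _ Ipsi).
    apply/measurable_EFinP; apply: measurable_funM; last first.
      by apply: measurable_funTS; exact: continuous_measurable_fun.
    suff : measurable_fun I (\1_[set s : measurableTypeR R | s <= r] : _ -> R).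
      by rewrite indic_pred.
    apply: measurable_funTS; apply: measurable_indic.
    by rewrite -[X in measurable X]setTI; apply: measurable_fun_le => //.
  move=> s _ /=; rewrite lee_fin; case: (s <= r); first by rewrite mul1r.
  by rewrite mul0r normr0.
have E2 : (\int[lam]_(s in I) ((s <= r)%R%:R * psi i s)%:E = (prim (a i) (psi i) r)%:E)%E.
  rewrite /prim /Rintegral fineK; last first.
    by apply: integrable_fin_num => //; exact: integrable_segment.
  rewrite [LHS]integral_mkcond [RHS]integral_mkcond; apply: eq_integral => s _.
  rewrite !patchE; have [sab|nsab] := boolP (a i < s < b i); last first.
    by rewrite (bump_out (bpsi i) nsab) mulr0 !if_same.
  rewrite mem_set//=; have /andP[as_ sb] := sab.
  rewrite !mem_setE /= in_itv/= (ltW as_)/=.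
  by case: (s <= r); rewrite ?mul1r ?mul0r.
have mean_kernelE s : ((mean_kernel s r * psi i s)%:E =
    (prim (a i) eta r * psi i s)%:E - ((s <= r)%R%:R * psi i s)%:E)%E.
  by rewrite -EFinB -mulrBl.
split.
  apply: (eq_integrable mI (fun s => (prim (a i) eta r * psi i s)%:E
      - ((s <= r)%R%:R * psi i s)%:E)%E); first by move=> s _; rewrite mean_kernelE.
  by apply: integrableB => //; exact: (integrableZl mI _ Ipsi).
transitivity (\int[lam]_(s in I)
    ((prim (a i) eta r * psi i s)%:E - ((s <= r)%R%:R * psi i s)%:E))%E.
  by apply: eq_integral => s _; rewrite mean_kernelE.
rewrite integralB//; last exact: (integrableZl mI _ Ipsi).
rewrite [X in (_ - X)%E]E2; under eq_integral do rewrite EFinM.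
rewrite integralZl// [X in (_ * X)%E]integral_psi -EFinM -EFinB; congr (_%:E).
by rewrite /Phi; ring.
Qed.

Let k x := (\int[lam]_(s in I) (K s x)%:E)%E.

Let integral_FT x : Q x -> (\int[lam]_(s in I) (F (s, x) * T (s, x))%:E =
  (u x * (m * (eta (x ord0 i) * P x)) - g x * (Phi (x ord0 i) * P x))%:E)%E.
Proof.
move=> Qx; have Ixi : I (x ord0 i) by rewrite /I /= in_itv/=; exact: Qx.
have [Ik Ek] := integral_mean_kernel Ixi.
transitivity (\int[lam]_(s in I) ((u x * eta (x ord0 i) * P x)%:E * (psi i s)%:E
   + (g x * P x)%:E * (mean_kernel s (x ord0 i) * psi i s)%:E))%E.
  apply: eq_integral => s _; rewrite -!EFinM -EFinD; congr (_%:E).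
  by rewrite /F /F1 /F2 /T /= tensor_upd; ring.
rewrite integralD//; [|exact: integrableZl|exact: integrableZl].
rewrite integralZl// [X in (_ * X + _)%E]integral_psi integralZl// [X in (_ + _ * X)%E]Ek.
by rewrite -!EFinM -EFinD; congr (_%:E); ring.
Qed.

Let integrable_tensor f psi' : leb.-integrable Q (EFin \o f) -> bumps a b psi' ->
  leb.-integrable Q (EFin \o (f \* tensor psi')).
Proof.
move=> If bpsi'; have [M _ HM] := tensor_bounded bpsi'.
apply: (integrableM_bounded mQ If (M := M)).
  apply: measurable_funTS; apply: measurable_smooth.
  by apply: smooth_tensor => l; exact: (bpsi' l).1.
by move=> x _; exact: HM.
Qed.

Let bumps_set f : bump_on (a i) (b i) f -> bumps a b (set_factor psi i f).
Proof. by move=> bf l; rewrite /set_factor; case: eqP => [->|_]. Qed.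

(** After the exchange, the kernel is integrated against the ith factor psi_i of
    the test function.  This produces m eta, where m is the integral of psi_i,
    and the primitive Phi of psi_i - m eta, which is a bump: the weak derivative
    may be tested with it. *)
Lemma integral_rep_tensor :
  leb.-integrable Q (EFin \o (fun x => fine (k x) * tensor psi x)) /\
  \int[leb]_(x in Q) (fine (k x) * tensor psi x) =
  \int[leb]_(x in Q) (u x * tensor psi x).
Proof.
have bPhi : bump_on (a i) (b i) Phi by exact: prim_bump.
have bs1 := @bumps_set _ beta; have bs2 := @bumps_set _ bPhi.
have IKT := integrable_exchange IFT.
have [Ii aeI] := integrable_setX_inner mI mQ IK.
have [Ij _] := integrable_setX_inner mI mQ IKT.
have mk : measurable_fun Q k by exact: measurable_int Ii.
have mkt : measurable_fun Q (EFin \o (fun x => fine (k x) * tensor psi x)).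
  apply/measurable_EFinP; apply: measurable_funM.
    exact: measurableT_comp.
  apply: measurable_funTS; apply: measurable_smooth.
  by apply: smooth_tensor => l; exact: (bpsi l).1.
have aeE : ae_eq leb Q (EFin \o (fun x => fine (k x) * tensor psi x))
    (fun x => \int[lam]_(s in I) ((EFin \o (F \* T)%R) \o exchange i) (s, x))%E.
  apply: filterS aeI => x /= + Qx => /(_ Qx) IKx.
  transitivity (\int[lam]_(s in I) ((tensor psi x)%:E * (K s x)%:E))%E.
    have IKx' : lam.-integrable I (EFin \o (fun s => K s x)) by exact: IKx.
    have kfin : k x \is a fin_num by exact: (integrable_fin_num mI IKx').
    have E := integralZl mI IKx' (tensor psi x).
    by rewrite EFinM (fineK kfin) [RHS]E muleC.
  by apply: eq_integral => s _; rewrite -EFinM mulrC KT.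
have Ifk : leb.-integrable Q (EFin \o (fine \o k)).
  apply: (le_integrable mQ _ _ Ii); first by apply/measurable_EFinP; exact: measurableT_comp.
  by move=> x _; exact: abse_fine_le.
split; first exact: (@integrable_tensor _ _ Ifk bpsi).
have L : (\int[leb]_(x in Q) (fine (k x) * tensor psi x)%:E =
  \int[leb]_(x in Q) (u x * (m * (eta (x ord0 i) * P x)) - g x * (Phi (x ord0 i) * P x))%:E)%E.
  have -> := ae_eq_integral _ _ mQ mkt (measurable_int _ Ij) aeE.
  have [<- _] := integral_setX mI mQ IKT.
  rewrite (integral_exchange IFT).
  have [-> _] := integral_setX mI mQ IFT.
  by apply: eq_integral => x /set_mem Qx; exact: integral_FT.
rewrite {1}/Rintegral L -/(Rintegral _ _ _) {L}.
have I1 := @integrable_tensor _ _ Iu bs1; have I2 := @integrable_tensor _ _ Ig bs2.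
have I0 := @integrable_tensor _ _ Iu bpsi.
have I1m := integrableZl mQ m I1.
have dPhi (t : R) : is_derive t (1 : R) Phi (psi i t - m * eta t).
  apply: is_deriveB; first exact: is_derive_prim (bpsi i).
  exact: (@is_deriveZ _ _ _ (prim (a i) eta) m t 1 _ (is_derive_prim t beta)).
have := weak bs2.
have -> : \int[leb]_(x in Q) (u x * 'D_(delta_mx ord0 i) (tensor (set_factor psi i Phi)) x) =
    \int[leb]_(x in Q) (u x * tensor psi x - m * (u x * tensor (set_factor psi i eta) x)).
  apply: eq_Rintegral => x _.
  by rewrite (derive_tensor _ _ _ dPhi) !tensor_set_factor tensorE -/(P x); ring.
rewrite RintegralB// RintegralZl// => E.
have -> : \int[leb]_(x in Q) (u x * (m * (eta (x ord0 i) * P x)) - g x * (Phi (x ord0 i) * P x)) =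
    \int[leb]_(x in Q) (m * (u x * tensor (set_factor psi i eta) x) - g x * tensor (set_factor psi i Phi) x).
  by apply: eq_Rintegral => x _; rewrite !tensor_set_factor -/(P x); ring.
rewrite RintegralB// RintegralZl//.
by rewrite -E; ring.
Qed.

End test.

(** Both sides have the same integral against every tensor product of bumps. *)
Lemma ae_representation : {ae leb, forall x, Q x ->
  u x = fine (\int[lam]_(s in I) (K s x)%:E)%E}.
Proof.
have [Ii _] := integrable_setX_inner mI mQ IK.
have mk := measurable_int _ Ii.
set k := (fun x => _) in Ii mk.
have Ifk : leb.-integrable Q (EFin \o (fine \o k)).
  apply: (le_integrable mQ _ _ Ii); first by apply/measurable_EFinP; exact: measurableT_comp.
  by move=> x _; exact: abse_fine_le.
have Ih : leb.-integrable Q (EFin \o (fun x => u x - fine (k x))).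
  rewrite (_ : _ \o _ = (fun x => (u x)%:E - (fine (k x))%:E)%E)//.
  exact: integrableB.
have H psi : bumps a b psi ->
    \int[leb]_(x in Q) ((u x - fine (k x)) * tensor psi x) = 0.
  move=> bpsi; have [If2 E] := integral_rep_tensor bpsi.
  transitivity (\int[leb]_(x in Q) (u x * tensor psi x - fine (k x) * tensor psi x)).
    by apply: eq_Rintegral => x _; rewrite mulrBl.
  have [M _ HM] := tensor_bounded bpsi.
  rewrite RintegralB//; first by rewrite E subrr.
  apply: (integrableM_bounded mQ Iu (M := M)).
    apply: measurable_funTS; apply: measurable_smooth.
    by apply: smooth_tensor => l; exact: (bpsi l).1.
  by move=> x _; exact: HM.
apply: filterS (fundamental_lemma Ih H) => x + Qx => /(_ Qx) /eqP.
by rewrite subr_eq0 => /eqP.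
Qed.

(** The function C is the average of u with weight eta on the lines in direction
    i.  By the representation formula, u - C is the integral of g against a
    kernel bounded by 1 on a line of length b_i - a_i. *)
Lemma one_direction_poincare : exists C : 'rV[R]_n -> R,
  [/\ measurable_fun Q C, forall s x, C (upd i s x) = C x &
   (\int[leb]_(x in Q) ((u x - C x) ^+ 2)%:E <=
    ((b i - a i) ^+ 2)%:E * \int[leb]_(x in Q) ((g x) ^+ 2)%:E)%E].
Proof.
have I1 := integrable_exchange IF1; have I2 := integrable_exchange IF2.
have [Ii1 ae1] := integrable_setX_inner mI mQ I1.
have [_ ae2] := integrable_setX_inner mI mQ I2.
pose C (x : 'rV[R]_n) := fine (\int[lam]_(s in I) ((EFin \o F1) \o exchange i) (s, x))%E.
have mC : measurable_fun Q C.
  by apply: measurableT_comp => //; exact: measurable_int Ii1.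
have ba0 : 0 < b i - a i by rewrite subr_gt0.
have lamI : lam I = (b i - a i)%:E by rewrite /I lebesgue_itvoo max_r// ltW.
exists C; split => //.
  move=> s x; rewrite /C; congr fine; apply: eq_integral => t _.
  by rewrite /exchange /F1 /= !upd_upd !upd_eq.
have mg2 : measurable_fun Q (fun x => ((g x) ^+ 2)%:E).
  by apply/measurable_EFinP; exact: measurable_funX.
have g20 x : Q x -> (0 <= ((g x) ^+ 2)%:E)%E by rewrite lee_fin sqr_ge0.
have mg2e : measurable_fun (I `*` Q) (fun p => ((g (upd i p.1 p.2)) ^+ 2)%:E).
  apply: (measurable_exchange_box (i := i) (F := fun p => ((g p.2) ^+ 2)%:E)).
  apply: (measurable_comp mQ) mg2 _; first by move=> _ [p [_ ?] <-].
  by apply: measurable_funTS; exact: measurable_snd.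
pose J x := (\int[lam]_(s in I) ((g (upd i s x)) ^+ 2)%:E)%E.
have J0 x : (0 <= J x)%E by apply: integral_ge0 => s _; rewrite lee_fin sqr_ge0.
have mJ : measurable_fun Q J.
  exact: (measurable_setX_integral lam mI mQ mg2e
    (fun p _ => sqr_ge0 (g (upd i p.1 p.2)))).
apply: (@le_trans _ _ (\int[leb]_(x in Q) ((b i - a i)%:E * J x)%E)%E); last first.
  rewrite ge0_integralZl_EFin//; last exact: ltW.
  rewrite /J (ge0_integral_upd i mg2 g20) lamI muleA -EFinM -expr2.
  exact: lexx.
have aeC : {ae leb, forall x, Q x -> (((u x - C x) ^+ 2)%:E <= (b i - a i)%:E * J x)%E}.
  have := ae_representation; apply: filterS2 (filterI ae1 ae2) => x [+ +] Hu Qx.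
  move=> /(_ Qx) I1x /(_ Qx) I2x.
  have I2x' : lam.-integrable I (EFin \o (fun s => mean_kernel (x ord0 i) s * g (upd i s x))).
    apply: (eq_integrable mI (((EFin \o F2) \o exchange i) \o (pair^~ x))) I2x => s _.
    by rewrite /= /F2 /= upd_eq.
  have -> : u x - C x = \int[lam]_(s in I) (mean_kernel (x ord0 i) s * g (upd i s x)).
    rewrite (Hu Qx).
    have -> : (\int[lam]_(s in I) (K s x)%:E =
        \int[lam]_(s in I) ((EFin \o F1) \o exchange i) (s, x)
        + \int[lam]_(s in I) (mean_kernel (x ord0 i) s * g (upd i s x))%:E)%E.
      rewrite -integralD//; apply: eq_integral => s _.
      by rewrite -EFinD; congr (_%:E); rewrite /K /F /F2 /= upd_eq.
    rewrite fineD; last 2 first.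
    - exact: (integrable_fin_num mI I1x).
    - exact: (integrable_fin_num mI I2x').
    by rewrite /C addrC addKr.
  have mgx : measurable_fun I (fun s => ((g (upd i s x)) ^+ 2)%:E).
    by apply: (measurable_setX_slice mI mQ mg2e).
  have mK2 : measurable_fun I (fun s => mean_kernel (x ord0 i) s * g (upd i s x)).
    by apply/measurable_EFinP; exact: measurable_int I2x'.
  have S := sqr_integral_le mI lamI ba0 mK2 I2x'.
  apply: (le_trans S).
  rewrite lee_pmul2l ?lte_fin//; apply: ge0_le_integral => //.
  - by move=> s _; rewrite lee_fin sqr_ge0.
  - apply/measurable_EFinP; apply: measurable_funX; apply/measurable_EFinP.
    exact: measurable_int I2x'.
  - move=> s _; rewrite lee_fin exprMn ler_piMl ?sqr_ge0//.
    by rewrite -(real_normK (num_real (mean_kernel _ _))) expr_le1.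
apply: ae_ge0_le_integral => //.
- by move=> x _; rewrite lee_fin sqr_ge0.
- by apply/measurable_EFinP; apply: measurable_funX; exact: measurable_funB.
- by move=> x _; rewrite mule_ge0// lee_fin ltW.
- exact: measurable_funeM.
Qed.

End one_direction.

(** * From one coordinate to all coordinates *)

Lemma integral_cst_mul d (T : measurableType d) (R : realType)
    (mu : {measure set T -> \bar R}) (D : set T) (m : R) (y : \bar R) :
  measurable D -> mu D = m%:E -> (\int[mu]_(x in D) y = m%:E * y)%E.
Proof. by move=> mD <-; rewrite muleC -[RHS](integral_cst mu mD y). Qed.

Lemma sqr_sub_le (R : realType) (y x z : R) :
  (x - z) ^+ 2 <= 2 * (x - y) ^+ 2 + 2 * (y - z) ^+ 2.
Proof. have H := sqr_ge0 ((x - y) - (y - z)); nra. Qed.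

(** Two points of a product are joined by changing the second component first and
    the first component next; the two squared differences are integrated
    separately. *)
Section tensor_step.
Context d1 d2 (T1 : measurableType d1) (T2 : measurableType d2) (R : realType).
Variable m1 : {sigma_finite_measure set T1 -> \bar R}.
Variable m2 : {sigma_finite_measure set T2 -> \bar R}.
Variables (A : set T1) (B : set T2) (mA : measurable A) (mB : measurable B).
Variables (al be : R).
Hypotheses (m1A : m1 A = al%:E) (m2B : m2 B = be%:E).
Variable v : T1 * T2 -> R.
Hypothesis mv : measurable_fun setT v.

Let sqd (x y : R) : \bar R := ((x - y) ^+ 2)%:E.

Let sqd_ge0 x y : (0 <= sqd x y)%E. Proof. by rewrite lee_fin sqr_ge0. Qed.

Let measurable_sqr_dist d (T : measurableType d) (f g : T -> R) :
  measurable_fun setT f -> measurable_fun setT g ->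
  measurable_fun setT (fun x => sqd (f x) (g x)).
Proof.
move=> mf mg; apply/measurable_EFinP; apply: measurable_funX.
exact: measurable_funB.
Qed.

Let al0 : 0 <= al. Proof. by rewrite -lee_fin -m1A measure_ge0. Qed.
Let be0 : 0 <= be. Proof. by rewrite -lee_fin -m2B measure_ge0. Qed.

Let G1 (p : T1 * T2) := (\int[m2]_(w in B) sqd (v p) (v (p.1, w)))%E.
Let H (p : T1 * T2) := (\int[m1]_(s in A) sqd (v p) (v (s, p.2)))%E.
Let G2 (r : T1) := (\int[m2]_(w in B) H (r, w))%E.

Let mG1 : measurable_fun setT G1.
Proof.
apply: (@measurable_setX_integral _ _ _ _ _ m2 _ _ mB measurableT
  (fun q : T2 * (T1 * T2) => sqd (v q.2) (v (q.2.1, q.1)))) => //.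
apply: measurable_funTS; apply: measurable_sqr_dist.
  by apply: (measurableT_comp mv); exact: measurable_snd.
apply: (measurableT_comp mv); apply/measurable_fun_pairP; split => /=.
  exact: (measurableT_comp measurable_fst measurable_snd).
exact: measurable_fst.
Qed.

Let mH : measurable_fun setT H.
Proof.
apply: (@measurable_setX_integral _ _ _ _ _ m1 _ _ mA measurableT
  (fun q : T1 * (T1 * T2) => sqd (v q.2) (v (q.1, q.2.2)))) => //.
apply: measurable_funTS; apply: measurable_sqr_dist.
  by apply: (measurableT_comp mv); exact: measurable_snd.
apply: (measurableT_comp mv); apply/measurable_fun_pairP; split => /=.
  exact: measurable_fst.
exact: (measurableT_comp measurable_snd measurable_snd).
Qed.

Let H0 p : (0 <= H p)%E.
Proof. by apply: integral_ge0 => s _; exact: sqd_ge0. Qed.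

Let G10 p : (0 <= G1 p)%E.
Proof. by apply: integral_ge0 => s _; exact: sqd_ge0. Qed.

Let G20 p : (0 <= G2 p)%E.
Proof. by apply: integral_ge0 => s _; exact: H0. Qed.

Let mG2 : measurable_fun setT G2.
Proof.
apply: (@measurable_setX_integral _ _ _ _ _ m2 _ _ mB measurableT
  (fun q : T2 * T1 => H (q.2, q.1))) => //.
apply: measurable_funTS; apply: (measurableT_comp mH).
by apply/measurable_fun_pairP; split; [exact: measurable_snd|exact: measurable_fst].
Qed.

Let inner p : (\int[m1 \x m2]_(q in A `*` B) sqd (v p) (v q) <=
  (2 * al)%:E * G1 p + 2%:E * G2 p.1)%E.
Proof.
pose f1 (q : T1 * T2) := sqd (v p) (v (p.1, q.2)).
pose f2 (q : T1 * T2) := sqd (v (p.1, q.2)) (v q).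
have mcst : measurable_fun setT (fun q : T1 * T2 => v (p.1, q.2)).
  apply: (measurableT_comp mv); apply/measurable_fun_pairP; split.
    exact: measurable_cst.
  exact: measurable_snd.
have mf1 : measurable_fun setT f1.
  by apply: measurable_sqr_dist => //; exact: measurable_cst.
have mf2 : measurable_fun setT f2 by exact: measurable_sqr_dist.
have mAB := measurableX mA mB.
apply: (@le_trans _ _ (\int[m1 \x m2]_(q in A `*` B) (2%:E * f1 q + 2%:E * f2 q))%E).
  apply: ge0_le_integral => //.
  - by apply: measurable_funTS; apply: measurable_sqr_dist => //; exact: measurable_cst.
  - by apply: emeasurable_funD; apply: measurable_funeM; exact: measurable_funTS.
  - move=> q _; rewrite /f1 /f2 /sqd -!EFinM -EFinD lee_fin.
    exact: sqr_sub_le.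
rewrite ge0_integralD//; last 4 first.
- by move=> q _; apply: mule_ge0; [rewrite lee_fin|exact: sqd_ge0].
- by apply: measurable_funeM; exact: measurable_funTS.
- by move=> q _; apply: mule_ge0; [rewrite lee_fin|exact: sqd_ge0].
- by apply: measurable_funeM; exact: measurable_funTS.
have e2 : (0 <= 2%:E :> \bar R)%E by rewrite lee_fin.
have mf1' : measurable_fun (A `*` B) f1 by exact: measurable_funTS.
have mf2' : measurable_fun (A `*` B) f2 by exact: measurable_funTS.
rewrite (ge0_integralZl (m1 \x m2)%E mAB mf1' (fun q _ => sqd_ge0 _ _) e2).
rewrite (ge0_integralZl (m1 \x m2)%E mAB mf2' (fun q _ => sqd_ge0 _ _) e2).
have [-> _] := @ge0_integral_setX _ _ _ _ _ m1 m2 _ _ mA mB _ mf2' (fun q _ => sqd_ge0 _ _).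
have [_ ->] := @ge0_integral_setX _ _ _ _ _ m1 m2 _ _ mA mB _ mf1' (fun q _ => sqd_ge0 _ _).
have -> : (\int[m1]_(x in A) \int[m2]_(y in B) f1 (x, y) = al%:E * G1 p)%E.
  exact: (@integral_cst_mul _ _ _ m1 A al (G1 p) mA m1A).
rewrite muleA -EFinM; exact: lexx.
Qed.

Lemma tensor_step :
  (\int[m1 \x m2]_(p in A `*` B) \int[m1 \x m2]_(q in A `*` B) ((v p - v q) ^+ 2)%:E <=
   (2 * al)%:E * (\int[m1]_(r in A) \int[m2]_(z in B) \int[m2]_(w in B)
      ((v (r, z) - v (r, w)) ^+ 2)%:E) +
   (2 * be)%:E * (\int[m1 \x m2]_(p in A `*` B) \int[m1]_(s in A)
      ((v p - v (s, p.2)) ^+ 2)%:E))%E.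
Proof.
have mAB := measurableX mA mB.
have mG2f : measurable_fun setT (fun p : T1 * T2 => G2 p.1).
  by apply: (measurableT_comp mG2); exact: measurable_fst.
have e2 : (0 <= 2%:E :> \bar R)%E by rewrite lee_fin.
have e2al : (0 <= (2 * al)%:E)%E by rewrite lee_fin mulr_ge0.
have mG1' : measurable_fun (A `*` B) (fun p => (2 * al)%:E * G1 p)%E.
  by apply: measurable_funeM; exact: measurable_funTS.
have mG2' : measurable_fun (A `*` B) (fun p => 2%:E * G2 p.1)%E.
  by apply: measurable_funeM; exact: measurable_funTS.
pose L (q : T2 * (T1 * T2)) := (\int[m1]_(s in A) sqd (v q.2) (v (s, q.1)))%E.
have L0 q : (0 <= L q)%E by apply: integral_ge0 => s _; exact: sqd_ge0.
have mL : measurable_fun setT L.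
  apply: (@measurable_setX_integral _ _ _ _ _ m1 _ _ mA measurableT
    (fun q : T1 * (T2 * (T1 * T2)) => sqd (v q.2.2) (v (q.1, q.2.1)))) => //.
  apply: measurable_funTS; apply: measurable_sqr_dist.
    apply: (measurableT_comp mv).
    exact: (measurableT_comp measurable_snd measurable_snd).
  apply: (measurableT_comp mv); apply/measurable_fun_pairP; split => /=.
    exact: measurable_fst.
  exact: (measurableT_comp measurable_fst measurable_snd).
have M : measurable_fun setT
    (fun p => \int[m1 \x m2]_(q in A `*` B) ((v p - v q) ^+ 2)%:E)%E.
  rewrite (_ : (fun p => _) = (fun p => \int[m2]_(w in B) L (w, p))%E).
    apply: (@measurable_setX_integral _ _ _ _ _ m2 _ _ mB measurableT L) => //.
    exact: measurable_funTS.
  apply/funext => p.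
  have mp : measurable_fun (A `*` B) (fun q => sqd (v p) (v q)).
    by apply: measurable_funTS; apply: measurable_sqr_dist => //; exact: measurable_cst.
  by have [-> _] := @ge0_integral_setX _ _ _ _ _ m1 m2 _ _ mA mB _ mp (fun q _ => sqd_ge0 _ _).
apply: (@le_trans _ _ (\int[m1 \x m2]_(p in A `*` B) ((2 * al)%:E * G1 p + 2%:E * G2 p.1))%E).
  apply: ge0_le_integral => //.
  - by move=> p _; apply: integral_ge0 => q _; exact: sqd_ge0.
  - apply: measurable_funTS.
    exact: M.
  - exact: emeasurable_funD.
  - by move=> p _; exact: inner.
rewrite ge0_integralD//; last 2 first.
- by move=> p _; exact: mule_ge0.
- by move=> p _; exact: mule_ge0.
have mG1'' : measurable_fun (A `*` B) G1 by exact: measurable_funTS.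
have mG2'' : measurable_fun (A `*` B) (fun p => G2 p.1) by exact: measurable_funTS.
rewrite (ge0_integralZl (m1 \x m2)%E mAB mG1'' (fun q _ => G10 q) e2al).
rewrite (ge0_integralZl (m1 \x m2)%E mAB mG2'' (fun q _ => G20 q.1) e2).
have [_ ->] := @ge0_integral_setX _ _ _ _ _ m1 m2 _ _ mA mB _ mG1'' (fun q _ => G10 q).
have [-> _] := @ge0_integral_setX _ _ _ _ _ m1 m2 _ _ mA mB _ mG2'' (fun q _ => G20 q.1).
have -> : (\int[m2]_(y in B) \int[m1]_(x in A) G2 (x, y).1 =
    be%:E * \int[m1]_(x in A) G2 x)%E.
  exact: (@integral_cst_mul _ _ _ m2 B be (\int[m1]_(x in A) G2 x)%E mB m2B).
have mH' : measurable_fun (A `*` B) H by exact: measurable_funTS.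
have [_ E] := @ge0_integral_setX _ _ _ _ _ m1 m2 _ _ mA mB _ mH' (fun q _ => H0 q).
rewrite [X in (_ + _ * (_ * X))%E](_ : _ = \int[m1 \x m2]_(p in A `*` B) H p)%E; last by rewrite E.
rewrite [X in (_ + X)%E]muleA -EFinM; exact: lexx.
Qed.

End tensor_step.

Section directional_energy.
Context {R : realType}.
Local Notation lam := (@lebesgue_measure R).

Definition dir_energy n (i : 'I_n) (a b : 'I_n -> R) (u : 'rV[R]_n -> R) : \bar R :=
  (\int[lebesgue_rV R n]_(x in box a b) \int[lam]_(t in `]a i, b i[)
    ((u x - u (upd i t x)) ^+ 2)%:E)%E.

Definition double_energy n (a b : 'I_n -> R) (u : 'rV[R]_n -> R) : \bar R :=
  (\int[lebesgue_rV R n]_(x in box a b) \int[lebesgue_rV R n]_(y in box a b)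
    ((u x - u y) ^+ 2)%:E)%E.

Lemma ge0_integral_rV_cons n (a b : 'I_n.+1 -> R) (f : 'rV[R]_n.+1 -> \bar R) :
  measurable_fun (box a b) f -> (forall x, box a b x -> (0 <= f x)%E) ->
  (\int[lebesgue_rV R n.+1]_(x in box a b) f x =
   \int[(lam \x lebesgue_rV R n)]_(p in
     `]a ord0, b ord0[ `*` box (a \o lift ord0) (b \o lift ord0)) f (rV_cons p))%E.
Proof.
move=> mf f0; rewrite -rV_cons_box.
rewrite -(ge0_integral_pushforward (@measurable_rV_cons R n) _ (measurable_box a b) mf)//.
by move=> x; rewrite inE; exact: f0.
Qed.

Lemma upd_cons0 n t (p : measurableTypeR R * 'rV[R]_n) :
  upd ord0 t (rV_cons p) = rV_cons (t : measurableTypeR R, p.2).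
Proof.
apply/rowP => l; case: (unliftP ord0 l) => [j|] ->.
  by rewrite upd_neq// !rV_consS.
by rewrite upd_eq rV_cons0.
Qed.

Lemma upd_consS n (j : 'I_n) t (p : measurableTypeR R * 'rV[R]_n) :
  upd (lift ord0 j) t (rV_cons p) = rV_cons (p.1, upd j t p.2).
Proof.
apply/rowP => l; case: (unliftP ord0 l) => [k|] ->; last first.
  by rewrite upd_neq// !rV_cons0.
rewrite rV_consS /=; have [->|kj] := eqVneq k j; first by rewrite !upd_eq.
by rewrite !upd_neq ?(inj_eq lift_inj)// rV_consS.
Qed.

Lemma measurable_sqr_dist d (T : measurableType d) (f g : T -> R) :
  measurable_fun setT f -> measurable_fun setT g ->
  measurable_fun setT (fun x => ((f x - g x) ^+ 2)%:E).
Proof.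
move=> mf mg; apply/measurable_EFinP; apply: measurable_funX.
exact: measurable_funB.
Qed.

Lemma measurable_dir n (i : 'I_n) (c d : R) (u : 'rV[R]_n -> R) :
  measurable_fun setT u -> measurable_fun setT
   (fun x => \int[lam]_(t in `]c, d[) ((u x - u (upd i t x)) ^+ 2)%:E)%E.
Proof.
move=> mu.
have mI : measurable (`]c, d[%classic : set (measurableTypeR R)) by exact: measurable_itv.
have mF : measurable_fun ((`]c, d[%classic : set (measurableTypeR R)) `*` setT)
    (fun q : measurableTypeR R * 'rV[R]_n => ((u q.2 - u (upd i q.1 q.2)) ^+ 2)%:E).
  apply: measurable_funTS; apply: measurable_sqr_dist.
    by apply: (measurableT_comp mu); exact: measurable_snd.
  by apply: (measurableT_comp mu); exact: measurable_upd.
exact: (measurable_setX_integral lam mI measurableT mF (fun q _ => sqr_ge0 _)).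
Qed.

Lemma measurable_double n (a b : 'I_n -> R) (u : 'rV[R]_n -> R) :
  measurable_fun setT u -> measurable_fun setT
   (fun x => \int[lebesgue_rV R n]_(y in box a b) ((u x - u y) ^+ 2)%:E)%E.
Proof.
move=> mu.
have mF : measurable_fun (box a b `*` setT)
    (fun q : 'rV[R]_n * 'rV[R]_n => ((u q.2 - u q.1) ^+ 2)%:E).
  apply: measurable_funTS; apply: measurable_sqr_dist.
    by apply: (measurableT_comp mu); exact: measurable_snd.
  by apply: (measurableT_comp mu); exact: measurable_fst.
exact: (measurable_setX_integral (lebesgue_rV R n) (measurable_box a b) measurableT mF
  (fun q _ => sqr_ge0 _)).
Qed.

Lemma dir_energy_ge0 n (i : 'I_n) a b u : (0 <= dir_energy i a b u)%E.
Proof.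
by apply: integral_ge0 => x _; apply: integral_ge0 => t _; rewrite lee_fin sqr_ge0.
Qed.

Lemma measurable_swap_integral d1 d2 (T1 : measurableType d1) (T2 : measurableType d2)
  (m2 : {sigma_finite_measure set T2 -> \bar R}) (B : set T2) (f : T1 * T2 -> \bar R) :
  measurable B -> measurable_fun setT f -> (forall p, 0 <= f p)%E ->
  measurable_fun setT (fun x => \int[m2]_(y in B) f (x, y))%E.
Proof.
move=> mB mf f0.
apply: (@measurable_setX_integral _ _ _ _ _ m2 _ _ mB measurableT
  (fun q : T2 * T1 => f (q.2, q.1))) => //.
apply: measurable_funTS; apply: (measurableT_comp mf).
by apply/measurable_fun_pairP; split; [exact: measurable_snd|exact: measurable_fst].
Qed.

(** The coordinates are changed one at a time. *)
Lemma double_energy_le n (a b : 'I_n -> R) : (forall i, a i < b i) ->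
  exists2 K : R, 0 <= K & forall u, measurable_fun setT u ->
    (double_energy a b u <= K%:E * \sum_i dir_energy i a b u)%E.
Proof.
elim: n a b => [|n IHn] a b ab.
  exists 0 => // u _; rewrite mul0e /double_energy integral0_eq// => x _.
  by apply: integral0_eq => y _; rewrite (thinmx0 x) (thinmx0 y) subrr expr0n.
have [|K' K'0 HK'] := IHn (a \o lift ord0) (b \o lift ord0); first by move=> i; exact: ab.
set I : set (measurableTypeR R) := `]a ord0, b ord0[%classic.
set B := box (a \o lift ord0) (b \o lift ord0).
have mI : measurable I by exact: measurable_itv.
have mB : measurable B by exact: measurable_box.
pose al := b ord0 - a ord0.
pose be := \prod_i Num.max 0 (b (lift ord0 i) - a (lift ord0 i)).
have al0 : 0 <= al by rewrite subr_ge0 ltW.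
have be0 : 0 <= be by apply: prodr_ge0 => i _; rewrite le_max lexx.
have lamI : lam I = al%:E by rewrite /I lebesgue_itvoo max_r.
have lebB : lebesgue_rV R n B = be%:E by exact: lebesgue_rV_box.
exists (2 * al * K' + 2 * be); first by rewrite addr_ge0 ?mulr_ge0.
move=> u mu; pose v p := u (@rV_cons R n p).
have mv : measurable_fun setT v.
  by apply: (measurableT_comp mu); exact: measurable_rV_cons.
have vr r : measurable_fun setT (fun z => v (r, z)).
  by apply: measurable_fun_pair2 mv.
have E0 : (double_energy a b u = \int[(lam \x lebesgue_rV R n)]_(p in I `*` B)
    \int[(lam \x lebesgue_rV R n)]_(q in I `*` B) ((v p - v q) ^+ 2)%:E)%E.
  rewrite /double_energy ge0_integral_rV_cons; last 2 first.
  - by apply: measurable_funTS; exact: measurable_double.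
  - by move=> x _; apply: integral_ge0 => y _; rewrite lee_fin sqr_ge0.
  apply: eq_integral => p _; rewrite ge0_integral_rV_cons//.
    apply: measurable_funTS; apply: measurable_sqr_dist => //; exact: measurable_cst.
  by move=> x _; rewrite lee_fin sqr_ge0.
have E1 : (dir_energy ord0 a b u = \int[(lam \x lebesgue_rV R n)]_(p in I `*` B)
    \int[lam]_(s in I) ((v p - v (s, p.2)) ^+ 2)%:E)%E.
  rewrite /dir_energy ge0_integral_rV_cons; last 2 first.
  - by apply: measurable_funTS; exact: measurable_dir.
  - by move=> x _; apply: integral_ge0 => y _; rewrite lee_fin sqr_ge0.
  by apply: eq_integral => p _; apply: eq_integral => s _; rewrite upd_cons0.
pose h j (p : measurableTypeR R * 'rV[R]_n) := (\int[lam]_(t in `](a \o lift ord0) j, (b \o lift ord0) j[)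
    ((v p - v (p.1, upd j t p.2)) ^+ 2)%:E)%E.
have h0 j p : (0 <= h j p)%E by apply: integral_ge0 => t _; rewrite lee_fin sqr_ge0.
have mh j : measurable_fun setT (h j).
  have := measurableT_comp (measurable_dir (lift ord0 j) (a (lift ord0 j)) (b (lift ord0 j)) mu)
    (@measurable_rV_cons R n).
  apply: eq_measurable_fun => p _ /=; apply: eq_integral => t _.
  by rewrite upd_consS.
have E2 j : (dir_energy (lift ord0 j) a b u = \int[lam]_(r in I)
    dir_energy j (a \o lift ord0) (b \o lift ord0) (fun z => v (r, z)))%E.
  rewrite /dir_energy ge0_integral_rV_cons; last 2 first.
  - by apply: measurable_funTS; exact: measurable_dir.
  - by move=> x _; apply: integral_ge0 => y _; rewrite lee_fin sqr_ge0.
  have [_ <-] := @ge0_integral_setX _ _ _ _ _ lam (lebesgue_rV R n) _ _ mI mB (h j)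
     (measurable_funTS (mh j)) (fun p _ => h0 j p).
  by apply: eq_integral => p _; apply: eq_integral => s _; rewrite upd_consS.
rewrite E0.
apply: le_trans (@tensor_step _ _ _ _ R lam (lebesgue_rV R n) I B mI mB al be lamI lebB v mv) _.
rewrite big_ord_recl; set S := (\sum_(i < n) _)%E.
have S0 : (0 <= S)%E by apply: sume_ge0 => j _; exact: dir_energy_ge0.
have T1 : (\int[lam]_(r in I) \int[lebesgue_rV R n]_(z in B) \int[lebesgue_rV R n]_(w in B)
    ((v (r, z) - v (r, w)) ^+ 2)%:E <= K'%:E * S)%E.
  have mE j : measurable_fun I (fun r => dir_energy j (a \o lift ord0) (b \o lift ord0) (fun z => v (r, z))).
    by apply: measurable_funTS; exact: (measurable_swap_integral (lebesgue_rV R n) mB (mh j) (h0 j)).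
  have mS : measurable_fun I (fun r => \sum_(j < n) dir_energy j (a \o lift ord0) (b \o lift ord0) (fun z => v (r, z)))%E.
    by apply: emeasurable_sum => j _; exact: mE.
  have -> : S = (\int[lam]_(r in I) \sum_(j < n) dir_energy j (a \o lift ord0) (b \o lift ord0) (fun z => v (r, z)))%E.
    rewrite ge0_integral_sum//; first by apply: eq_bigr => j _; exact: E2.
    by move=> j r _; exact: dir_energy_ge0.
  rewrite -ge0_integralZl_EFin//; last by move=> r _; apply: sume_ge0 => j _; exact: dir_energy_ge0.
  apply: ge0_le_integral => //.
  - move=> r _; apply: integral_ge0 => z _; apply: integral_ge0 => w _.
    by rewrite lee_fin sqr_ge0.
  - apply: measurable_funTS.
    pose g (p : measurableTypeR R * 'rV[R]_n) := (\int[lebesgue_rV R n]_(w in B) ((v p - v (p.1, w)) ^+ 2)%:E)%E.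
    apply: (@measurable_swap_integral _ _ _ _ (lebesgue_rV R n) B g mB) => [|p].
      have mq : measurable_fun setT (fun q : (measurableTypeR R * 'rV[R]_n) * 'rV[R]_n =>
          ((v q.1 - v (q.1.1, q.2)) ^+ 2)%:E).
        apply: measurable_sqr_dist; first by apply: (measurableT_comp mv); exact: measurable_fst.
        apply: (measurableT_comp mv); apply/measurable_fun_pairP; split => /=.
          exact: (measurableT_comp measurable_fst measurable_fst).
        exact: measurable_snd.
      exact: (measurable_swap_integral (lebesgue_rV R n) mB mq (fun q => sqr_ge0 _)).
    by apply: integral_ge0 => w _; rewrite lee_fin sqr_ge0.
  - exact: measurable_funeM.
  - by move=> r _; exact: HK'.
rewrite -E1; set e := dir_energy ord0 a b u.
have e0 : (0 <= e)%E by exact: dir_energy_ge0.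
rewrite EFinD ge0_muleDl ?lee_fin ?mulr_ge0//; apply: leeD.
  have -> : ((2 * al * K')%:E * (e + S) = (2 * al)%:E * (K'%:E * (e + S)))%E.
    by rewrite muleA -EFinM.
  apply: lee_wpmul2l; first by rewrite lee_fin mulr_ge0.
  apply: le_trans T1 _; apply: lee_wpmul2l; first by rewrite lee_fin.
  by rewrite leeDr.
by apply: lee_wpmul2l; [rewrite lee_fin mulr_ge0|rewrite leeDl].
Qed.

End directional_energy.

(** * The Poincare inequality on a box and along a tube *)

Section poincare.
Context {R : realType} {n : nat}.
Local Notation leb := (lebesgue_rV R n).
Local Notation lam := (@lebesgue_measure R).
Implicit Types (a b : 'I_n -> R) (u g C : 'rV[R]_n -> R).

Let sq_le (x y : R) : (x - y) ^+ 2 <= 2 * x ^+ 2 + 2 * y ^+ 2.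
Proof. have := @sqr_sub_le R 0 x y; by rewrite subr0 sub0r sqrrN. Qed.

Let sq_le2 (x y : R) : x ^+ 2 <= 2 * (x - y) ^+ 2 + 2 * y ^+ 2.
Proof. by have := @sqr_sub_le R y x 0; rewrite !subr0. Qed.

Lemma measurable_upd_line i (x : 'rV[R]_n) :
  measurable_fun setT (fun t : measurableTypeR R => upd i t x).
Proof. exact: (measurable_fun_pair1 x (measurable_upd i)). Qed.

(** Two points on a line in direction i see the same value of C, so the squared
    difference of u is at most twice the sum of the squared distances to C. *)
Lemma dir_energy_le_dist i a b u C : a i < b i ->
  measurable_fun setT u -> measurable_fun (box a b) C ->
  (forall s x, C (upd i s x) = C x) ->
  (dir_energy i a b u <= (4 * (b i - a i))%:E *
    \int[leb]_(x in box a b) ((u x - C x) ^+ 2)%:E)%E.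
Proof.
move=> abi mu mC CE; set Q := box a b.
set I : set (measurableTypeR R) := `]a i, b i[%classic.
have mQ : measurable Q by exact: measurable_box.
have mI : measurable I by exact: measurable_itv.
have ba0 : 0 < b i - a i by rewrite subr_gt0.
have lamI : lam I = (b i - a i)%:E by rewrite /I lebesgue_itvoo max_r// ltW.
pose w x := ((u x - C x) ^+ 2)%:E.
have w0 x : (0 <= w x)%E by rewrite lee_fin sqr_ge0.
have mw : measurable_fun Q w.
  apply/measurable_EFinP; apply: measurable_funX; apply: measurable_funB => //.
  exact: measurable_funTS.
have mw2 : measurable_fun (I `*` Q) (fun p : measurableTypeR R * 'rV[R]_n => w (upd i p.1 p.2)).
  apply: (measurable_exchange_box (i := i) (F := w \o snd)).
  apply: (measurable_comp mQ) mw _; first by move=> _ [p [_ ?] <-].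
  by apply: measurable_funTS; exact: measurable_snd.
pose J x := (\int[lam]_(t in I) w (upd i t x))%E.
have J0 x : (0 <= J x)%E by apply: integral_ge0.
have mJ : measurable_fun Q J.
  exact: (measurable_setX_integral lam mI mQ mw2 (fun p _ => w0 _)).
apply: (@le_trans _ _ (\int[leb]_(x in Q) ((2 * (b i - a i))%:E * w x + 2%:E * J x))%E).
  apply: ge0_le_integral => //.
  - by move=> x _; apply: integral_ge0 => t _; rewrite lee_fin sqr_ge0.
  - by apply: measurable_funTS; exact: measurable_dir.
  - by apply: emeasurable_funD; exact: measurable_funeM.
  - move=> x Qx.
    have mwx : measurable_fun I (fun t => w (upd i t x)).
      by apply: (measurable_setX_slice mI mQ mw2).
    apply: (@le_trans _ _ (\int[lam]_(t in I) (2%:E * w x + 2%:E * w (upd i t x)))%E).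
      apply: ge0_le_integral => //.
      + by move=> t _; rewrite lee_fin sqr_ge0.
      + apply: measurable_funTS; apply: measurable_sqr_dist; first exact: measurable_cst.
        by apply: (measurableT_comp mu); exact: measurable_upd_line.
      + by apply: emeasurable_funD => //; exact: measurable_funeM.
      + move=> t _; rewrite /w -!EFinM -EFinD lee_fin CE.
        have := sq_le (u x - C x) (u (upd i t x) - C x).
        by rewrite opprB addrA subrK.
    rewrite ge0_integralD//; last 3 first.
    + by move=> t _; rewrite mule_ge0.
    + by move=> t _; rewrite mule_ge0.
    + exact: measurable_funeM.
    rewrite !ge0_integralZl//.
    have -> : (\int[lam]_(t in I) w x = (b i - a i)%:E * w x)%E.
      exact: (@integral_cst_mul _ _ _ lam I (b i - a i) (w x) mI lamI).
    by rewrite muleA -EFinM lexx.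
rewrite ge0_integralD//; last 4 first.
- by move=> x _; rewrite mule_ge0// lee_fin mulr_ge0// ltW.
- exact: measurable_funeM.
- by move=> x _; rewrite mule_ge0.
- exact: measurable_funeM.
rewrite ge0_integralZl//; last by rewrite lee_fin mulr_ge0// ltW.
rewrite ge0_integralZl//.
have -> := ge0_integral_upd i mw (fun x _ => w0 x).
rewrite [X in (_ + _ * (X * _))%E]lamI muleA -EFinM -ge0_muleDl ?lee_fin ?mulr_ge0 ?(ltW ba0)// -EFinD.
rewrite (_ : 2 * (b i - a i) + 2 * (b i - a i) = 4 * (b i - a i)) ?lexx//; ring.
Qed.

Definition weak_on (i : 'I_n) a b u g := forall psi, bumps a b psi ->
  \int[leb]_(x in box a b) (u x * 'D_(delta_mx ord0 i) (tensor psi) x) =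
  - \int[leb]_(x in box a b) (g x * tensor psi x).

Lemma dir_energy_le i a b u g : a i < b i -> measurable_fun setT u ->
  leb.-integrable (box a b) (EFin \o u) -> leb.-integrable (box a b) (EFin \o g) ->
  weak_on i a b u g ->
  (dir_energy i a b u <= (4 * (b i - a i) ^+ 3)%:E *
    \int[leb]_(x in box a b) ((g x) ^+ 2)%:E)%E.
Proof.
move=> abi mu Iu Ig w; have [eta [beta eta0 eta1]] := unit_bump abi.
have [C [mC CE HC]] := one_direction_poincare abi Iu Ig w beta eta0 eta1.
apply: le_trans (dir_energy_le_dist abi mu mC CE) _.
rewrite (_ : 4 * (b i - a i) ^+ 3 = 4 * (b i - a i) * (b i - a i) ^+ 2); last by ring.
rewrite [in leRHS]EFinM -[leRHS]muleA; apply: lee_wpmul2l; last exact: HC.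
by rewrite lee_fin mulr_ge0// subr_ge0 ltW.
Qed.

(** For a function with mean 0, the cross term of (u(x) - u(y))^2 integrates
    to 0. *)
Lemma double_energy_ge a b u m : leb (box a b) = m%:E -> measurable_fun setT u ->
  leb.-integrable (box a b) (EFin \o u) ->
  leb.-integrable (box a b) (EFin \o (fun x => u x ^+ 2)) ->
  \int[leb]_(x in box a b) u x = 0 ->
  (m%:E * \int[leb]_(x in box a b) ((u x) ^+ 2)%:E <= double_energy a b u)%E.
Proof.
move=> lebm mu Iu Iu2 u0; have mQ := measurable_box a b.
have m0 : 0 <= m by rewrite -lee_fin -lebm measure_ge0.
have mu2 : measurable_fun (box a b) (fun x => ((u x) ^+ 2)%:E).
  by apply: measurable_funTS; apply/measurable_EFinP; exact: measurable_funX.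
have lebo : (leb (box a b) < +oo)%E by rewrite lebm ltry.
rewrite -ge0_integralZl_EFin//; last by move=> x _; rewrite lee_fin sqr_ge0.
apply: ge0_le_integral => //.
- by move=> x _; rewrite mule_ge0// lee_fin sqr_ge0.
- exact: measurable_funeM.
- by apply: measurable_funTS; exact: measurable_double.
move=> x _.
have Ic k := integrable_cst_fin k mQ lebo.
have IZ : leb.-integrable (box a b) (fun y => ((2 * u x)%:E * (u y)%:E)%E).
  exact: (integrableZl mQ _ Iu).
have I12 : leb.-integrable (box a b) (fun y => ((u x ^+ 2)%:E - (2 * u x)%:E * (u y)%:E)%E).
  by apply: integrableB => //; exact: (Ic (u x ^+ 2)).
have -> : (\int[leb]_(y in box a b) ((u x - u y) ^+ 2)%:E =
    \int[leb]_(y in box a b) (((u x ^+ 2)%:E - (2 * u x)%:E * (u y)%:E) + (u y ^+ 2)%:E))%E.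
  by apply: eq_integral => y _; rewrite -EFinM -EFinB -EFinD; congr (_%:E); ring.
rewrite integralD// integralB//; last exact: (Ic (u x ^+ 2)).
have -> : (\int[leb]_(y in box a b) (u x ^+ 2)%:E = m%:E * (u x ^+ 2)%:E)%E.
  exact: (@integral_cst_mul _ _ _ leb (box a b) m _ mQ lebm).
have -> : (\int[leb]_(y in box a b) ((2 * u x)%:E * (u y)%:E) = 0)%E.
  rewrite (integralZl mQ Iu).
  have := integrable_fin_num mQ Iu; move: u0; rewrite /Rintegral.
  by case: integral => // r /= -> _; rewrite mule0.
rewrite sube0 leeDl//; apply: integral_ge0 => y _; rewrite lee_fin sqr_ge0//.
Qed.

Lemma poincare_box a b : (forall i, a i < b i) ->
  exists2 K : R, 0 <= K & forall u (g : 'I_n -> 'rV[R]_n -> R),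
    measurable_fun setT u ->
    leb.-integrable (box a b) (EFin \o u) ->
    leb.-integrable (box a b) (EFin \o (fun x => u x ^+ 2)) ->
    (forall i, leb.-integrable (box a b) (EFin \o g i)) ->
    (forall i, weak_on i a b u (g i)) ->
    \int[leb]_(x in box a b) u x = 0 ->
    (\int[leb]_(x in box a b) ((u x) ^+ 2)%:E <=
     K%:E * \sum_i \int[leb]_(x in box a b) ((g i x) ^+ 2)%:E)%E.
Proof.
move=> ab; have [K K0 HK] := double_energy_le ab.
pose m := \prod_i Num.max 0 (b i - a i).
have m0 : 0 < m.
  by apply: prodr_gt0 => i _; rewrite max_r ?subr_gt0 ?subr_ge0// ltW.
have lebm : leb (box a b) = m%:E by exact: lebesgue_rV_box.
pose L := \sum_i 4 * (b i - a i) ^+ 3.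
have L0 : 0 <= L.
  by apply: sumr_ge0 => i _; rewrite mulr_ge0// exprn_ge0// subr_ge0 ltW.
have Li i : 4 * (b i - a i) ^+ 3 <= L.
  rewrite /L (bigD1 i)//= lerDl; apply: sumr_ge0 => j _.
  by rewrite mulr_ge0// exprn_ge0// subr_ge0 ltW.
exists (m^-1 * (K * L)); first by rewrite !mulr_ge0// invr_ge0 ltW.
move=> u g mu Iu Iu2 Ig w u0.
have H1 := double_energy_ge lebm mu Iu Iu2 u0.
set S := (\sum_(i < n) _)%E.
rewrite -(@lee_pmul2l _ m%:E) ?lte_fin// muleA -EFinM mulrA mulfV ?gt_eqF// mul1r.
apply: le_trans H1 _; apply: le_trans (HK u mu) _.
rewrite EFinM -muleA; apply: lee_wpmul2l; first by rewrite lee_fin.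
rewrite /S.
rewrite ge0_sume_distrr; last first.
  by move=> i _; apply: integral_ge0 => x _; rewrite lee_fin sqr_ge0.
apply: lee_sum => i _; apply: le_trans (dir_energy_le (ab i) mu Iu (Ig i) (w i)) _.
apply: lee_wpmul2r; last by rewrite lee_fin.
by apply: integral_ge0 => x _; rewrite lee_fin sqr_ge0.
Qed.

(** The point x is compared with the points obtained by moving its ith coordinate
    into ]c, d[.  The constants do not depend on the sides of the box in the
    other directions. *)
Lemma tube_estimate i a b (c d : R) u : a i <= c -> c < d -> d <= b i ->
  measurable_fun setT u ->
  ((d - c)%:E * \int[leb]_(x in box a b) ((u x) ^+ 2)%:E <=
   2%:E * dir_energy i a b u + (2 * (b i - a i))%:E *
   \int[leb]_(x in box a b `&` [set x | (c < x ord0 i < d)%R]) ((u x) ^+ 2)%:E)%E.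
Proof.
move=> ac cd db mu; set Q := box a b.
have abi : a i < b i by exact: le_lt_trans ac (lt_le_trans cd db).
set I : set (measurableTypeR R) := `]a i, b i[%classic.
set J : set (measurableTypeR R) := `]c, d[%classic.
have mQ : measurable Q by exact: measurable_box.
have mI : measurable I by exact: measurable_itv.
have mJ : measurable J by exact: measurable_itv.
have JI : J `<=` I by apply: subset_itvW.
have lamI : lam I = (b i - a i)%:E by rewrite /I lebesgue_itvoo max_r// subr_ge0 ltW.
have lamJ : lam J = (d - c)%:E by rewrite /J lebesgue_itvoo max_r// subr_ge0 ltW.
pose F (x : 'rV[R]_n) : \bar R := ((u x ^+ 2) * \1_J (x ord0 i))%:E.
have F0 x : (0 <= F x)%E by rewrite lee_fin mulr_ge0// sqr_ge0.
have mF : measurable_fun setT F.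
  apply/measurable_EFinP; apply: measurable_funM; first exact: measurable_funX.
  have mJ1 : measurable_fun setT (\1_J : measurableTypeR R -> R) by exact: measurable_indic.
  exact: (measurableT_comp mJ1 (measurable_rV_coord i)).
have mF2 : measurable_fun (I `*` Q) (fun p : measurableTypeR R * 'rV[R]_n => F (upd i p.1 p.2)).
  by apply: measurable_funTS; apply: (measurableT_comp mF); exact: measurable_upd.
pose G x := (\int[lam]_(t in I) F (upd i t x))%E.
pose E x := (\int[lam]_(t in I) ((u x - u (upd i t x)) ^+ 2)%:E)%E.
have G0 x : (0 <= G x)%E by apply: integral_ge0.
have E0 x : (0 <= E x)%E by apply: integral_ge0 => t _; rewrite lee_fin sqr_ge0.
have mG : measurable_fun Q G.
  exact: (measurable_setX_integral lam mI mQ mF2 (fun p _ => F0 _)).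
have mE : measurable_fun Q E by apply: measurable_funTS; exact: measurable_dir.
have mu2 : measurable_fun setT (fun x => ((u x) ^+ 2)%:E).
  by apply/measurable_EFinP; exact: measurable_funX.
rewrite -ge0_integralZl_EFin//; last 3 first.
- by move=> x _; rewrite lee_fin sqr_ge0.
- exact: measurable_funTS.
- by rewrite subr_ge0 ltW.
apply: (@le_trans _ _ (\int[leb]_(x in Q) (2%:E * E x + 2%:E * G x))%E).
  apply: ge0_le_integral => //.
  - by move=> x _; apply: mule_ge0; rewrite lee_fin ?sqr_ge0// subr_ge0 ltW.
  - by apply: measurable_funeM; exact: measurable_funTS.
  - by apply: emeasurable_funD; exact: measurable_funeM.
  move=> x Qx.
  have mline : measurable_fun setT (fun t : measurableTypeR R => u (upd i t x)).
    by apply: (measurableT_comp mu); exact: measurable_upd_line.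
  have m1 : measurable_fun setT (fun t : measurableTypeR R => ((u x - u (upd i t x)) ^+ 2)%:E).
    by apply: measurable_sqr_dist => //; exact: measurable_cst.
  have m2 : measurable_fun setT (fun t : measurableTypeR R => F (upd i t x)).
    by apply: (measurableT_comp mF); exact: measurable_upd_line.
  have -> : ((d - c)%:E * (u x ^+ 2)%:E = \int[lam]_(t in J) (u x ^+ 2)%:E)%E.
    by rewrite (@integral_cst_mul _ _ _ lam J (d - c) _ mJ lamJ).
  apply: (@le_trans _ _ (\int[lam]_(t in J)
      (2%:E * ((u x - u (upd i t x)) ^+ 2)%:E + 2%:E * F (upd i t x)))%E).
    apply: ge0_le_integral => //.
    + by move=> t _; rewrite lee_fin sqr_ge0.
    + by apply: emeasurable_funD; apply: measurable_funeM; exact: measurable_funTS.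
    + move=> t Jt; rewrite /F upd_eq indicE mem_set// mulr1 -!EFinM -EFinD lee_fin.
      exact: sq_le2.
  rewrite ge0_integralD//; last 4 first.
  + by move=> t _; rewrite mule_ge0// lee_fin sqr_ge0.
  + by apply: measurable_funeM; exact: measurable_funTS.
  + by move=> t _; rewrite mule_ge0.
  + by apply: measurable_funeM; exact: measurable_funTS.
  have e2 : (0 <= 2%:E :> \bar R)%E by rewrite lee_fin.
  rewrite (ge0_integralZl lam mJ (measurable_funTS m1) (fun t _ => sqr_ge0 _) e2).
  rewrite (ge0_integralZl lam mJ (measurable_funTS m2) (fun t _ => F0 _) e2).
  apply: leeD; apply: lee_wpmul2l => //.
    apply: ge0_subset_integral => //; first exact: measurable_funTS.
    by move=> t _; rewrite lee_fin sqr_ge0.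
  apply: ge0_subset_integral => //; exact: measurable_funTS.
rewrite ge0_integralD//; last 4 first.
- by move=> x _; rewrite mule_ge0.
- exact: measurable_funeM.
- by move=> x _; rewrite mule_ge0.
- exact: measurable_funeM.
rewrite !ge0_integralZl//; apply: leeD; first exact: lexx.
have -> := ge0_integral_upd i (measurable_funTS mF) (fun x _ => F0 x).
rewrite [X in (_ * (X * _) <= _)%E]lamI muleA -EFinM; apply: lee_wpmul2l.
  by rewrite lee_fin mulr_ge0// subr_ge0 ltW.
rewrite integral_mkcondr le_eqVlt; apply/orP; left; apply/eqP.
apply: eq_integral => x _; rewrite /F patchE.
case: ifPn => [/set_mem/= cxd|/negP ncxd].
  by rewrite indicE mem_set ?mulr1// /J /= in_itv.
rewrite indicE memNset ?mulr0// /J /= in_itv/= => cxd.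
by apply: ncxd; exact: mem_set.
Qed.

End poincare.

(** * Weak derivatives of smooth functions *)

Section smooth_weak.
Context {R : realType} {n : nat}.
Local Notation leb := (lebesgue_rV R n).
Local Notation lam := (@lebesgue_measure R).
Implicit Types (a b : 'I_n -> R) (u phi F : 'rV[R]_n -> R).

Lemma compact_closed_box a b :
  compact [set x : 'rV[R]_n | forall i, `[a i, b i]%classic (x ord0 i)].
Proof.
apply: (@rV_compact R n (fun i => `[a i, b i]%classic)) => i.
exact: segment_compact.
Qed.

Lemma continuous_bounded_box F a b : continuous F ->
  exists2 M, 0 <= M & forall x, box a b x -> `|F x| <= M.
Proof.
move=> cF; have cK := @compact_closed_box a b.
have cFK := continuous_compact (continuous_subspaceT cF) cK.
have [M [_ HM]] := compact_bounded cFK.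
exists (`|M| + 1) => // x xab; apply: (HM (`|M| + 1)).
  by apply: le_lt_trans (ler_norm M) _; rewrite ltrDl.
exists x => // i; rewrite /= in_itv/=.
by have /andP[/ltW-> /ltW->] := xab i.
Qed.

Lemma continuous_integrable_box F a b : continuous F ->
  leb.-integrable (box a b) (EFin \o F).
Proof.
move=> cF; have [M M0 HM] := continuous_bounded_box a b cF.
have mQ := measurable_box a b.
have I1 := integrable_cst_fin 1 mQ (lebesgue_rV_box_fin a b).
have := integrableM_bounded mQ I1 (measurable_funTS (continuous_measurable_rV cF)) HM.
by apply: eq_integrable => // x _ /=; rewrite mul1r.
Qed.

Lemma updE i t (x : 'rV[R]_n) : upd i t x = t *: delta_mx ord0 i + upd i 0 x.
Proof.
apply/rowP => l; rewrite !mxE eqxx /=; case: eqP => _.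
  by rewrite mulr1 addr0.
by rewrite mulr0 add0r.
Qed.

Lemma continuous_upd i (x : 'rV[R]_n) : continuous (fun t : R => upd i t x).
Proof.
move=> t; rewrite (_ : (fun t => _) = (fun t => t *: delta_mx ord0 i + upd i 0 x)); last first.
  by apply/funext => s; rewrite updE.
by apply: cvgD; [apply: cvgZl; exact: cvg_id|exact: cvg_cst].
Qed.

Lemma integral_derive_eq0 i a b F : (forall j, a j < b j) -> continuous F ->
  (forall x, derivable F x (delta_mx ord0 i)) ->
  continuous (fun x => 'D_(delta_mx ord0 i) F x) ->
  (forall x, ~ box a b x -> F x = 0) ->
  (\int[leb]_(x in box a b) ('D_(delta_mx ord0 i) F x)%:E = 0)%E.
Proof.
move=> ab cF dF cD F0.
have ba0 : 0 < b i - a i by rewrite subr_gt0.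
have [E _] := integral_upd i (continuous_integrable_box a b cD).
have lamI : lam `]a i, b i[ = (b i - a i)%:E by rewrite lebesgue_itvoo max_r// ltW.
have : ((b i - a i)%:E * \int[leb]_(x in box a b) ('D_(delta_mx ord0 i) F x)%:E = 0)%E.
  rewrite -lamI -E; apply: integral0_eq => x xab.
  pose g t := F (upd i t x); pose g' t := 'D_(delta_mx ord0 i) F (upd i t x).
  have gE t h : F (h *: delta_mx ord0 i + upd i t x) = g (h + t).
    rewrite /g (updE i (h + t)) (updE i t) addrA -scalerDl//.
  have dg t : derivable g t 1 /\ 'D_1 g t = g' t.
    have [H1 H2] := derive_line (gE t).
    by split; [exact: (H2.1 (dF _))|rewrite /g' H1].
  have cg : continuous g.
    by move=> t; apply: (@continuous_comp _ _ _ (fun t => upd i t x) F); [exact: continuous_upd|exact: cF].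
  have cg' : continuous g'.
    by move=> t; apply: (@continuous_comp _ _ _ (fun t => upd i t x) (fun x => 'D_(delta_mx ord0 i) F x)); [exact: continuous_upd|exact: cD].
  have dgoo : derivable_oo_LRcontinuous g (a i) (b i).
    split; first by move=> t _; have [] := dg t.
      by apply: cvg_at_right_filter; exact: cg.
    by apply: cvg_at_left_filter; exact: cg.
  have g'E : {in `]a i, b i[, (g^`())%classic =1 g'}.
    by move=> t _; rewrite derive1E; have [] := dg t.
  have := continuous_FTC2 (ab i) (continuous_subspaceT cg') dgoo g'E.
  rewrite {1 2}/g !F0; last 2 first.
  - by move=> /(_ i); rewrite upd_eq ltxx.
  - by move=> /(_ i); rewrite upd_eq ltxx andbF.
  rewrite subee// integral_itv_bndoo//.
  apply/measurable_EFinP; apply: measurable_funTS.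
  exact: continuous_measurable_fun.
move/eqP; rewrite mule_eq0 => /orP[|/eqP//].
by rewrite eqe gt_eqF.
Qed.

Lemma compact_in_box (K : set 'rV[R]_n) : compact K ->
  exists2 M : R, 0 < M & K `<=` box (fun=> - M) (fun=> M).
Proof.
move=> cK.
have /choice[M HM] : forall i : 'I_n, exists M : R, 0 <= M /\ forall x, K x -> `|x ord0 i| <= M.
  move=> i; have ci : continuous (fun x : 'rV[R]_n => x ord0 i).
    by move=> x; exact: coord_continuous.
  have cKi := continuous_compact (continuous_subspaceT ci) cK.
  have [M [_ HM]] := compact_bounded cKi.
  exists (`|M| + 1); split => // x Kx; apply: (HM (`|M| + 1)); last by exists x.
  by apply: le_lt_trans (ler_norm M) _; rewrite ltrDl.
exists (1 + \sum_i M i).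
  by rewrite ltr_pwDl// sumr_ge0// => i _; have [] := HM i.
move=> x Kx i; rewrite -ltr_norml.
have [_ /(_ x Kx) H] := HM i.
apply: le_lt_trans H _; rewrite (bigD1 i)//= addrCA ltrDl.
by rewrite ltr_pwDl// sumr_ge0// => j _; have [] := HM j.
Qed.

Lemma Rintegral_support (A B : set 'rV[R]_n) F :
  (forall x, ~ A x -> F x = 0) -> (forall x, ~ B x -> F x = 0) ->
  \int[leb]_(x in A) F x = \int[leb]_(x in B) F x.
Proof.
move=> FA FB; rewrite Rintegral_mkcond [RHS]Rintegral_mkcond.
congr (Rintegral _ _ _); apply/funext => x; rewrite !patchE.
case: ifPn => [_|/negP nA]; case: ifPn => [_|/negP nB] //.
  by rewrite FB// => Bx; apply: nB; exact: mem_set.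
by rewrite FA// => Ax; apply: nA; exact: mem_set.
Qed.

(** The support of the test function is enclosed in a box, on which the integral
    of the derivative of a product vanishes line by line. *)
Lemma weak_partial_smooth Omega u phi i : smooth u -> test_function Omega phi ->
  \int[leb]_(x in Omega) (u x * 'D_(delta_mx ord0 i) phi x) =
  - \int[leb]_(x in Omega) ('D_(delta_mx ord0 i) u x * phi x).
Proof.
move=> su tphi; have [sphi cphi subO] := tphi.
have [M M0 HM] := compact_in_box cphi.
pose Q : set 'rV[R]_n := box (fun=> - M) (fun=> M); have mQ : measurable Q by exact: measurable_box.
have tQ : test_function Q phi by [].
have tdO := test_function_partial i tphi; have tdQ := test_function_partial i tQ.
have cu := smooth_continuous su.
have cphi' := smooth_continuous sphi.
have cdu := smooth_continuous (smooth_partial i su).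
have cdphi := smooth_continuous (smooth_partial i sphi).
rewrite (@Rintegral_support Omega Q); last 2 first.
- by move=> x Ox; rewrite (support_out tdO Ox) mulr0.
- by move=> x Ox; rewrite (support_out tdQ Ox) mulr0.
rewrite (@Rintegral_support Omega Q (fun x => 'D_(delta_mx ord0 i) u x * phi x)); last 2 first.
- by move=> x Ox; rewrite (support_out tphi Ox) mulr0.
- by move=> x Ox; rewrite (support_out tQ Ox) mulr0.
have I1 : leb.-integrable Q (EFin \o (fun x => u x * 'D_(delta_mx ord0 i) phi x)).
  exact: (continuous_integrable_box _ _ (smooth_continuous (smoothM su (smooth_partial i sphi)))).
have I2 : leb.-integrable Q (EFin \o (fun x => 'D_(delta_mx ord0 i) u x * phi x)).
  exact: (continuous_integrable_box _ _ (smooth_continuous (smoothM (smooth_partial i su) sphi))).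
apply/eqP; rewrite -addr_eq0 -RintegralD//; apply/eqP.
have su_phi := smoothM su sphi.
have := @integral_derive_eq0 i (fun _ : 'I_n => - M) (fun _ : 'I_n => M) (u \* phi) _ (smooth_continuous su_phi)
  (fun x => @smooth_derivable R n i _ x su_phi) (smooth_continuous (smooth_partial i su_phi)) _.
rewrite /Rintegral => H; rewrite (_ : (\int[leb]_(x in Q) _ = 0)%E)//.
rewrite -[RHS]H.
- apply: eq_integral => x _; congr (_%:E).
  rewrite deriveM; [|exact: smooth_derivable|exact: smooth_derivable].
  by rewrite [X in _ + X]mulrC.
- by move=> j; rewrite gtrN.
- by move=> x nQ /=; rewrite (support_out tQ nQ) mulr0.
Qed.

(** Each integration by parts moves the outermost derivative of the test function
    onto u, where it becomes the innermost one: the word is reversed. *)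
Lemma is_weak_partials_smooth Omega u s : smooth u ->
  is_weak_partials Omega s u (partials (rev s) u).
Proof.
move=> su phi tphi; elim: s u su => [|i s IH] u su.
  by rewrite expr0 mul1r.
rewrite [size _]/= exprS mulN1r mulNr.
rewrite [partials (i :: s) phi]/=.
rewrite (weak_partial_smooth i su (test_function_partials s tphi)).
congr (- _); rewrite rev_cons partials_rcons.
exact: (IH _ (smooth_partial i su)).
Qed.

Lemma square_integrable_continuous (Omega : set 'rV[R]_n) a b u :
  Omega `<=` box a b -> measurable Omega -> continuous u ->
  square_integrable Omega u.
Proof.
move=> OQ mO cu; split; first by apply: measurable_funTS; exact: continuous_measurable_rV.
have cu2 : continuous (fun x => u x ^+ 2).
  move=> x; rewrite (_ : (fun x => _) = u \* u); last by apply/funext => y; rewrite expr2.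
  by apply: continuousM; exact: cu.
have := integrableS (measurable_box a b) mO OQ (continuous_integrable_box a b cu2).
move=> /integrableP[_]; apply: le_lt_trans; apply: ge0_le_integral => //.
- by move=> x _; rewrite lee_fin sqr_ge0.
- by apply: measurable_funTS; apply/measurable_EFinP; exact: continuous_measurable_rV.
- apply: measurableT_comp => //; apply: measurable_funTS.
  by apply/measurable_EFinP; exact: continuous_measurable_rV.
- by move=> x _; rewrite lee_fin ler_norm.
Qed.

Lemma sobolev_smooth k (Omega : set 'rV[R]_n) a b u :
  Omega `<=` box a b -> measurable Omega -> smooth u -> sobolev k Omega u.
Proof.
move=> OQ mO su; split.
  by apply: square_integrable_continuous OQ mO _; exact: smooth_continuous.
move=> s _; exists (partials (rev s) u); split; last exact: is_weak_partials_smooth.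
apply: square_integrable_continuous OQ mO _.
by apply: smooth_continuous; exact: smooth_partials.
Qed.

End smooth_weak.

(** * Linear combinations and uniqueness of weak derivatives *)

Section sobolev_linear.
Context {R : realType} {n : nat}.
Local Notation leb := (lebesgue_rV R n).
Variables (Omega : set 'rV[R]_n) (A B : 'I_n -> R).
Hypotheses (mO : measurable Omega) (OAB : Omega `<=` box A B).
Implicit Types (u v g : 'rV[R]_n -> R).

Lemma Omega_finite : (leb Omega < +oo)%E.
Proof.
apply: le_lt_trans (lebesgue_rV_box_fin A B).
by apply: le_measure; rewrite ?inE//; exact: measurable_box.
Qed.

Lemma square_integrable_integrable u : square_integrable Omega u ->
  leb.-integrable Omega (EFin \o u) /\
  leb.-integrable Omega (EFin \o (fun x => u x ^+ 2)).
Proof. by move=> [mu u2]; apply: sqr_integrable => //; exact: Omega_finite. Qed.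

Lemma square_integrableD u v : square_integrable Omega u ->
  square_integrable Omega v -> square_integrable Omega (u \+ v).
Proof.
move=> su sv; have [mu u2] := su; have [mv v2] := sv.
split; first exact: measurable_funD.
have [_ Iu] := square_integrable_integrable su.
have [_ Iv] := square_integrable_integrable sv.
have mu2 := measurable_int _ Iu; have mv2 := measurable_int _ Iv.
apply: (@le_lt_trans _ _ (\int[leb]_(x in Omega) (2%:E * (u x ^+ 2)%:E + 2%:E * (v x ^+ 2)%:E))%E).
  apply: ge0_le_integral => //.
  - by move=> x _; rewrite lee_fin sqr_ge0.
  - by apply/measurable_EFinP; apply: measurable_funX; exact: measurable_funD.
  - by apply: emeasurable_funD; exact: measurable_funeM.
  - move=> x _; rewrite -!EFinM -EFinD lee_fin /=.
    by have := @sqr_sub_le R 0 (u x) (- v x); rewrite subr0 sub0r !opprK.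
rewrite integralD//; [|exact: integrableZl|exact: integrableZl].
by rewrite !integralZl// lte_add_pinfty// lte_mul_pinfty.
Qed.

Lemma square_integrableZ (c : R) u : square_integrable Omega u ->
  square_integrable Omega (fun x => c * u x).
Proof.
move=> su; have [mu u2] := su; split; first exact: measurable_funM.
have [_ Iu] := square_integrable_integrable su.
under eq_integral do rewrite exprMn EFinM.
by rewrite integralZl// lte_mul_pinfty// lee_fin sqr_ge0.
Qed.

Lemma square_integrable0 : square_integrable Omega (fun=> 0 : R).
Proof.
split; first exact: measurable_cst.
by rewrite integral0_eq// => x _; rewrite expr0n.
Qed.

Lemma square_integrable_lincomb j (b : 'I_j -> 'rV[R]_n -> R) c :
  (forall i, square_integrable Omega (b i)) -> square_integrable Omega (lincomb b c).
Proof.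
move=> sb; rewrite /lincomb; elim: (index_enum _) => [|i r IHr].
  rewrite (_ : (fun x => _) = fun=> 0); first exact: square_integrable0.
  by apply/funext => x; rewrite big_nil.
rewrite (_ : (fun x => _) = (fun x => c ord0 i * b i x) \+
    (fun x => \sum_(i <- r) c ord0 i * b i x)); last first.
  by apply/funext => x; rewrite big_cons.
by apply: square_integrableD => //; exact: square_integrableZ.
Qed.

Lemma integrable_test u phi : square_integrable Omega u -> smooth phi ->
  leb.-integrable Omega (EFin \o (u \* phi)).
Proof.
move=> su sphi; have [Iu _] := square_integrable_integrable su.
have [M M0 HM] := continuous_bounded_box A B (smooth_continuous sphi).
apply: (integrableM_bounded mO Iu (M := M)); last by move=> x /OAB; exact: HM.
by apply: measurable_funTS; exact: measurable_smooth.
Qed.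

Lemma Rintegral_lincomb (D : set 'rV[R]_n) j (b : 'I_j -> 'rV[R]_n -> R) c : measurable D ->
  (forall i, leb.-integrable D (EFin \o b i)) ->
  \int[leb]_(x in D) lincomb b c x = \sum_(i < j) c ord0 i * \int[leb]_(x in D) b i x.
Proof.
move=> mD Ib; rewrite /Rintegral.
have -> : (\int[leb]_(x in D) (lincomb b c x)%:E =
    \sum_(i < j) ((c ord0 i)%:E * \int[leb]_(x in D) (b i x)%:E))%E.
  transitivity (\int[leb]_(x in D) (\sum_(i < j) (c ord0 i)%:E * (b i x)%:E))%E.
    apply: eq_integral => x _; rewrite /lincomb -sumEFin.
    by apply: eq_bigr => i _; rewrite EFinM.
  rewrite integral_sum//; last by move=> i; exact: (integrableZl mD (c ord0 i) (Ib i)).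
  by apply: eq_bigr => i _; exact: (integralZl mD (Ib i) (c ord0 i)).
rewrite (eq_bigr (fun i => (c ord0 i * fine (\int[leb]_(x in D) (b i x)%:E)%E)%:E)).
  by rewrite sumEFin.
by move=> i _; rewrite EFinM fineK//; exact: (integrable_fin_num mD (Ib i)).
Qed.

Lemma is_weak_partials_lincomb j (b g : 'I_j -> 'rV[R]_n -> R) c s :
  (forall i, square_integrable Omega (b i)) -> (forall i, square_integrable Omega (g i)) ->
  (forall i, is_weak_partials Omega s (b i) (g i)) ->
  is_weak_partials Omega s (lincomb b c) (lincomb g c).
Proof.
move=> sb sg w phi tphi; have [sphi _ _] := tphi.
have E h psi : (forall i, square_integrable Omega (h i)) -> smooth psi ->
    \int[leb]_(x in Omega) (lincomb h c x * psi x) =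
    \sum_(i < j) c ord0 i * \int[leb]_(x in Omega) (h i x * psi x).
  move=> sh spsi; rewrite -(@Rintegral_lincomb Omega j (fun i => h i \* psi))//.
    apply: eq_Rintegral => x _; rewrite /lincomb big_distrl/=.
    by apply: eq_bigr => i _; rewrite mulrA.
  by move=> i; exact: integrable_test.
rewrite (E _ _ sb (smooth_partials s sphi)) (E _ _ sg sphi) big_distrr/=.
by apply: eq_bigr => i _; rewrite (w i phi tphi) mulrCA.
Qed.

Lemma sobolev_lincomb k j (b : 'I_j -> 'rV[R]_n -> R) c :
  (forall i, sobolev k Omega (b i)) -> sobolev k Omega (lincomb b c).
Proof.
move=> sb; have sq i : square_integrable Omega (b i) by have [] := sb i.
split; first exact: square_integrable_lincomb.
move=> s sk; have /choice[g Hg] : forall i, exists g, square_integrable Omega g /\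
    is_weak_partials Omega s (b i) g.
  by move=> i; have [_ /(_ s sk)] := sb i.
exists (lincomb g c); split.
  by apply: square_integrable_lincomb => i; have [] := Hg i.
by apply: is_weak_partials_lincomb => // i; have [] := Hg i.
Qed.

Lemma weak_partialsP k s u : sobolev k Omega u -> (size s <= k)%N ->
  square_integrable Omega (weak_partials Omega s u) /\
  is_weak_partials Omega s u (weak_partials Omega s u).
Proof.
move=> [_ /(_ s)H] /H [g Hg]; rewrite /weak_partials.
by have := @xgetPex _ (fun=> 0) [set g | square_integrable Omega g /\
  is_weak_partials Omega s u g]; apply; exists g.
Qed.

Lemma Rintegral_tensor_box a b u psi : box a b `<=` Omega -> bumps a b psi ->
  \int[leb]_(x in Omega) (u x * tensor psi x) =
  \int[leb]_(x in box a b) (u x * tensor psi x).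
Proof.
move=> abO bpsi; apply: Rintegral_support => x nx.
  by rewrite (tensor_out bpsi) ?mulr0// => /abO.
by rewrite (tensor_out bpsi) ?mulr0.
Qed.

(** The chosen representative of a weak derivative is determined almost everywhere
    on the boxes contained in Omega. *)
Lemma weak_partials_unique_box a b s u g1 g2 : box a b `<=` Omega ->
  square_integrable Omega g1 -> square_integrable Omega g2 ->
  is_weak_partials Omega s u g1 -> is_weak_partials Omega s u g2 ->
  {ae leb, forall x, box a b x -> g1 x = g2 x}.
Proof.
move=> abO sg1 sg2 w1 w2; have mQ := measurable_box a b.
have [I1 _] := square_integrable_integrable sg1.
have [I2 _] := square_integrable_integrable sg2.
have I1Q := integrableS mO mQ abO I1; have I2Q := integrableS mO mQ abO I2.
have I12 : leb.-integrable (box a b) (EFin \o (g1 \- g2)).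
  rewrite (_ : _ \o _ = (fun x => (g1 x)%:E - (g2 x)%:E)%E)//.
  exact: integrableB.
suff H psi : bumps a b psi -> \int[leb]_(x in box a b) ((g1 \- g2) x * tensor psi x) = 0.
  apply: filterS (fundamental_lemma I12 H) => x + Qx => /(_ Qx) /eqP.
  by rewrite subr_eq0 => /eqP.
move=> bpsi; have tpsi := test_function_sub abO (test_function_tensor bpsi).
have [stens _ _] := tpsi.
have J1 := integrable_test sg1 stens; have J2 := integrable_test sg2 stens.
rewrite -(Rintegral_tensor_box _ abO bpsi).
transitivity (\int[leb]_(x in Omega) (g1 x * tensor psi x - g2 x * tensor psi x)).
  by apply: eq_Rintegral => x _; rewrite mulrBl.
rewrite RintegralB//.
have := w1 _ tpsi; rewrite (w2 _ tpsi) => /eqP.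
by rewrite (inj_eq (mulfI _)) ?signr_eq0// => /eqP ->; rewrite subrr.
Qed.

End sobolev_linear.

(** * The dumbbell and its spectral gap *)

Section dumbbell.
Context {R : realType} {n : nat}.
Local Notation leb := (lebesgue_rV R n).
Variables (i0 : 'I_n) (N : nat).

Definition cyl_lo (s h : R) (l : 'I_n) : R := if l == i0 then s else - h.
Definition cyl_hi (t h : R) (l : 'I_n) : R := if l == i0 then t else h.
(** The open cylinder ]s, t[ x ]-h, h[^(n-1) with axis in direction i0. *)
Definition cyl (s t h : R) : set 'rV[R]_n := box (cyl_lo s h) (cyl_hi t h).

(** The room k occupies the axis from 2k to 2k+1, and the gaps between the rooms
    have length 1 as well. *)
Definition room (k : nat) : set 'rV[R]_n := cyl k.*2%:R k.*2.+1%:R 1.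
Definition tube (eps : R) : set 'rV[R]_n := cyl 0 N.*2.+1%:R eps.
Definition dumbbell (eps : R) : set 'rV[R]_n :=
  tube eps `|` \bigcup_(k in [set: 'I_N.+1]) room k.
(** A box that contains all the dumbbells, for bounds independent of eps. *)
Definition hull : set 'rV[R]_n := cyl 0 N.*2.+1%:R 1.

Lemma measurable_cyl s t h : measurable (cyl s t h).
Proof. exact: measurable_box. Qed.

Lemma cylS s s' t t' h h' : s' <= s -> t <= t' -> h <= h' ->
  cyl s t h `<=` cyl s' t' h'.
Proof.
move=> ss tt hh x H l; have /andP[H1 H2] := H l.
rewrite /cyl_lo /cyl_hi in H1 H2 *; case: (l == i0) H1 H2 => H1 H2.
  by rewrite (le_lt_trans ss H1) (lt_le_trans H2 tt).
by rewrite (lt_le_trans H2 hh) andbT (le_lt_trans _ H1)// lerN2.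
Qed.

Lemma cyl_ab s t h : s < t -> 0 < h -> forall l, cyl_lo s h l < cyl_hi t h l.
Proof.
by move=> st h0 l; rewrite /cyl_lo /cyl_hi; case: ifP => // _; rewrite gtrN.
Qed.

Lemma room_hull k : (k < N.+1)%N -> room k `<=` hull.
Proof.
move=> kN; apply: cylS => //.
by rewrite ler_nat ltnS leq_double -ltnS.
Qed.

Lemma tube_hull eps : eps <= 1 -> tube eps `<=` hull.
Proof. by move=> e1; apply: cylS. Qed.

Lemma dumbbell_hull eps : eps <= 1 -> dumbbell eps `<=` hull.
Proof.
move=> e1 x [|[k _]]; first exact: tube_hull.
exact: room_hull.
Qed.

Lemma room_dumbbell eps (k : 'I_N.+1) : room k `<=` dumbbell eps.
Proof. by move=> x xk; right; exists k. Qed.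

Lemma tube_dumbbell eps : tube eps `<=` dumbbell eps.
Proof. by move=> x; left. Qed.

Lemma measurable_dumbbell eps : measurable (dumbbell eps).
Proof.
apply: measurableU; first exact: measurable_cyl.
by apply: fin_bigcup_measurable => // k _; exact: measurable_cyl.
Qed.

(** The overlap of the tube with the rooms is counted twice. *)
Lemma integral_dumbbell_le eps (f : 'rV[R]_n -> \bar R) :
  measurable_fun (dumbbell eps) f -> (forall x, dumbbell eps x -> 0 <= f x)%E ->
  (\int[leb]_(x in dumbbell eps) f x <= \int[leb]_(x in tube eps) f x +
    \sum_(k < N.+1) \int[leb]_(x in room k) f x)%E.
Proof.
move=> mf f0.
have f0D D x : D `<=` dumbbell eps -> (0 <= (f \_ D) x)%E.
  by move=> sD; rewrite patchE; case: ifPn => // /set_mem /sD; exact: f0.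
have mfD D : measurable D -> D `<=` dumbbell eps -> measurable_fun setT (f \_ D).
  move=> mD sD; apply/(measurable_restrictT _ mD).
  exact: (measurable_funS (measurable_dumbbell eps) sD mf).
have sr (k : 'I_N.+1) := @room_dumbbell eps k.
have mr (k : 'I_N.+1) : measurable (room k) by exact: measurable_cyl.
have st := @tube_dumbbell eps.
have mt : measurable (tube eps) by exact: measurable_cyl.
rewrite integral_mkcond [X in (_ <= X + _)%E]integral_mkcond.
under [X in (_ <= _ + X)%E]eq_bigr do rewrite integral_mkcond.
rewrite -ge0_integral_sum//; last 2 first.
- by move=> k; apply: mfD => //.
- by move=> k x _; exact: f0D.
rewrite -ge0_integralD//; last 4 first.
- by move=> x _; exact: f0D.
- exact: mfD.
- by move=> x _; apply: sume_ge0 => k _; exact: f0D.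
- by apply: emeasurable_sum => k _; exact: mfD.
apply: ge0_le_integral => //.
- by move=> x _; exact: f0D.
- by apply: mfD => //; exact: measurable_dumbbell.
- apply: emeasurable_funD; first exact: mfD.
  by apply: emeasurable_sum => k _; exact: mfD.
move=> x _; rewrite [X in (X <= _)%E]patchE; case: ifPn => [/set_mem|_]; last first.
  by rewrite adde_ge0 ?f0D// sume_ge0// => k _; exact: f0D.
move=> [xt|[k _ xk]].
  rewrite [X in (_ <= X + _)%E]patchE mem_set// leeDl// sume_ge0// => k _; exact: f0D.
rewrite (bigD1 k)//= [X in (_ <= _ + (X + _))%E]patchE mem_set//.
rewrite addeCA leeDl// adde_ge0 ?f0D// sume_ge0// => l _; exact: f0D.
Qed.

(** The extension by 0 makes the function measurable on the whole space, as is
    convenient when coordinates are moved. *)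
Lemma weak_on_box (Om : set 'rV[R]_n) a b i u g : box a b `<=` Om ->
  is_weak_partials Om [:: i] u g -> weak_on i a b (u \_ Om) g.
Proof.
move=> abO w psi bpsi.
have tab := test_function_tensor bpsi.
have := w _ (test_function_sub abO tab).
rewrite expr1 mulN1r (Rintegral_tensor_box _ abO bpsi) => <-.
have dab := test_function_partial i tab.
rewrite [RHS](@Rintegral_support R n Om (box a b)); last 2 first.
- by move=> x nx; rewrite /= (support_out (test_function_sub abO dab) nx) mulr0.
- by move=> x nx; rewrite /= (support_out dab nx) mulr0.
apply: eq_Rintegral => x /set_mem /abO xO; by rewrite patchE mem_set.
Qed.

(** The rooms are controlled by the Poincare inequality, and the tube by the part
    of it above the unit interval, which lies in the first room. *)
Lemma spectral_gap : exists2 K : R, 0 < K & forall eps u, 0 < eps < 1 ->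
  sobolev 1 (dumbbell eps) u ->
  (forall k : 'I_N.+1, \int[leb]_(x in room k) u x = 0) ->
  \int[leb]_(x in dumbbell eps) (u x) ^+ 2 <=
  K * \int[leb]_(x in dumbbell eps) sqnorm_grad (dumbbell eps) u x.
Proof.
have ab k : forall l, cyl_lo k.*2%:R 1 l < cyl_hi k.*2.+1%:R 1 l.
  by apply: cyl_ab => //; rewrite ltr_nat.
have /choice[K HK] : forall k : 'I_N.+1, exists K, 0 <= K /\
   forall u (g : 'I_n -> 'rV[R]_n -> R), measurable_fun setT u ->
    leb.-integrable (room k) (EFin \o u) ->
    leb.-integrable (room k) (EFin \o (fun x => u x ^+ 2)) ->
    (forall i, leb.-integrable (room k) (EFin \o g i)) ->
    (forall i, weak_on i (cyl_lo k.*2%:R 1) (cyl_hi k.*2.+1%:R 1) u (g i)) ->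
    \int[leb]_(x in room k) u x = 0 ->
    (\int[leb]_(x in room k) ((u x) ^+ 2)%:E <=
     K%:E * \sum_i \int[leb]_(x in room k) ((g i x) ^+ 2)%:E)%E.
  by move=> k; have [K K0 H] := poincare_box (ab k); exists K.
pose L : R := N.*2.+1%:R.
pose K1 := \sum_k K k.
have K10 : 0 <= K1 by apply: sumr_ge0 => k _; have [] := HK k.
(* The bracket is the constant for the tube: 2 * 4 L^3 from the derivative along
   the axis and 2 L K1 from the first room.  The final K1 is for the rooms, and
   1 makes the sum positive. *)
exists (1 + (8 * L ^+ 3 + 2 * L * K1) + K1).
  by rewrite -addrA ltr_pwDl// addr_ge0// addr_ge0// !mulr_ge0.
move=> eps u /andP[e0 e1] su u0.
set Om := dumbbell eps.
have mO : measurable Om by exact: measurable_dumbbell.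
have OAB : Om `<=` box (cyl_lo 0 1) (cyl_hi N.*2.+1%:R 1) by apply: dumbbell_hull; exact: ltW.
have [squ _] := su.
pose g i := weak_partials Om [:: i] u.
have Hg i : square_integrable Om (g i) /\ is_weak_partials Om [:: i] u (g i).
  exact: (weak_partialsP su).
pose v := u \_ Om.
have mv : measurable_fun setT v.
  by apply/(measurable_restrictT _ mO); case: squ.
have [Iu Iu2] := square_integrable_integrable mO OAB squ.
have Ig i := square_integrable_integrable mO OAB (Hg i).1.
have vE D x : D `<=` Om -> D x -> v x = u x.
  by move=> DO /DO xO; rewrite /v patchE mem_set.
have Iv D : measurable D -> D `<=` Om -> leb.-integrable D (EFin \o v) /\
    leb.-integrable D (EFin \o (fun x => v x ^+ 2)).
  move=> mD DO; split.
    have := integrableS mO mD DO Iu; apply: eq_integrable => //.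
    by move=> x /set_mem xD /=; rewrite (vE D).
  have := integrableS mO mD DO Iu2; apply: eq_integrable => //.
  by move=> x /set_mem xD /=; rewrite (vE D).
pose G i := (\int[leb]_(x in Om) ((g i x) ^+ 2)%:E)%E.
have G0 i : (0 <= G i)%E by apply: integral_ge0 => x _; rewrite lee_fin sqr_ge0.
have GD i D : measurable D -> D `<=` Om -> (\int[leb]_(x in D) ((g i x) ^+ 2)%:E <= G i)%E.
  move=> mD DO; apply: ge0_subset_integral => //; first exact: measurable_int (Ig i).2.
  by move=> x _; rewrite lee_fin sqr_ge0.
pose S := (\sum_i G i)%E.
have S0 : (0 <= S)%E by apply: sume_ge0.
have room_le (k : 'I_N.+1) : (\int[leb]_(x in room k) ((v x) ^+ 2)%:E <= (K k)%:E * S)%E.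
  have [K0 H] := HK k; have rO := @room_dumbbell eps k.
  have mr : measurable (room k) by exact: measurable_cyl.
  have [I1 I2] := Iv _ mr rO.
  apply: le_trans (H v g mv I1 I2 _ _ _) _.
  - by move=> i; exact: integrableS mO mr rO (Ig i).1.
  - by move=> i; apply: weak_on_box => //; exact: (Hg i).2.
  - by rewrite -[RHS](u0 k); apply: eq_Rintegral => x /set_mem xr; rewrite (vE (room k)).
  - apply: lee_wpmul2l; first by rewrite lee_fin.
    by apply: lee_sum => i _; exact: GD.
have K1E (k : 'I_N.+1) : K k <= K1.
  by rewrite /K1 (bigD1 k)//= lerDl sumr_ge0// => l _; have [] := HK l.
have tO := @tube_dumbbell eps.
have mt : measurable (tube eps) by exact: measurable_cyl.
have mslab : measurable [set x : 'rV[R]_n | 0 < x ord0 i0 < 1].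
  rewrite (_ : [set _ | _] = rV_coord i0 @^-1` `]0, 1[%classic).
    rewrite -[X in measurable X]setTI.
    by apply: (@measurable_rV_coord R n i0) => //; exact: measurable_itv.
  by apply/seteqP; split => x /=; rewrite in_itv.
have tube_le : (\int[leb]_(x in tube eps) ((v x) ^+ 2)%:E <=
    (8 * L ^+ 3 + 2 * L * K1)%:E * S)%E.
  have L1 : 1 <= L by rewrite ler1n.
  have L0 : 0 <= L by apply: le_trans L1.
  have [I1 _] := Iv _ mt tO.
  have aE : cyl_lo 0 eps i0 = 0 by rewrite /cyl_lo eqxx.
  have bE : cyl_hi N.*2.+1%:R eps i0 = L by rewrite /cyl_hi eqxx.
  have abt : cyl_lo 0 eps i0 < cyl_hi N.*2.+1%:R eps i0 by rewrite aE bE (lt_le_trans ltr01).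
  have := @tube_estimate R n i0 (cyl_lo 0 eps) (cyl_hi N.*2.+1%:R eps) 0 1 v.
  rewrite aE bE => /(_ (lexx 0) ltr01 L1 mv); rewrite !subr0 mul1e => H.
  apply: le_trans H _; rewrite (EFinD (8 * L ^+ 3)) ge0_muleDl ?lee_fin ?mulr_ge0// ?exprn_ge0//.
  apply: leeD.
    have := dir_energy_le abt mv I1 (integrableS mO mt tO (Ig i0).1) (weak_on_box tO (Hg i0).2).
    rewrite aE bE subr0 => H.
    apply: (@le_trans _ _ (2%:E * ((4 * L ^+ 3)%:E * S))%E).
      apply: lee_wpmul2l; first by rewrite lee_fin.
      apply: le_trans H _; apply: lee_wpmul2l; first by rewrite lee_fin mulr_ge0// exprn_ge0.
      apply: le_trans (GD i0 _ mt tO) _.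
      rewrite /S (bigD1 i0)//= leeDl//; exact: sume_ge0.
    rewrite muleA -EFinM mulrA -natrM; exact: lexx.
  rewrite (EFinM (2 * L)) -muleA; apply: lee_wpmul2l; first by rewrite lee_fin mulr_ge0.
  apply: (@le_trans _ _ (\int[leb]_(x in room ord0) ((v x) ^+ 2)%:E)%E).
    apply: ge0_subset_integral => //.
    + exact: measurableI mt mslab.
    + exact: measurable_cyl.
    + by apply: measurable_funTS; apply/measurable_EFinP; exact: measurable_funX.
    + by move=> x _; rewrite lee_fin sqr_ge0.
    move=> x [xt /andP[x0 x1]] l; have := xt l; rewrite /cyl_lo /cyl_hi.
    have [->|_] := eqVneq l i0; first by rewrite x0 x1.
    move=> /andP[h1 h2]; rewrite (lt_trans _ h1) ?ltrN2//= (lt_trans h2)//.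
  apply: le_trans (room_le ord0) _; apply: lee_wpmul2r => //.
  by rewrite lee_fin; exact: K1E.
have mv2 D : measurable_fun D (fun x => ((v x) ^+ 2)%:E).
  by apply: measurable_funTS; apply/measurable_EFinP; exact: measurable_funX.
have tot : (\int[leb]_(x in Om) ((v x) ^+ 2)%:E <=
    (1 + (8 * L ^+ 3 + 2 * L * K1) + K1)%:E * S)%E.
  apply: le_trans (integral_dumbbell_le (mv2 _) _) _.
    by move=> x _; rewrite lee_fin sqr_ge0.
  apply: (@le_trans _ _ ((8 * L ^+ 3 + 2 * L * K1)%:E * S + K1%:E * S)%E).
    apply: leeD => //; apply: (@le_trans _ _ (\sum_(k < N.+1) ((K k)%:E * S))%E).
      by apply: lee_sum => k _; exact: room_le.
    rewrite /K1 -sumEFin ge0_sume_distrl// => k _; rewrite lee_fin; have [] := HK k => //.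
  have L0 : 0 <= L by [].
  rewrite -ge0_muleDl ?lee_fin ?addr_ge0 ?mulr_ge0 ?exprn_ge0// -EFinD.
  apply: lee_wpmul2r => //; by rewrite lee_fin lerD2r lerDr.
have SE : S = (\int[leb]_(x in Om) (sqnorm_grad Om u x))%R%:E.
  have E : (S = \int[leb]_(x in Om) (sqnorm_grad Om u x)%:E)%E.
    rewrite /sqnorm_grad; under [RHS]eq_integral do rewrite -sumEFin.
    by rewrite integral_sum// => i; exact: (Ig i).2.
  rewrite /Rintegral -E fineK//; apply/sum_fin_numP => i _ _.
  exact: (integrable_fin_num mO (Ig i).2).
have uE : (\int[leb]_(x in Om) ((v x) ^+ 2)%:E = (\int[leb]_(x in Om) (u x ^+ 2))%:E)%E.
  rewrite fineK; last exact: (integrable_fin_num mO Iu2).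
  by apply: eq_integral => x /set_mem xO; rewrite (vE Om).
by move: tot; rewrite uE SE -EFinM lee_fin.
Qed.

End dumbbell.

(** * Min-max bounds and the Laplace eigenvalues from below *)

Section minmax_bounds.
Context {R : realType} {n : nat}.
Local Notation leb := (lebesgue_rV R n).
Variables (Omega : set 'rV[R]_n) (A B : 'I_n -> R).
Hypotheses (mO : measurable Omega) (OAB : Omega `<=` box A B).
Implicit Types (u v g : 'rV[R]_n -> R).

(** Linear independence almost everywhere is what makes the denominators of the
    Rayleigh quotients positive. *)
Lemma Rintegral_sqr_gt0 j (b : 'I_j -> 'rV[R]_n -> R) c :
  (forall i, square_integrable Omega (b i)) -> ae_free Omega b -> c != 0 ->
  0 < \int[leb]_(x in Omega) (lincomb b c x) ^+ 2.
Proof.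
move=> sb fb c0.
have su := square_integrable_lincomb mO OAB c sb.
have [_ Iu2] := square_integrable_integrable mO OAB su.
have mu2 := measurable_int _ Iu2.
rewrite lt_neqAle; apply/andP; split; last by apply: Rintegral_ge0 => x _; exact: sqr_ge0.
apply: contraNneq c0 => u0; apply/eqP/fb.
have [+ _] := ae_eq_integral_abs leb mO mu2.
have -> : (\int[leb]_(x in Omega) `|((fun x => lincomb b c x ^+ 2) x)%:E| = 0)%E.
  rewrite (_ : (\int[leb]_(x in Omega) _ = \int[leb]_(x in Omega) (lincomb b c x ^+ 2)%:E)%E); last first.
    by apply: eq_integral => x _; rewrite gee0_abs// lee_fin sqr_ge0.
  by rewrite -(fineK (integrable_fin_num mO Iu2)) [fine _](esym u0).
move=> /(_ erefl); apply: filterS => x + Ox => /(_ Ox) [] /eqP.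
by rewrite sqrf_eq0 => /eqP.
Qed.

Lemma minmax_ge k dens j (m : R) :
  (forall b : 'I_j -> 'rV[R]_n -> R, (forall i, sobolev k Omega (b i)) ->
    ae_free Omega b -> exists2 c : 'rV[R]_j, c != 0 &
    m * \int[leb]_(x in Omega) (lincomb b c x) ^+ 2 <=
    \int[leb]_(x in Omega) dens (lincomb b c) x) ->
  (m%:E <= minmax k Omega dens j)%E.
Proof.
move=> H; apply: le_ereal_inf_tmp => _ [b [sb fb] <-].
have [c c0 Hc] := H b sb fb.
apply: (@le_trans _ _ (rayleigh Omega dens (lincomb b c))%:E); last first.
  by apply: ereal_sup_ubound; exists c.
have u0 : 0 < \int[leb]_(x in Omega) (lincomb b c x) ^+ 2.
  by apply: Rintegral_sqr_gt0 => // i; have [] := sb i.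
by rewrite lee_fin /rayleigh ler_pdivlMr.
Qed.

Lemma minmax_le k dens j (m : R) (b : 'I_j -> 'rV[R]_n -> R) :
  (forall i, sobolev k Omega (b i)) -> ae_free Omega b ->
  (forall c : 'rV[R]_j, c != 0 -> \int[leb]_(x in Omega) dens (lincomb b c) x <=
    m * \int[leb]_(x in Omega) (lincomb b c x) ^+ 2) ->
  (minmax k Omega dens j <= m%:E)%E.
Proof.
move=> sb fb H; apply: (@le_trans _ _ (ereal_sup [set (rayleigh Omega dens (lincomb b c))%:E
    | c in [set c : 'rV[R]_j | c != 0]])).
  by apply: ereal_inf_lbound; exists b.
apply: ge_ereal_sup => _ [c c0 <-].
have u0 : 0 < \int[leb]_(x in Omega) (lincomb b c x) ^+ 2.
  by apply: Rintegral_sqr_gt0 => // i; have [] := sb i.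
by rewrite lee_fin /rayleigh ler_pdivrMr//; exact: H.
Qed.

End minmax_bounds.

Section laplace_lower_bound.
Context {R : realType} {n : nat}.
Local Notation leb := (lebesgue_rV R n).
Variables (i0 : 'I_n) (N : nat).
Local Notation dumbbell := (@dumbbell R n i0 N).

Lemma dumbbell_box eps : 0 < eps < 1 ->
  dumbbell eps `<=` box (cyl_lo i0 0 1) (cyl_hi i0 N.*2.+1%:R 1).
Proof. by move=> /andP[_ /ltW e1]; exact: dumbbell_hull. Qed.

(** In a space of dimension j >= N+2, the N+1 linear conditions that the means in
    the rooms vanish have a nonzero solution, to which the spectral gap
    applies. *)
Lemma laplace_dumbbell_ge : exists2 m : R, 0 < m & forall eps j,
  0 < eps < 1 -> (N + 2 <= j)%N ->
  (m%:E <= laplace_neumann (dumbbell eps) j)%E.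
Proof.
have [K K0 HK] := @spectral_gap R n i0 N.
exists K^-1; first by rewrite invr_gt0.
move=> eps j e01 Nj.
have OAB := dumbbell_box e01.
have mO := @measurable_dumbbell R n i0 N eps.
apply: (minmax_ge mO OAB) => b sb fb.
pose M : 'M[R]_(j, N.+1) := \matrix_(i, k) \int[leb]_(x in room i0 k) b i x.
have : kermx M != 0.
  rewrite kermx_eq0 /row_free; apply/eqP => rM.
  by have := rank_leq_col M; rewrite rM => /(leq_trans Nj); rewrite addn2 ltnn.
move=> /rowV0Pn[c cM c0]; exists c => //.
have cM0 : c *m M = 0 by apply/sub_kermxP.
rewrite ler_pdivrMl//; apply: HK => //.
  exact: (sobolev_lincomb mO OAB c sb).
move=> k; have mr : measurable (room i0 k : set 'rV[R]_n) by exact: measurable_cyl.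
rewrite Rintegral_lincomb//.
  have := congr1 (fun A : 'rV[R]_N.+1 => A ord0 k) cM0; rewrite !mxE => M0; rewrite -[RHS]M0.
  by apply: eq_bigr => i _; rewrite mxE.
move=> i; have [sq _] := sb i.
apply: (integrableS mO mr); first exact: room_dumbbell.
by have [] := square_integrable_integrable mO OAB sq.
Qed.

End laplace_lower_bound.

(** * Positive quadratic forms and locality *)

Lemma continuous_sqr {R : realType} (T : topologicalType) (f : T -> R) :
  continuous f -> continuous (fun x => f x ^+ 2).
Proof.
move=> cf x; rewrite (_ : (fun x => _) = f \* f); first by apply: continuousM; exact: cf.
by apply/funext => y; rewrite expr2.
Qed.

Lemma continuous_sum {R : realType} (T : topologicalType) (I : Type) (r : seq I)
    (f : I -> T -> R) : (forall i, continuous (f i)) ->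
  continuous (fun x => \sum_(i <- r) f i x).
Proof.
move=> cf; elim: r => [|i r IH] x.
  by rewrite (_ : (fun x => _) = fun=> 0); [exact: cvg_cst|apply/funext => y; rewrite big_nil].
rewrite (_ : (fun x => _) = f i \+ (fun x => \sum_(i <- r) f i x)).
  by apply: continuousD; [exact: cf|exact: IH].
by apply/funext => y; rewrite big_cons.
Qed.

Section quadratic_form.
Context {R : realType} (j : nat) (G : 'I_j -> 'I_j -> R).

Let Q (c : 'rV[R]_j) := \sum_i c ord0 i * \sum_i' c ord0 i' * G i' i.

(** The form attains its minimum on the unit sphere, which is compact. *)
Lemma quadratic_form_ge : (forall c, c != 0 -> 0 < Q c) ->
  exists2 k : R, 0 < k & forall c : 'rV[R]_j, k * \sum_i (c ord0 i) ^+ 2 <= Q c.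
Proof.
move=> Q0; pose s (c : 'rV[R]_j) : R := \sum_i (c ord0 i) ^+ 2.
have ci i : continuous (fun c : 'rV[R]_j => c ord0 i).
  by move=> x; exact: coord_continuous.
have cs : continuous s.
  by apply: continuous_sum => i; apply: continuous_sqr; exact: ci.
have cQ : continuous Q.
  apply: continuous_sum => i c.
  apply: (@continuousM _ _ (fun c : 'rV[R]_j => c ord0 i)); first exact: ci.
  apply: continuous_sum => i' {}c; apply: (@continuousM _ _ (fun c : 'rV[R]_j => c ord0 i')); first exact: ci.
  exact: cst_continuous.
have s0 c : c != 0 -> 0 < s c.
  move=> c0; rewrite lt_neqAle sumr_ge0 ?andbT; last by move=> i _; exact: sqr_ge0.
  rewrite eq_sym psumr_eq0; last by move=> i _; exact: sqr_ge0.
  apply: contra c0 => /allP c0; apply/eqP/rowP => i; rewrite mxE.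
  by have := c0 i (mem_index_enum i); rewrite /= sqrf_eq0 => /eqP.
pose A := [set c | s c = 1].
have sZ r c : s (r *: c) = r ^+ 2 * s c.
  by rewrite /s big_distrr; apply: eq_bigr => i _; rewrite mxE exprMn.
have QZ r c : Q (r *: c) = r ^+ 2 * Q c.
  rewrite /Q big_distrr; apply: eq_bigr => i _ /=; rewrite mxE expr2 -!mulrA; congr (_ * _).
  rewrite mulrCA; congr (_ * _); rewrite big_distrr; apply: eq_bigr => i' _ /=.
  by rewrite mxE mulrA.
have Qs0 : s 0 = 0 /\ Q 0 = 0.
  by split; rewrite /s /Q big1// => i _; rewrite mxE ?expr0n// mul0r.
have nA c : c != 0 -> A ((Num.sqrt (s c))^-1 *: c).
  move=> c0; rewrite /A /= sZ exprVn sqr_sqrtr ?(ltW (s0 _ c0))// mulVf// gt_eqF// s0//.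
have cA : compact A.
  apply: subclosed_compact (@compact_closed_box R j (fun=> -1) (fun=> 1)) _.
    exact: (@closed_comp _ _ s [set 1]).
  move=> c sc i /=; rewrite in_itv /= -ler_norml -(@ler_pXn2r _ 2)// ?nnegrE//.
  rewrite expr1n real_normK ?num_real// -sc /s (bigD1 i)//= lerDl sumr_ge0// => l _.
  exact: sqr_ge0.
have [A0|/set0P A0] := eqVneq A set0.
  exists 1 => // c; have [->|/nA] := eqVneq c 0; last by rewrite A0.
  by rewrite -/(s 0) !Qs0.1 Qs0.2 mulr0.
have [c1 /set_mem Ac1 Hc1] := EVT_min_rV A0 cA (continuous_subspaceT cQ).
exists (Q c1).
  by apply: Q0; apply: contraPneq Ac1 => ->; rewrite /A /= Qs0.1 => /esym/eqP; rewrite oner_eq0.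
move=> c; rewrite -/(s c); have [->|c0] := eqVneq c 0.
  by rewrite Qs0.1 Qs0.2 mulr0.
have := Hc1 _ (mem_set (nA c c0)); rewrite QZ exprVn sqr_sqrtr ?(ltW (s0 _ c0))//.
by rewrite ler_pdivlMl ?s0// mulrC.
Qed.

End quadratic_form.

Section smooth_local.
Context {R : realType} {n : nat}.
Local Notation leb := (lebesgue_rV R n).

(** Partial derivatives are computed locally; this evaluates those of a function
    that is affine on an open set only. *)
Lemma partials_local (U : set 'rV[R]_n) f g s x : open U ->
  (forall y, U y -> f y = g y) -> U x -> partials s f x = partials s g x.
Proof.
move=> oU fg; elim: s x => [|i s IH] x Ux /=; first exact: fg.
apply: near_eq_derive; have : nbhs x U by exact: open_nbhs_nbhs.
by apply: filterS => y /IH.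
Qed.

Lemma Rintegral_sqr_box_gt0 (a b : 'I_n -> R) (u : 'rV[R]_n -> R) x : continuous u -> box a b x ->
  u x != 0 -> 0 < \int[leb]_(x in box a b) (u x) ^+ 2.
Proof.
move=> cu xab ux.
pose d := `|u x| / 2; have d0 : 0 < d by rewrite divr_gt0// normr_gt0.
have oU : open (box a b `&` [set y | d < `|u y|]).
  apply: openI; first exact: open_box.
  have cn : continuous (fun y => `|u y|) by move=> y; apply: (continuous_comp (cu y)); exact: norm_continuous.
  by apply: (@open_comp _ _ (fun y => `|u y|) [set r | d < r]); [move=> y _; exact: cn|exact: open_gt].
have Ux : (box a b `&` [set y | d < `|u y|]) x.
  by split => //=; rewrite /d ltr_pdivrMr// ltr_pMr ?normr_gt0// ltr1n.
have [e e0 He] := open_box_sub oU Ux.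
set B := box _ _ in He.
have cu2 : continuous (fun x => u x ^+ 2).
  exact: continuous_sqr.
have I2 := continuous_integrable_box a b cu2.
have mB : measurable B by exact: measurable_box.
have mQ := measurable_box a b.
have BQ : B `<=` box a b by move=> y /He[].
rewrite -lte_fin /Rintegral fineK; last exact: (integrable_fin_num mQ I2).
have lebB : leb B = (\prod_(i < n) (e + e))%:E.
  rewrite lebesgue_rV_box; congr (_%:E); apply: eq_bigr => i _.
  by rewrite (_ : _ - _ = e + e) ?max_r// ?addr_ge0 ?ltW//; ring.
apply: (@lt_le_trans _ _ (\int[leb]_(y in B) (d ^+ 2)%:E)%E); last first.
  apply: (@le_trans _ _ (\int[leb]_(y in B) (u y ^+ 2)%:E)%E).
    apply: ge0_le_integral => //.
    - by move=> y _; rewrite lee_fin sqr_ge0.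
    - by apply: measurable_int (integrableS mQ mB BQ I2).
    move=> y /He[_ /= dy]; rewrite lee_fin -(real_normK (num_real (u y))).
    by rewrite ler_pXn2r// ?nnegrE ltW.
  apply: ge0_subset_integral => //; first exact: measurable_int I2.
  by move=> y _; rewrite lee_fin sqr_ge0.
rewrite (@integral_cst_mul _ _ _ leb B _ _ mB lebB) -EFinM lte_fin.
rewrite mulr_gt0// ?exprn_gt0//; apply: prodr_gt0 => i _; exact: addr_gt0.
Qed.

End smooth_local.

(** * Functions that are affine in every room *)

Section cutoffs.
Context {R : realType}.

Lemma smooth_step : exists S : R -> R, [/\ smooth1 S,
  forall x, x <= 0 -> S x = 0 & forall x, 1 <= x -> S x = 1].
Proof.
have [eta [beta eta0 eta1]] := unit_bump (@ltr01 R).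
exists (prim 0 eta); split; first exact: smooth1_prim beta.
  by move=> x x0; rewrite prim_left.
by move=> x x1; rewrite (prim_right beta x1).
Qed.

(** A step up over the gap before the room k times a step down over the gap after
    it. *)
Lemma room_cutoff (k : nat) : exists2 chi : R -> R, smooth1 chi &
  forall (l : nat) x, l.*2%:R < x < l.*2.+1%:R -> chi x = (l == k)%:R.
Proof.
have [S [sS S0 S1]] := smooth_step.
exists ((fun x => S (1 * x + (1 - k.*2%:R))) \*
  (fun x => 1 + (-1) * S (1 * x + (- k.*2.+1%:R)))).
  apply: smooth1M; first exact: smooth1_affine.
  apply: (@smooth1D R (fun=> 1)); first exact: smooth1_cst.
  apply: (@smooth1M R (fun=> -1)); first exact: smooth1_cst.
  exact: smooth1_affine.
move=> l x /andP[lx xl]; rewrite /= !mul1r.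
have leR (a b : nat) : (a <= b)%N -> a%:R <= b%:R :> R by rewrite ler_nat.
case: (ltngtP l k) lx xl => [lk|kl|->] lx xl.
- have := leR l.*2.+2 k.*2; rewrite -doubleS leq_double => /(_ lk) => H.
  rewrite S0 ?mul0r//.
  move: H xl; rewrite doubleS -[l.*2.+2%:R]natr1; lra.
- have := leR k.*2.+2 l.*2; rewrite -doubleS leq_double => /(_ kl) => H.
  rewrite [X in _ * (1 + _ * X)]S1 ?mulr1 ?subrr ?mulr0//.
  move: H lx; rewrite doubleS -[k.*2.+2%:R]natr1; lra.
- move: lx xl; rewrite -natr1 => H1 H2.
  rewrite S1; last by lra.
  by rewrite S0; [rewrite mulr0 addr0 mul1r|lra].
Qed.

End cutoffs.

Section test_functions.
Context {R : realType} {n : nat}.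
Local Notation leb := (lebesgue_rV R n).
Variables (i0 : 'I_n) (N : nat).

(** The affine functions 1, x_1, .., x_n; the first index stands for 1. *)
Definition affine_basis (a : 'I_n.+1) (x : 'rV[R]_n) : R :=
  oapp (fun l => x ord0 l) 1 (unlift ord0 a).

Lemma smooth_affine_basis a : smooth (affine_basis a).
Proof.
rewrite /affine_basis; case: (unlift ord0 a) => [l|] /=; last exact: smooth_cst.
exact: (smooth_coord l (@smooth1_id R)).
Qed.

Lemma partials2_affine_basis a p q x : partials [:: p; q] (affine_basis a) x = 0.
Proof.
rewrite /affine_basis /=; case: (unlift ord0 a) => [l|] /=.
  rewrite (_ : (fun x => 'D__ _ x) = fun=> (if l == q then 1 else 0) : R).
    exact: derive_cst.
  by apply/funext => y; have [] := @derive_coord R n id (fun=> 1) l q y (fun t => is_derive_id t 1).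
rewrite (_ : (fun x => 'D__ _ x) = fun=> 0 : R); first exact: derive_cst.
by apply/funext => y; exact: derive_cst.
Qed.

(** The coefficients are read off from the differences between the centre of the
    room and a point shifted in one coordinate. *)
Lemma affine_room_eq0 k (d : 'I_n.+1 -> R) :
  (forall x, room i0 k x -> \sum_a d a * affine_basis a x = 0) -> forall a, d a = 0.
Proof.
move=> H; pose z : 'rV[R]_n := \row_l (if l == i0 then k.*2%:R + 1 / 2 else 0).
have E x : room i0 k x -> d ord0 + \sum_l d (lift ord0 l) * x ord0 l = 0.
  move=> /H; rewrite big_ord_recl /affine_basis unlift_none mulr1 => E; rewrite -[RHS]E.
  by congr (_ + _); apply: eq_bigr => l _; rewrite liftK.
have zr t q : 0 <= t -> t <= 1 / 4 -> room i0 k (upd q (z ord0 q + t) z).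
  move=> t0 t4 l; rewrite /cyl_lo /cyl_hi -[k.*2.+1%:R]natr1 !mxE.
  by have [->|lq] := eqVneq l q; case: eqP => _; apply/andP; split; lra.
have z0 q : upd q (z ord0 q + 0) z = z.
  by apply/rowP => l; rewrite mxE addr0; case: eqP => [->|].
have dl q : d (lift ord0 q) = 0.
  have H0 := E _ (zr 0 q (lexx _) ltac:(lra)).
  have H1 := E _ (zr (1/4) q ltac:(lra) (lexx _)).
  move: H0 H1; rewrite (bigD1 q)//= [X in _ -> _ + X = _ -> _](bigD1 q)//=.
  set s1 := \sum_(l | _) _; set s2 := \sum_(l | _) _.
  have -> : s1 = s2 by apply: eq_bigr => l lq; rewrite !upd_neq.
  rewrite !upd_eq; nra.
have d0 : d ord0 = 0.
  have := E z; rewrite big1 ?addr0; first by apply; rewrite -(z0 i0); apply: zr => //; lra.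
  by move=> l _; rewrite dl mul0r.
by move=> a; case: (unliftP ord0 a) => [l|] ->.
Qed.

Lemma test_basis : exists B : 'I_N.+1 * 'I_n.+1 -> 'rV[R]_n -> R,
  (forall p, smooth (B p)) /\
  forall p (k : 'I_N.+1) x, room i0 k x -> B p x = (k == p.1)%:R * affine_basis p.2 x.
Proof.
have /choice[chi Hchi] : forall k : 'I_N.+1, exists chi : R -> R, smooth1 chi /\
    forall (l : nat) x, l.*2%:R < x < l.*2.+1%:R -> chi x = (l == k)%:R.
  by move=> k; have [chi H1 H2] := @room_cutoff R k; exists chi.
exists (fun p => (fun x : 'rV[R]_n => chi p.1 (x ord0 i0)) \* affine_basis p.2); split.
  move=> p; apply: smoothM; last exact: smooth_affine_basis.
  by apply: smooth_coord; have [] := Hchi p.1.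
move=> p k x xk /=; have [_ /(_ k)H] := Hchi p.1; rewrite H//.
by have := xk i0; rewrite /cyl_lo /cyl_hi eqxx.
Qed.

(** The test functions are indexed by a room and an affine function; an injection
    [idx] selects j of them. *)
Section span.
Variable B : 'I_N.+1 * 'I_n.+1 -> 'rV[R]_n -> R.
Hypothesis smB : forall p, smooth (B p).
Hypothesis BE : forall p (k : 'I_N.+1) x, room i0 k x ->
  B p x = (k == p.1)%:R * affine_basis p.2 x.
Variables (j : nat) (idx : 'I_j -> 'I_N.+1 * 'I_n.+1).
Hypothesis idx_inj : injective idx.
Let b i := B (idx i).

Let smb i : smooth (b i). Proof. exact: smB. Qed.

Lemma smooth_lincomb (h : 'I_j -> 'rV[R]_n -> R) c :
  (forall i, smooth (h i)) -> smooth (lincomb h c).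
Proof.
move=> sh; apply: smooth_sum => i _.
by apply: (@smoothM R n (fun=> c ord0 i)); [exact: smooth_cst|exact: sh].
Qed.

(** In one room only the test functions attached to it survive, and their
    combination is affine. *)
Lemma lincomb_room (k : 'I_N.+1) c x : room i0 k x ->
  lincomb b c x = \sum_a (\sum_(i | idx i == (k, a)) c ord0 i) * affine_basis a x.
Proof.
move=> xk; rewrite (eq_bigr (fun a => \sum_i (if idx i == (k, a) then c ord0 i else 0) * affine_basis a x)).
  rewrite exchange_big; apply: eq_bigr => i _ /=.
  rewrite /b (BE _ xk); case: (idx i) => [k' a'] /=.
  rewrite (bigD1 a')//= big1 ?addr0; last first.
    by move=> a /negbTE aa; rewrite xpair_eqE [_ == a]eq_sym aa andbF mul0r.
  rewrite xpair_eqE eqxx andbT [k == k']eq_sym.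
  by case: eqP => _; rewrite ?mul1r// !mul0r mulr0.
by move=> a _; rewrite big_mkcond big_distrl.
Qed.

(** The squared norm over the rooms is a positive definite quadratic form in the
    coefficients, because a combination that vanishes in all the rooms is zero.
    The tube does not enter, so the constant is independent of eps. *)
Lemma mass_rooms_ge : exists2 k : R, 0 < k & forall c : 'rV[R]_j,
  k * \sum_i (c ord0 i) ^+ 2 <=
  \sum_(k < N.+1) \int[leb]_(x in room i0 k) (lincomb b c x) ^+ 2.
Proof.
pose G i' i := \sum_(k < N.+1) \int[leb]_(x in room i0 k) (b i' x * b i x).
have mr (k : 'I_N.+1) : measurable (room i0 k : set 'rV[R]_n) by exact: measurable_cyl.
have QE (c : 'rV[R]_j) : \sum_(k < N.+1) \int[leb]_(x in room i0 k) (lincomb b c x) ^+ 2 =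
    \sum_i c ord0 i * \sum_i' c ord0 i' * G i' i.
  under [RHS]eq_bigr => i _.
    under eq_bigr => i' _ do rewrite /G big_distrr.
    rewrite exchange_big big_distrr.
    over.
  rewrite exchange_big; apply: eq_bigr => k _ /=.
  have Ib (h : 'rV[R]_n -> R) : smooth h -> leb.-integrable (room i0 k) (EFin \o h).
    by move=> sh; exact: (continuous_integrable_box _ _ (smooth_continuous sh)).
  rewrite (eq_bigr (fun i => c ord0 i * \int[leb]_(x in room i0 k) (lincomb b c \* b i) x)).
    rewrite -Rintegral_lincomb//.
      apply: eq_Rintegral => x _; rewrite /lincomb expr2 big_distrr; apply: eq_bigr => i _ /=.
      by rewrite mulrCA.
    by move=> i; apply: Ib; apply: smoothM; [exact: smooth_lincomb|exact: smb].
  move=> i _; congr (_ * _); rewrite -(@Rintegral_lincomb R n _ j (fun i' => b i' \* b i))//.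
    by apply: eq_Rintegral => x _; rewrite /lincomb /= big_distrl; apply: eq_bigr => i' _ /=; rewrite mulrA.
  by move=> i'; apply: Ib; apply: smoothM; exact: smb.
have [|k k0 Hk] := @quadratic_form_ge R j G; last first.
  by exists k => // c; rewrite QE; exact: Hk.
move=> c c0; rewrite -QE.
have [i ci] : exists i, c ord0 i != 0.
  apply/existsP; apply: contra_neqT c0; rewrite negb_exists => /forallP c0.
  by apply/rowP => i; rewrite mxE; have := c0 i; rewrite negbK => /eqP.
have [k [x xk ux]] : exists k : 'I_N.+1, exists2 x, room i0 k x & lincomb b c x != 0.
  exists (idx i).1; apply: contrapT => H.
  have := @affine_room_eq0 (idx i).1 (fun a => \sum_(i' | idx i' == ((idx i).1, a)) c ord0 i') _ (idx i).2.
  rewrite -surjective_pairing (big_pred1 i); first by move=> H1; move: ci; rewrite H1 ?eqxx// => x xk;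
    rewrite -lincomb_room//; apply: contrapT => /eqP ux; apply: H; exists x.
  by move=> i' /=; rewrite (inj_eq idx_inj).
rewrite (bigD1 k)//=; apply: ltr_wpDr.
  by apply: sumr_ge0 => l _; apply: Rintegral_ge0 => y _; exact: sqr_ge0.
apply: Rintegral_sqr_box_gt0 xk ux.
by apply: smooth_continuous; exact: smooth_lincomb.
Qed.

End span.

End test_functions.

(** * The eigenvalues from above *)

Lemma sqr_le_sum (R : realType) (j : nat) (c h : 'I_j -> R) (M : R) :
  (forall i, `|h i| <= M) ->
  (\sum_i c i * h i) ^+ 2 <= j%:R ^+ 2 * M ^+ 2 * \sum_i (c i) ^+ 2.
Proof.
move=> hM; set s := \sum_i (c i) ^+ 2.
have s0 : 0 <= s by apply: sumr_ge0 => i _; exact: sqr_ge0.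
have cs i : `|c i| <= Num.sqrt s.
  rewrite -(@ler_pXn2r _ 2)// ?nnegrE ?sqrtr_ge0// sqr_sqrtr// real_normK ?num_real//.
  by rewrite /s (bigD1 i)//= lerDl sumr_ge0// => l _; exact: sqr_ge0.
case: j => [|j] in c h hM s s0 cs *; first by rewrite big_ord0 expr0n mulr_ge0// mulr_ge0// sqr_ge0.
have M0 : 0 <= M by exact: le_trans (hM ord0).
have H : `|\sum_i c i * h i| <= j.+1%:R * M * Num.sqrt s.
  apply: le_trans (ler_norm_sum _ _ _) _.
  have -> : j.+1%:R * M * Num.sqrt s = \sum_(i < j.+1) Num.sqrt s * M.
    by rewrite sumr_const card_ord -[RHS]mulr_natl [Num.sqrt _ * M]mulrC mulrA.
  by apply: ler_sum => i _; rewrite normrM ler_pM.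
rewrite -(sqr_sqrtr s0) -!exprMn -(real_normK (num_real (\sum_i _))).
by rewrite ler_pXn2r// ?nnegrE// !mulr_ge0// sqrtr_ge0.
Qed.

Section weak_energy.
Context {R : realType} {n : nat}.
Local Notation leb := (lebesgue_rV R n).
Variables (Omega : set 'rV[R]_n) (A B : 'I_n -> R).
Hypotheses (mO : measurable Omega) (OAB : Omega `<=` box A B).

(** On a box inside Omega, the weak derivatives of a smooth function are replaced
    by its classical derivatives, since they agree almost everywhere there. *)
Lemma weak_energy_box (a b : 'I_n -> R) s j (f : 'I_j -> 'rV[R]_n -> R) c :
  box a b `<=` Omega -> (forall i, smooth (f i)) ->
  (\int[leb]_(x in box a b) ((weak_partials Omega s (lincomb f c) x) ^+ 2)%:E =
   \int[leb]_(x in box a b) ((lincomb (fun i => partials (rev s) (f i)) c x) ^+ 2)%:E)%E.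
Proof.
move=> abO smf; have mQ := measurable_box a b.
have sob i : sobolev (size s) Omega (f i) := sobolev_smooth _ OAB mO (smf i).
have [sw ww] := weak_partialsP (sobolev_lincomb mO OAB c sob) (leqnn _).
have sh i : square_integrable Omega (partials (rev s) (f i)).
  apply: square_integrable_continuous OAB mO _.
  by apply: smooth_continuous; exact: smooth_partials.
have sfq i : square_integrable Omega (f i).
  by apply: square_integrable_continuous OAB mO _; exact: smooth_continuous.
have sH := square_integrable_lincomb mO OAB c sh.
have wH := is_weak_partials_lincomb mO OAB c sfq sh
  (fun i => @is_weak_partials_smooth R n Omega (f i) s (smf i)).
have aeE := weak_partials_unique_box mO OAB abO sw sH ww wH.
apply: ge0_ae_eq_integral => //.
- by apply/measurable_EFinP; apply: measurable_funX; exact: measurable_funS mO abO sw.1.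
- by apply/measurable_EFinP; apply: measurable_funX; exact: measurable_funS mO abO sH.1.
- by move=> x _; rewrite lee_fin sqr_ge0.
- by move=> x _; rewrite lee_fin sqr_ge0.
- by apply: filterS aeE => x + Qx => /(_ Qx) ->.
Qed.

Lemma weak_energy_integrable k s u : sobolev k Omega u -> (size s <= k)%N ->
  leb.-integrable Omega (EFin \o (fun x => (weak_partials Omega s u x) ^+ 2)).
Proof.
move=> su sk; have [sw _] := weak_partialsP su sk.
by have [] := square_integrable_integrable mO OAB sw.
Qed.

Lemma Rintegral_weak_energy_le k (I : finType) (s : I -> seq 'I_n) u (E : I -> R) :
  sobolev k Omega u -> (forall p, (size (s p) <= k)%N) ->
  (forall p, (\int[leb]_(x in Omega) ((weak_partials Omega (s p) u x) ^+ 2)%:E <= (E p)%:E)%E) ->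
  \int[leb]_(x in Omega) (\sum_p (weak_partials Omega (s p) u x) ^+ 2) <= \sum_p E p.
Proof.
move=> su sk H; rewrite /Rintegral.
have -> : (\int[leb]_(x in Omega) (\sum_p weak_partials Omega (s p) u x ^+ 2)%:E =
    \sum_p \int[leb]_(x in Omega) ((weak_partials Omega (s p) u x) ^+ 2)%:E)%E.
  under eq_integral do rewrite -sumEFin.
  by rewrite integral_sum// => p; exact: (weak_energy_integrable su (sk p)).
have Hf p := integrable_fin_num mO (weak_energy_integrable su (sk p)).
rewrite -sum_fine; last by move=> p _; exact: Hf.
by apply: ler_sum => p _; rewrite -lee_fin fineK//; exact: Hf.
Qed.

End weak_energy.

Section dumbbell_upper_bounds.
Context {R : realType} {n : nat}.
Local Notation leb := (lebesgue_rV R n).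
Variables (i0 : 'I_n) (N : nat).
Local Notation dumbbell := (@dumbbell R n i0 N).
Local Notation tube := (@tube R n i0 N).
Variable B : 'I_N.+1 * 'I_n.+1 -> 'rV[R]_n -> R.
Hypothesis smB : forall p, smooth (B p).
Hypothesis BE : forall p (k : 'I_N.+1) x, room i0 k x ->
  B p x = (k == p.1)%:R * affine_basis p.2 x.
Variables (j : nat) (idx : 'I_j -> 'I_N.+1 * 'I_n.+1).
Hypothesis idx_inj : injective idx.
Let b i := B (idx i).

Let smb i : smooth (b i). Proof. exact: smB. Qed.

Let sumsq (c : 'rV[R]_j) : R := \sum_i (c ord0 i) ^+ 2.

Let sumsq_ge0 c : 0 <= sumsq c.
Proof. by apply: sumr_ge0 => i _; exact: sqr_ge0. Qed.

Lemma partials_bounded s : exists2 M : R, 0 <= M & forall i x, hull i0 N x ->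
  `|partials (rev s) (b i) x| <= M.
Proof.
have /choice[M HM] : forall i, exists M : R, 0 <= M /\ forall x, hull i0 N x ->
    `|partials (rev s) (b i) x| <= M.
  move=> i; have := smooth_continuous (smooth_partials (rev s) (smb i)).
  by move=> /(continuous_bounded_box (cyl_lo i0 0 1) (cyl_hi i0 N.*2.+1%:R 1))[M M0 H]; exists M.
exists (\sum_i M i); first by apply: sumr_ge0 => i _; have [] := HM i.
move=> i x hx; have [_ /(_ x hx) H] := HM i; apply: le_trans H _.
by rewrite (bigD1 i)//= lerDl sumr_ge0// => l _; have [] := HM l.
Qed.

Lemma weak_energy_dumbbell_le eps s c : 0 < eps < 1 ->
  (\int[leb]_(x in dumbbell eps) ((weak_partials (dumbbell eps) s (lincomb b c) x) ^+ 2)%:E <=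
   \int[leb]_(x in tube eps) ((lincomb (fun i => partials (rev s) (b i)) c x) ^+ 2)%:E +
   \sum_(k < N.+1) \int[leb]_(x in room i0 k) ((lincomb (fun i => partials (rev s) (b i)) c x) ^+ 2)%:E)%E.
Proof.
move=> e01; have OAB := @dumbbell_box R n i0 N _ e01.
have mO := @measurable_dumbbell R n i0 N eps.
have sob i : sobolev (size s) (dumbbell eps) (b i) := sobolev_smooth _ OAB mO (smb i).
have I2 := weak_energy_integrable mO OAB (sobolev_lincomb mO OAB c sob) (leqnn _).
apply: le_trans (integral_dumbbell_le (measurable_int _ I2) _) _.
  by move=> x _; rewrite lee_fin sqr_ge0.
rewrite (weak_energy_box mO OAB s c (@tube_dumbbell R n i0 N eps) smb).
apply: leeD; first exact: lexx.
apply: lee_sum => k _.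
by rewrite (weak_energy_box mO OAB s c (@room_dumbbell R n i0 N eps k) smb).
Qed.

Lemma integral_lincomb_le (a' b' : 'I_n -> R) (h : 'I_j -> 'rV[R]_n -> R) c (M : R) :
  (forall i, continuous (h i)) -> (forall i x, box a' b' x -> `|h i x| <= M) ->
  (\int[leb]_(x in box a' b') ((lincomb h c x) ^+ 2)%:E <=
   (j%:R ^+ 2 * M ^+ 2 * sumsq c)%:E * leb (box a' b'))%E.
Proof.
move=> ch hM; have mQ := measurable_box a' b'.
rewrite -(integral_cst leb mQ); apply: ge0_le_integral => //.
- by move=> x _; rewrite lee_fin sqr_ge0.
- apply: measurable_funTS; apply/measurable_EFinP; apply: measurable_funX.
  apply: continuous_measurable_rV; apply: continuous_sum => i.
  by move=> x; apply: continuousM; [exact: cst_continuous|exact: ch].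
- by move=> x Qx; rewrite lee_fin; apply: sqr_le_sum => i; exact: hM.
Qed.

Lemma mass_le : exists2 m : R, 0 < m & forall eps c, 0 < eps < 1 ->
  sumsq c <= m * \int[leb]_(x in dumbbell eps) (lincomb b c x) ^+ 2.
Proof.
have [k k0 Hk] := mass_rooms_ge smB BE idx_inj.
exists (k^-1 * N.+1%:R); first by rewrite mulr_gt0// invr_gt0.
move=> eps c e01; rewrite -mulrA ler_pdivlMl//; apply: le_trans (Hk c) _.
have OAB := @dumbbell_box R n i0 N _ e01.
have mO := @measurable_dumbbell R n i0 N eps.
have sl : smooth (lincomb b c) by exact: smooth_lincomb.
have [_ I2] := square_integrable_integrable mO OAB
  (square_integrable_continuous OAB mO (smooth_continuous sl)).
have -> : N.+1%:R * \int[leb]_(x in dumbbell eps) (lincomb b c x) ^+ 2 =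
    \sum_(k < N.+1) \int[leb]_(x in dumbbell eps) (lincomb b c x) ^+ 2.
  by rewrite sumr_const card_ord -[RHS]mulr_natl.
apply: ler_sum => l _; have mr : measurable (room i0 l : set 'rV[R]_n) by exact: measurable_cyl.
have Ir := integrableS mO mr (@room_dumbbell R n i0 N eps l) I2.
rewrite -lee_fin /Rintegral !fineK; [|exact: (integrable_fin_num mO I2)|exact: (integrable_fin_num mr Ir)].
apply: ge0_subset_integral => //.
- exact: measurable_int I2.
- by move=> x _; rewrite lee_fin sqr_ge0.
- exact: room_dumbbell.
Qed.

(** A combination that vanishes almost everywhere has norm 0, and [mass_le] bounds
    its coefficients by this norm. *)
Lemma test_ae_free eps : 0 < eps < 1 -> ae_free (dumbbell eps) b.
Proof.
move=> e01 c c0; have [m m0 Hm] := mass_le.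
have OAB := @dumbbell_box R n i0 N _ e01.
have mO := @measurable_dumbbell R n i0 N eps.
have := Hm _ c e01; rewrite {1}/Rintegral (_ : (\int[leb]_(x in _) _ = 0)%E).
  rewrite mulr0 => s0; have /eqP : sumsq c = 0 by apply/eqP; rewrite eq_le s0 sumsq_ge0.
  rewrite psumr_eq0; last by move=> i _; exact: sqr_ge0.
  move=> /allP {}s0; apply/rowP => i; rewrite mxE.
  by have := s0 i (mem_index_enum i); rewrite /= sqrf_eq0 => /eqP.
transitivity (\int[leb]_(x in dumbbell eps) (0%:E))%E; last by rewrite integral0.
apply: ge0_ae_eq_integral => //.
- apply: measurable_funTS; apply/measurable_EFinP; apply: measurable_funX.
  by apply: measurable_smooth; exact: smooth_lincomb.
- by move=> x _; rewrite lee_fin sqr_ge0.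
- by apply: filterS c0 => x + Ox => /(_ Ox) ->; rewrite expr0n.
Qed.

Lemma grad_energy_le : exists M : R, forall eps c, 0 < eps < 1 ->
  \int[leb]_(x in dumbbell eps) sqnorm_grad (dumbbell eps) (lincomb b c) x <= M * sumsq c.
Proof.
have /choice[M HM] : forall i : 'I_n, exists M : R, 0 <= M /\ forall i' x, hull i0 N x ->
    `|partials (rev [:: i]) (b i') x| <= M.
  by move=> i; have [M M0 H] := partials_bounded [:: i]; exists M.
pose V : R := fine (leb (hull i0 N)).
have VE : leb (hull i0 N) = V%:E.
  by rewrite fineK// ge0_fin_numE; [exact: lebesgue_rV_box_fin|exact: measure_ge0].
pose E p := j%:R ^+ 2 * M p ^+ 2 * (V + N.+1%:R * V).
exists (\sum_p E p) => eps c e01; have OAB := @dumbbell_box R n i0 N _ e01.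
have mO := @measurable_dumbbell R n i0 N eps.
have e1 : eps <= 1 by case/andP: e01 => _ /ltW.
have sob i : sobolev 1 (dumbbell eps) (b i) := sobolev_smooth _ OAB mO (smb i).
rewrite big_distrl /=; apply: (Rintegral_weak_energy_le mO OAB (sobolev_lincomb mO OAB c sob)) => // p.
have [M0 Hp] := HM p.
have H (D : set 'rV[R]_n) : measurable D -> D `<=` hull i0 N -> (leb D <= V%:E)%E.
  by move=> mD DH; rewrite -VE; apply: le_measure; rewrite ?inE//; exact: measurable_box.
have ch i : continuous (partials (rev [:: p]) (b i)).
  by apply: smooth_continuous; exact: smooth_partials.
have K0 : 0 <= j%:R ^+ 2 * M p ^+ 2 * sumsq c by rewrite !mulr_ge0// ?sqr_ge0.
apply: le_trans (weak_energy_dumbbell_le [:: p] c e01) _.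
rewrite -/(sumsq c) (_ : E p * sumsq c = j%:R ^+ 2 * M p ^+ 2 * sumsq c * V +
   \sum_(k < N.+1) (j%:R ^+ 2 * M p ^+ 2 * sumsq c * V)); last first.
  by rewrite sumr_const card_ord -[_ *+ _]mulr_natl /E; ring.
rewrite EFinD -sumEFin; apply: leeD; last apply: lee_sum => k _.
  have th := @tube_hull R n i0 N eps e1.
  apply: le_trans (integral_lincomb_le c ch (fun i x tx => Hp i x (th x tx))) _.
  by rewrite (EFinM _ V); apply: lee_wpmul2l; [rewrite lee_fin|apply: H => //; exact: measurable_box].
have rh := @room_hull R n i0 N k (ltn_ord k).
apply: le_trans (integral_lincomb_le c ch (fun i x tx => Hp i x (rh x tx))) _.
by rewrite (EFinM _ V); apply: lee_wpmul2l; [rewrite lee_fin|apply: H => //; exact: measurable_box].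
Qed.

(** In the rooms the test functions are affine, so that only the tube contributes;
    there the Hessians are bounded independently of eps. *)
Lemma hess_energy_le : exists2 M : R, 0 <= M & forall eps c, 0 < eps < 1 ->
  \int[leb]_(x in dumbbell eps) sqnorm_hess (dumbbell eps) (lincomb b c) x <=
  M * fine (leb (tube eps)) * sumsq c.
Proof.
have /choice[M HM] : forall p : 'I_n * 'I_n, exists M : R, 0 <= M /\ forall i' x, hull i0 N x ->
    `|partials (rev [:: p.1; p.2]) (b i') x| <= M.
  by move=> p; have [M M0 H] := partials_bounded [:: p.1; p.2]; exists M.
pose E p := j%:R ^+ 2 * M p ^+ 2.
exists (\sum_p E p); first by apply: sumr_ge0 => p _; rewrite mulr_ge0// sqr_ge0.
move=> eps c e01; have OAB := @dumbbell_box R n i0 N _ e01.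
have mO := @measurable_dumbbell R n i0 N eps.
have e1 : eps <= 1 by case/andP: e01 => _ /ltW.
have sob i : sobolev 2 (dumbbell eps) (b i) := sobolev_smooth _ OAB mO (smb i).
rewrite -mulrA big_distrl /=.
rewrite (_ : sqnorm_hess _ _ = fun x => \sum_p (weak_partials (dumbbell eps) [:: p.1; p.2] (lincomb b c) x) ^+ 2);
  last by apply/funext => x; rewrite /sqnorm_hess pair_bigA.
apply: (Rintegral_weak_energy_le mO OAB (sobolev_lincomb mO OAB c sob)) => // p.
have [M0 Hp] := HM p.
have ch i : continuous (partials (rev [:: p.1; p.2]) (b i)).
  by apply: smooth_continuous; exact: smooth_partials.
apply: le_trans (weak_energy_dumbbell_le [:: p.1; p.2] c e01) _.
rewrite [X in (_ + X)%E]big1 ?adde0; last first.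
  move=> k _; apply: integral0_eq => x xk; rewrite /lincomb big1 ?expr0n// => i _.
  rewrite (@partials_local R n (room i0 k) _ (fun y => (k == (idx i).1)%:R * affine_basis (idx i).2 y))//.
  - rewrite /=; case: (k == _).
      rewrite (_ : (fun y => 1%:R * _) = affine_basis (idx i).2); last by apply/funext => y; rewrite mul1r.
      by have := @partials2_affine_basis R n (idx i).2 p.2 p.1 x => /= ->; rewrite mulr0.
    rewrite (_ : (fun y => 0%:R * _) = fun=> 0 : R); last by apply/funext => y; rewrite mul0r.
    rewrite (_ : (fun x => 'D__ _ x) = fun=> 0 : R); first by rewrite derive_cst mulr0.
    by apply/funext => y; exact: derive_cst.
  - exact: open_box.
  - by move=> y yk; rewrite /b; exact: BE.
have th := @tube_hull R n i0 N eps e1.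
apply: le_trans (integral_lincomb_le c ch (fun i x tx => Hp i x (th x tx))) _.
rewrite (_ : E p * _ = j%:R ^+ 2 * M p ^+ 2 * sumsq c * fine (leb (tube eps))); last by rewrite /E; ring.
rewrite (EFinM _ (fine _)) fineK//.
by rewrite ge0_fin_numE; [exact: lebesgue_rV_box_fin|exact: measure_ge0].
Qed.

End dumbbell_upper_bounds.

Section eigenvalue_upper_bounds.
Context {R : realType} {n : nat}.
Local Notation leb := (lebesgue_rV R n).
Variables (i0 : 'I_n) (N j : nat).
Hypothesis jle : (j <= N.+1 * n.+1)%N.

(** The energies and the squared norm are compared through the sum of the squares
    of the coefficients. *)
Lemma dumbbell_upper_bounds : exists2 M : R, 0 <= M & forall eps, 0 < eps < 1 ->
  (laplace_neumann (dumbbell i0 N eps) j <= M%:E)%E /\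
  (biharmonic_neumann (dumbbell i0 N eps) j <= (M * fine (leb (tube i0 N eps)))%:E)%E.
Proof.
have [B [smB BE]] := @test_basis R n i0 N.
have jcard : (j <= #|{: 'I_N.+1 * 'I_n.+1}|)%N by rewrite card_prod !card_ord.
pose idx (i : 'I_j) := enum_val (widen_ord jcard i).
have idx_inj : injective idx.
  by move=> i i' /enum_val_inj/(congr1 val)/= H; exact: val_inj.
have [m m0 Hm] := mass_le smB BE idx_inj.
have [M1 HM1] := grad_energy_le i0 smB idx.
have [M2 M20 HM2] := hess_energy_le smB BE idx.
exists (`|M1| * m + M2 * m) => [|eps e01].
  by rewrite addr_ge0// mulr_ge0// ltW.
have OAB := @dumbbell_box R n i0 N _ e01.
have mO := @measurable_dumbbell R n i0 N eps.
have V0 : 0 <= fine (leb (tube i0 N eps)) by apply: fine_ge0; exact: measure_ge0.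
have sob k i : sobolev k (dumbbell i0 N eps) (B (idx i)) := sobolev_smooth _ OAB mO (smB _).
have fb := test_ae_free smB BE idx_inj e01.
split; apply: (minmax_le mO OAB (sob _) fb) => c c0.
  apply: le_trans (HM1 _ _ e01) _.
  apply: le_trans (_ : `|M1| * (m * \int[leb]_(x in dumbbell i0 N eps) (lincomb (fun i => B (idx i)) c x) ^+ 2) <= _).
    apply: le_trans (_ : `|M1| * \sum_i (c ord0 i) ^+ 2 <= _).
      by apply: ler_wpM2r; [apply: sumr_ge0 => i _; exact: sqr_ge0|exact: ler_norm].
    by apply: ler_wpM2l => //; exact: Hm.
  rewrite mulrA; apply: ler_wpM2r; first by apply: Rintegral_ge0 => x _; exact: sqr_ge0.
  by rewrite lerDl mulr_ge0// ltW.
apply: le_trans (HM2 _ _ e01) _.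
apply: le_trans (_ : M2 * fine (leb (tube i0 N eps)) * (m * \int[leb]_(x in dumbbell i0 N eps) (lincomb (fun i => B (idx i)) c x) ^+ 2) <= _).
  by apply: ler_wpM2l; [exact: mulr_ge0|exact: Hm].
rewrite mulrA; apply: ler_wpM2r; first by apply: Rintegral_ge0 => x _; exact: sqr_ge0.
by rewrite mulrAC; apply: ler_wpM2r => //; rewrite lerDr mulr_ge0// ltW.
Qed.

End eigenvalue_upper_bounds.

(** * The boundary of the dumbbell *)

Section local_epigraph.
Context {R : realType} {n : nat}.
Implicit Types (x y d : 'rV[R]_n) (U V : set 'rV[R]_n).

Lemma coord_norm_le x i : `|x ord0 i| <= `|x|.
Proof.
rewrite [`|x|]/Num.norm /= mx_normrE.
exact: (le_bigmax _ (fun ij : 'I_1 * 'I_n => `|x ij.1 ij.2|) (ord0, i)).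
Qed.

(** Growth at unit speed along d turns the sublevel set {G < 0} into the strict
    epigraph of a Lipschitz function over the hyperplane orthogonal to d. *)
Definition epigraph_map d (G : 'rV[R]_n -> R) :=
  (exists2 M : R, 0 <= M & forall y z, `|G y - G z| <= M * `|y - z|) /\
  forall y t, G (y + t *: d) = G y + t.

(** The first two cases are those of a point inside or outside U.  Including them
    makes the property stable under finite unions and intersections. *)
Definition local_epigraph d x U :=
  [\/ \forall y \near x, U y, \forall y \near x, ~ U y |
   exists2 G, epigraph_map d G & \forall y \near x, U y <-> G y < 0].

Lemma epigraph_map_max d G H : epigraph_map d G -> epigraph_map d H ->
  epigraph_map d (fun y => Num.max (G y) (H y)).
Proof.
move=> [[M M0 HM] EG] [[L L0 HL] EH]; split; last first.
  by move=> y t; rewrite EG EH addr_maxl.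
exists (M + L); first exact: addr_ge0.
move=> y z; rewrite mulrDl; apply: le_trans (lerD (HM y z) (HL y z)).
have := ler_norm (G y - G z); have := ler_norm (G z - G y).
have := ler_norm (H y - H z); have := ler_norm (H z - H y).
rewrite [`|H z - _|]distrC [`|G z - _|]distrC => h1 h2 h3 h4.
have g1 := normr_ge0 (G y - G z); have g2 := normr_ge0 (H y - H z).
rewrite ler_norml; case: (leP (G y) (H y)) => a1; case: (leP (G z) (H z)) => a2;
  by apply/andP; split; lra.
Qed.

Lemma epigraph_map_min d G H : epigraph_map d G -> epigraph_map d H ->
  epigraph_map d (fun y => Num.min (G y) (H y)).
Proof.
move=> [[M M0 HM] EG] [[L L0 HL] EH]; split; last first.
  by move=> y t; rewrite EG EH addr_minl.
exists (M + L); first exact: addr_ge0.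
move=> y z; rewrite mulrDl; apply: le_trans (lerD (HM y z) (HL y z)).
have := ler_norm (G y - G z); have := ler_norm (G z - G y).
have := ler_norm (H y - H z); have := ler_norm (H z - H y).
rewrite [`|H z - _|]distrC [`|G z - _|]distrC => h1 h2 h3 h4.
have g1 := normr_ge0 (G y - G z); have g2 := normr_ge0 (H y - H z).
rewrite ler_norml; case: (leP (G y) (H y)) => a1; case: (leP (G z) (H z)) => a2;
  by apply/andP; split; lra.
Qed.

Lemma local_epigraphI d x U V : local_epigraph d x U -> local_epigraph d x V ->
  local_epigraph d x (U `&` V).
Proof.
move=> [nU|nU|[G eG nG]] [nV|nV|[H eH nH]].
- by apply: Or31; apply: filterS2 nU nV => y.
- by apply: Or32; apply: filterS nV => y nVy [_].
- by apply: Or33; exists H => //; apply: filterS2 nU nH => y Uy [h1 h2]; split => [[_ /h1]|/h2].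
- by apply: Or32; apply: filterS nU => y nUy [].
- by apply: Or32; apply: filterS nU => y nUy [].
- by apply: Or32; apply: filterS nU => y nUy [].
- by apply: Or33; exists G => //; apply: filterS2 nV nG => y Vy [h1 h2]; split => [[/h1]|/h2].
- by apply: Or32; apply: filterS nV => y nVy [_].
- apply: Or33; exists (fun y => Num.max (G y) (H y)); first exact: epigraph_map_max.
  apply: filterS2 nG nH => y [g1 g2] [h1 h2]; rewrite gt_max.
  by split=> [[/g1 -> /h1 ->]|/andP[/g2 ? /h2]].
Qed.

Lemma local_epigraphU d x U V : local_epigraph d x U -> local_epigraph d x V ->
  local_epigraph d x (U `|` V).
Proof.
move=> [nU|nU|[G eG nG]] [nV|nV|[H eH nH]].
- by apply: Or31; apply: filterS nU => y; left.
- by apply: Or31; apply: filterS nU => y; left.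
- by apply: Or31; apply: filterS nU => y; left.
- by apply: Or31; apply: filterS nV => y; right.
- by apply: Or32; apply: filterS2 nU nV => y nUy nVy [].
- apply: Or33; exists H => //; apply: filterS2 nU nH => y nUy [h1 h2].
  by split=> [[//|/h1]|/h2]; [|right].
- by apply: Or31; apply: filterS nV => y; right.
- apply: Or33; exists G => //; apply: filterS2 nV nG => y nVy [h1 h2].
  by split=> [[/h1|//]|/h2]; [|left].
- apply: Or33; exists (fun y => Num.min (G y) (H y)); first exact: epigraph_map_min.
  apply: filterS2 nG nH => y [g1 g2] [h1 h2]; rewrite gt_min.
  split=> [[/g1 ->//|/h1 ->]|/orP[/g2|/h2]]; [by rewrite orbT|by left|by right].
Qed.

Lemma local_epigraph_bigI d x (I : finType) (F : I -> set 'rV[R]_n) :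
  (forall i, local_epigraph d x (F i)) ->
  local_epigraph d x [set y | forall i, F i y].
Proof.
move=> H; suff K (r : seq I) : local_epigraph d x [set y | forall i, i \in r -> F i y].
  have := K (index_enum I); rewrite (_ : [set y | _] = [set y | forall i, F i y])//.
  by apply/seteqP; split => y Hy i //=; apply: Hy; rewrite mem_index_enum.
elim: r => [|i r IH].
  by apply: Or31; near=> y => i.
rewrite (_ : [set y | _] = F i `&` [set y | forall i, i \in r -> F i y]).
  exact: local_epigraphI.
apply/seteqP; split => y /=.
  move=> Hy; split; first by apply: Hy; rewrite mem_head.
  by move=> k kr; apply: Hy; rewrite in_cons kr orbT.
by move=> [Fi Hr] k; rewrite in_cons => /predU1P[->|/Hr].
Unshelve. all: by end_near. Qed.

Lemma local_epigraph_bigU d x (I : finType) (F : I -> set 'rV[R]_n) :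
  (forall i, local_epigraph d x (F i)) ->
  local_epigraph d x (\bigcup_(i in [set: I]) F i).
Proof.
move=> H; suff K (r : seq I) : local_epigraph d x [set y | exists2 i, i \in r & F i y].
  have := K (index_enum I); rewrite (_ : [set y | _] = \bigcup_(i in [set: I]) F i)//.
  apply/seteqP; split => y; first by move=> [i _ Fi]; exists i.
  by move=> [i _ Fi]; exists i => //; rewrite mem_index_enum.
elim: r => [|i r IH].
  by apply: Or32; near=> y => -[].
rewrite (_ : [set y | _] = F i `|` [set y | exists2 i, i \in r & F i y]).
  exact: local_epigraphU.
apply/seteqP; split => y /=.
  move=> [k]; rewrite in_cons => /predU1P[->|kr] Fk; [by left|by right; exists k].
by move=> [Fi|[k kr Fk]]; [exists i; rewrite ?mem_head|exists k; rewrite // in_cons kr orbT].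
Unshelve. all: by end_near. Qed.

(** Half-spaces orthogonal to a coordinate axis, with s = 1 or s = -1.  The
    direction d must leave the half-space only if x is on its boundary. *)
Lemma local_epigraph_halfspace d x l (s c : R) : s ^+ 2 = 1 ->
  (s * x ord0 l = c -> d ord0 l = s) ->
  local_epigraph d x [set y | s * y ord0 l < c].
Proof.
move=> s1 H; have cs : {for x, continuous (fun y : 'rV[R]_n => s * y ord0 l)}.
  by apply: continuousM; [exact: cst_continuous|exact: coord_continuous].
case: (ltgtP (s * x ord0 l) c) => [xc|xc|xc].
- by apply: Or31; exact: (cvgr_lt _ cs).
- apply: Or32; have nc : \forall y \near x, c < s * (y : 'rV[R]_n) ord0 l by exact: (cvgr_gt _ cs).
  by apply: filterS nc => y cy /(lt_trans cy); rewrite ltxx.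
- apply: Or33; exists (fun y => s * y ord0 l - c).
    split; last first.
      move=> y t; rewrite !mxE (H xc) mulrDr mulrCA -expr2 s1 mulr1; ring.
    exists 1 => // y z; rewrite mul1r opprB addrA subrK -mulrBr normrM.
    have -> : `|s| = 1.
      by apply/eqP; rewrite -(@eqrXn2 _ 2)// expr1n real_normK ?num_real// s1.
    by rewrite mul1r; have := coord_norm_le (y - z) l; rewrite !mxE.
  by apply: filterE => y; rewrite /= subr_lt0.
Qed.

(** At a boundary point only the third case remains, and G is rescaled so that it
    decreases at unit speed along the unit vector e = - d / |d|. *)
Lemma local_epigraph_boundary d x U : (0 < n)%N -> (forall l, d ord0 l ^+ 2 = 1) ->
  closure U x -> open U -> ~ U x -> local_epigraph d x U -> lipschitz_boundary_at U x.
Proof.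
move=> n0 d1 clU oU nUx [nU|nU|[G [[M M0 HM] EG] nG]].
- by exfalso; apply: nUx; exact: nbhs_singleton.
- by exfalso; have [y [Uy]] := clU _ nU.
pose r : R := Num.sqrt n%:R; have r0 : 0 < r by rewrite sqrtr_gt0 ltr0n.
pose e : 'rV[R]_n := (- r^-1) *: d.
exists e, (fun y => r * G y); split.
- rewrite /dotv (eq_bigr (fun=> n%:R^-1)).
    by rewrite sumr_const card_ord -[_ *+ _]mulr_natl divff// pnatr_eq0 -lt0n.
  move=> l _; rewrite mxE -expr2 exprMn sqrrN exprVn d1 mulr1.
  by rewrite sqr_sqrtr.
- exists (r * M); split; first exact: num_real.
  move=> L rL [y z] _ /=; rewrite -mulrBr normrM gtr0_norm//.
  apply: (@le_trans _ _ (r * M * `|y - z|)).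
    by rewrite -mulrA; apply: ler_wpM2l; [exact: ltW|exact: HM].
  by apply: ler_wpM2r => //; exact: ltW.
- apply: filterS nG => y ->; set t := dotv y e.
  rewrite /e scalerA -scaleNr mulrN opprK EG mulrDr [r * (t / r)]mulrC divfK ?gt_eqF//.
  by rewrite gtrDr pmulr_rlt0.
Qed.

End local_epigraph.

Lemma convex_gt (R : realType) (a z x t : R) :
  a < z -> a < x -> 0 <= t -> t <= 1 -> a < z + t * (x - z).
Proof.
move=> az ax; rewrite le_eqVlt => /predU1P[<-|t0] t1; first by rewrite mul0r addr0.
have h1 : 0 < t * (x - a) by rewrite mulr_gt0// subr_gt0.
have h2 : 0 <= (1 - t) * (z - a) by rewrite mulr_ge0// subr_ge0// ltW.
nra.
Qed.

Section dumbbell_geometry.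
Context {R : realType} {n : nat}.
Variables (i0 : 'I_n) (N : nat).
Implicit Types (a b : 'I_n -> R) (x y d : 'rV[R]_n).

Lemma connected_box a b : connected (box a b).
Proof.
have [->|/set0P[z zab]] := eqVneq (box a b) set0; first exact: connected0.
pose S x : set 'rV[R]_n := (fun t : R => z + t *: (x - z)) @` `[0, 1]%classic.
rewrite (_ : box a b = \bigcup_(x in box a b) S x).
  apply: bigcup_connected => [|x xab].
    by exists z => x xab; exists 0; rewrite ?scale0r ?addr0//= in_itv /= lexx ler01.
  apply: connected_continuous_connected; first exact: segment_connected.
  apply: continuous_subspaceT => t; apply: cvgD; first exact: cvg_cst.
  by apply: cvgZl; exact: cvg_id.
apply/seteqP; split=> [x xab|y [x xab [t]]] /=.
  exists x => //; exists 1; last by rewrite scale1r addrC subrK.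
  by rewrite /= in_itv /= lexx ler01.
rewrite in_itv /= => /andP[t0 t1] <- l; rewrite !mxE.
have /andP[z1 z2] := zab l; have /andP[x1 x2] := xab l.
rewrite convex_gt//= -ltrN2.
have -> : - (z ord0 l + t * (x ord0 l - z ord0 l)) = - z ord0 l + t * (- x ord0 l - - z ord0 l) by ring.
by rewrite convex_gt ?ltrN2.
Qed.

(** The hypotheses say that d leaves the cylinder through every face that
    contains x. *)
Lemma local_epigraph_cyl d x (s t h : R) :
  d ord0 i0 ^+ 2 = 1 -> (x ord0 i0 = s -> d ord0 i0 = -1) ->
  (x ord0 i0 = t -> d ord0 i0 = 1) -> 0 < h ->
  (forall l, l != i0 -> d ord0 l = if x ord0 l < 0 then -1 else 1) ->
  local_epigraph d x (cyl i0 s t h).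
Proof.
move=> di ds dt h0 dl.
have -> : cyl i0 s t h = [set y : 'rV[R]_n | forall l,
   ([set y : 'rV[R]_n | -1 * y ord0 l < - cyl_lo i0 s h l] `&`
    [set y : 'rV[R]_n | 1 * y ord0 l < cyl_hi i0 t h l]) y].
  apply/seteqP; split => y Hy l; have := Hy l; rewrite /= mulN1r mul1r ltrN2.
    by move/andP.
  by move=> [-> ->].
apply: local_epigraph_bigI => l; apply: local_epigraphI.
  apply: local_epigraph_halfspace; first by rewrite sqrrN expr1n.
  rewrite mulN1r => /oppr_inj; rewrite /cyl_lo; have [->|li xl] := eqVneq l i0; first exact: ds.
  by rewrite dl// xl oppr_lt0 h0.
apply: local_epigraph_halfspace; first by rewrite expr1n.
rewrite mul1r /cyl_hi; have [->|li xl] := eqVneq l i0; first exact: dt.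
by rewrite dl// xl ltNge ltW.
Qed.

Lemma open_dumbbell (eps : R) : open (dumbbell i0 N eps : set 'rV[R]_n).
Proof.
by apply: openU; [exact: open_box|apply: bigcup_open => k _; exact: open_box].
Qed.

Lemma room_meets_tube eps (k : 'I_N.+1) : 0 < eps -> eps < 1 ->
  (tube i0 N eps `&` room i0 k : set 'rV[R]_n) !=set0.
Proof.
move=> e0 e1; exists (\row_l (if l == i0 then k.*2%:R + 1 / 2 else 0)).
have kN : (k.*2.+1%:R : R) <= N.*2.+1%:R by rewrite ler_nat ltnS leq_double -ltnS.
have k0 : 0 <= k.*2%:R :> R by [].
split=> l; rewrite /cyl_lo /cyl_hi mxE; case: eqP => _; apply/andP; split;
  move: kN; rewrite -?[k.*2.+1%:R]natr1 => kN; lra.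
Qed.

Lemma bounded_lipschitz_dumbbell eps : 0 < eps < 1 ->
  bounded_lipschitz_domain (dumbbell i0 N eps : set 'rV[R]_n).
Proof.
move=> e01; have /andP[e0 e1] := e01; have oO : open (dumbbell i0 N eps : set 'rV[R]_n) by exact: open_dumbbell.
split=> //.
- by have [x [xt _]] := room_meets_tube ord0 e0 e1; exists x; left.
- rewrite (_ : dumbbell i0 N eps = \bigcup_(k in [set: 'I_N.+1]) (tube i0 N eps `|` room i0 k)).
    have [x [xt _]] := room_meets_tube ord0 e0 e1.
    apply: bigcup_connected; first by exists x => k _; left.
    by move=> k _; apply: connectedU; [exact: room_meets_tube|exact: connected_box|exact: connected_box].
  apply/seteqP; split => [y [ty|[k _ ry]]|y [k _ [ty|ry]]].
  + by exists ord0 => //; left.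
  + by exists k => //; right.
  + by left.
  + by right; exists k.
- have cK := compact_bounded (@compact_closed_box R n (cyl_lo i0 0 1) (cyl_hi i0 N.*2.+1%:R 1)).
  apply: sub_boundedr cK => P KP y Oy; apply: KP => l /=; rewrite in_itv /=.
  by have /andP[/ltW -> /ltW ->] := dumbbell_hull (ltW e1) Oy l.
move=> x [clx nOx].
(* Transversally to the axis, d points away from the axis.  Along the axis, it
   points right at a right wall of a room and left elsewhere; left walls are at
   even abscissas and right walls at odd ones, so there is no conflict. *)
pose d : 'rV[R]_n := \row_l (if l == i0 then
  (if [exists k : 'I_N.+1, x ord0 i0 == k.*2.+1%:R] then 1 else -1)
  else if x ord0 l < 0 then -1 else 1).
have d1 l : d ord0 l ^+ 2 = 1 by rewrite mxE; do 2 case: ifP => _; rewrite ?sqrrN expr1n.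
have dl l : l != i0 -> d ord0 l = if x ord0 l < 0 then -1 else 1.
  by move=> li; rewrite mxE (negbTE li).
have dt (k : 'I_N.+1) : x ord0 i0 = k.*2.+1%:R -> d ord0 i0 = 1.
  by move=> xk; rewrite mxE eqxx ifT//; apply/existsP; exists k; rewrite xk.
have ds (k : nat) : x ord0 i0 = k.*2%:R -> d ord0 i0 = -1.
  move=> xk; rewrite mxE eqxx ifF//; apply/existsP => -[k'].
  by rewrite xk eqr_nat => /eqP/(congr1 odd); rewrite /= !odd_double.
apply: (local_epigraph_boundary (d := d)) => //; first by case: n i0 {x d clx nOx d1 dl dt ds oO} => // -[].
apply: local_epigraphU.
  by apply: local_epigraph_cyl => //; [exact: (ds 0)|exact: (dt ord_max)].
by apply: local_epigraph_bigU => k; apply: local_epigraph_cyl => //; [exact: ds|exact: dt].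
Qed.

End dumbbell_geometry.

(** * The quotient of the eigenvalues *)

(** One transversal side contributes the factor 2 eps, and the other sides are
    bounded; a second coordinate is needed here. *)
Lemma lebesgue_tube_le (R : realType) (n : nat) (i0 i1 : 'I_n) (N : nat) : i1 != i0 ->
  exists2 C : R, 0 <= C & forall eps, 0 < eps < 1 ->
  fine (lebesgue_rV R n (tube i0 N eps)) <= C * eps.
Proof.
move=> i10; pose L : R := N.*2.+1%:R + 2.
exists (2 * \prod_(i < n | i != i1) L).
  by rewrite mulr_ge0// prodr_ge0// => i _; rewrite addr_ge0.
move=> eps /andP[e0 e1]; rewrite lebesgue_rV_box /= (bigD1 i1)//=.
rewrite /cyl_lo /cyl_hi (negbTE i10) opprK max_r; last by rewrite addr_ge0// ltW.
rewrite mulrAC (_ : 2 * eps = eps + eps); last by ring.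
apply: ler_wpM2l; first by rewrite addr_ge0// ltW.
have N0 : 0 <= N.*2.+1%:R :> R by [].
apply: ler_prod => i _; rewrite le_max lexx /= ge_max addr_ge0//=.
by rewrite /L; case: ifP => _; [lra|move: N0; lra].
Qed.

Lemma ratio_sqr_bounds (R : realType) (b l m P e : R) : 0 <= b -> b <= P * e ->
  0 < m -> m <= l -> 0 <= b / l ^+ 2 <= P / m ^+ 2 * e.
Proof.
move=> b0 bP m0 ml; rewrite divr_ge0 ?sqr_ge0//= mulrAC.
apply: ler_pM => //; first by rewrite invr_ge0 sqr_ge0.
have l0 := lt_le_trans m0 ml.
by rewrite lef_pV2 ?posrE ?exprn_gt0// ler_pXn2r// ?nnegrE ltW.
Qed.

Theorem theorem4p1 (R : realType) (n : nat) (hn : (2 <= n)%N)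
    (N : nat) (hN : (1 <= N)%N) :
  exists (eps0 : R) (Omega : R -> set 'rV[R]_n),
    0 < eps0 /\
    (forall eps, 0 < eps < eps0 -> bounded_lipschitz_domain (Omega eps)) /\
    forall j : nat, (N + 2 <= j <= (N + 1) * (n + 1))%N ->
      (forall eps, 0 < eps < eps0 ->
        [/\ biharmonic_neumann (Omega eps) j \is a fin_num,
            laplace_neumann (Omega eps) j \is a fin_num &
            (0 < laplace_neumann (Omega eps) j)%E]) /\
      fine (biharmonic_neumann (Omega eps) j)
        / (fine (laplace_neumann (Omega eps) j)) ^+ 2 @[eps --> 0^'+] --> 0.
Proof.
pose i0 : 'I_n := Ordinal (ltnW hn); pose i1 : 'I_n := Ordinal hn.
exists 1, (dumbbell i0 N); split=> //; split.
  by move=> eps; exact: bounded_lipschitz_dumbbell.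
move=> j /andP[Nj]; rewrite !addn1 => jN.
have [m m0 Hm] := @laplace_dumbbell_ge R n i0 N.
have [M M0 HM] := @dumbbell_upper_bounds R n i0 N j jN.
have [C C0 HC] := @lebesgue_tube_le R n i0 i1 N isT.
pose bi eps := biharmonic_neumann (dumbbell i0 N eps : set 'rV[R]_n) j.
pose la eps := laplace_neumann (dumbbell i0 N eps : set 'rV[R]_n) j.
have bi0 eps : 0 < eps < 1 -> (0%:E <= bi eps)%E.
  move=> e01; have OAB := @dumbbell_box R n i0 N _ e01.
  apply: (minmax_ge (measurable_dumbbell i0 N eps) OAB) => b _ _.
  have j0 : (0 < j)%N by apply: leq_trans Nj; rewrite addn2.
  exists (const_mx 1).
    apply/eqP => /rowP/(_ (Ordinal j0)); rewrite !mxE => /eqP; exact/negP/oner_neq0.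
  rewrite mul0r; apply: Rintegral_ge0 => x _.
  by apply: sumr_ge0 => p _; apply: sumr_ge0 => q _; exact: sqr_ge0.
have fin eps : 0 < eps < 1 -> [/\ bi eps \is a fin_num, la eps \is a fin_num & (0 < la eps)%E].
  move=> e01; have [H1 H2] := HM _ e01; have H3 := Hm _ _ e01 Nj; have H4 := bi0 _ e01.
  split; last by apply: lt_le_trans H3; rewrite lte_fin.
  - by rewrite ge0_fin_numE//; apply: le_lt_trans H2 _; exact: ltry.
  - rewrite ge0_fin_numE; first by apply: le_lt_trans H1 _; exact: ltry.
    by apply: le_trans H3; rewrite lee_fin ltW.
split=> //.
pose K := M * C / m ^+ 2.
have near01 : \forall eps \near 0^'+, 0 < (eps : R) < 1.
  by near=> eps; apply/andP; split; near: eps; [exact: nbhs_right_gt|exact: nbhs_right_lt].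
apply: (@squeeze_cvgr _ _ _ _ (fun=> 0) (fun eps => K * eps)).
- apply: filterS near01 => eps e01; have [fb fl l0] := fin _ e01.
  have b0 : 0 <= fine (bi eps) by apply: fine_ge0; exact: bi0.
  have lm : m <= fine (la eps) by rewrite -lee_fin fineK//; exact: Hm.
  have bC : fine (bi eps) <= M * C * eps.
    have [_ H] := HM _ e01; rewrite -lee_fin (fineK fb); apply: le_trans H _.
    by rewrite lee_fin -mulrA; apply: ler_wpM2l; [exact: M0|exact: HC].
  exact: ratio_sqr_bounds b0 bC m0 lm.
- exact: cvg_cst.
- rewrite -[X in _ --> X](mulr0 K); apply: cvgM; first exact: cvg_cst.
  by apply: (@cvg_at_right_filter R R^o id); exact: cvg_id.
Unshelve. all: by end_near. Qed.
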